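(* Let $\mathcal{J}=\mathfrak{S}_\Phi$ be a symmetrically-normed ideal and let $A\in\mathcal{CR}$ with polar decomposition $A=V_A|A|$. (1) If $V\in\mathcal{O}_{\mathcal J}(A)$ and $V$ is a partial isometry, then $\|A-V_A\|_\Phi\le\|A-V\|_\Phi$. (2) If $B\in\mathcal{LO}_{\mathcal J}(A)$ is such that $AB^*|_{R(A)}=I_{R(A)}$ and $BA^*|_{R(B)}=I_{R(B)}$, then $\|A-(A^* )^\dagger\|_\Phi\le\|A-B\|_\Phi$. If moreover $\Phi$ is a strictly Schur-convex symmetric norming function and, for $V$ as in (1), $\|A-V_A\|_\Phi=\|A-V\|_\Phi$, then $V=V_A$. Similarly, if $\Phi$ is strictly Schur-convex and, for $B$ as in (2), $\|A-(A^* )^\dagger\|_\Phi=\|A-B\|_\Phi$, then $B=(A^* )^\dagger$.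
   Context: $\mathcal{H}$ is a separable infinite-dimensional complex Hilbert space, $\mathcal{B}(\mathcal{H})$ the algebra of bounded operators on it, $\mathcal{K}$ the compact operators. $R(A)$, $N(A)$ denote range and nullspace. $\mathcal{CR}=\{A\in\mathcal{B}(\mathcal{H}): R(A)\text{ is closed}\}$; for $A\in\mathcal{CR}$, $A^\dagger$ is the Moore–Penrose inverse (the unique bounded operator with $AA^\dagger A=A$, $A^\dagger AA^\dagger=A^\dagger$, $AA^\dagger=P_{R(A)}$, $A^\dagger A=P_{N(A)^\perp}$, where $P_{\mathcal S}$ denotes the orthogonal projection onto $\mathcal S$). Polar decomposition: $A=V_A|A|$, $|A|=(A^*A)^{1/2}$, $V_A$ the partial isometry with $N(V_A)=N(A)$. For a compact operator $A$, $s(A)=\{s_n(A)\}_{n\ge1}$ is the sequence of singular values in non-increasing order with multiplicity. A symmetric norming function is a norm $\Phi$ on the space $c_{00}$ of finitely supported real sequences with $\Phi(1,0,0,\dots)=1$ and $\Phi(a_1,\dots,a_n,0,\dots)=\Phi(|a_{\sigma(1)}|,\dots,|a_{\sigma(n)}|,0,\dots)$ for every $n\geq 1$ and every permutation $\sigma$ of $\{1,\dots,n\}$. For $A\in\mathcal{K}$, $\|A\|_\Phi=\sup_{k\ge1}\Phi(s_1(A),\dots,s_k(A),0,\dots)\in[0,\infty]$ (with the convention $\|A\|_\Phi=\infty$ for non-compact $A$), and $\mathfrak{S}_\Phi=\{A\in\mathcal{K}:\|A\|_\Phi<\infty\}$; such operator ideals are called symmetrically-normed ideals. For compact $A,B$,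 $s(B)\prec_w s(A)$ means $\sum_{i=1}^n s_i(B)\le\sum_{i=1}^n s_i(A)$ for all $n\geq 1$. $\Phi$ (equivalently $\|\cdot\|_\Phi$) is strictly Schur-convex if whenever $A,B\in\mathfrak{S}_\Phi$ satisfy $s(B)\prec_w s(A)$ and $\|B\|_\Phi=\|A\|_\Phi$, then $s(A)=s(B)$. $\mathcal{G}\ell_{\mathcal J}=\{G\in\mathcal{B}(\mathcal{H}): G\text{ invertible},\ G-I\in\mathcal{J}\}$, $\mathcal{LO}_{\mathcal J}(A)=\{GA: G\in\mathcal{G}\ell_{\mathcal J}\}$, $\mathcal{O}_{\mathcal J}(A)=\{GAK^{-1}: G,K\in\mathcal{G}\ell_{\mathcal J}\}$. *)

(* Defs.v *)
From HB Require Import structures.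
From mathcomp Require Import all_boot all_order all_algebra all_fingroup.
From mathcomp Require Import sesquilinear complex.
From mathcomp Require Import all_classical all_reals all_analysis.

Set Implicit Arguments.
Unset Strict Implicit.
Unset Printing Implicit Defensive.

Import Order.TTheory GRing.Theory Num.Theory.
Import numFieldNormedType.Exports.

Local Open Scope classical_set_scope.
Local Open Scope ring_scope.
Local Open Scope complex_scope.

(* The form ip is linear in its first argument and conjugate-linear in the
   second one. Norms, and hence the operator bounds below, are (real) elements
   of R[i]. *)
HB.mixin Record CompleteNormedModule_isHilbert (R : realType) H
    & CompleteNormedModule R[i] H := {
  ip : {dot H for (Num.conj : R[i] -> R[i])} ;
  sqr_norm_ip : forall x : H, `|x| ^+ 2 = ip x x
}.

#[short(type="hilbertType")]
HB.structure Definition Hilbert (R : realType) :=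
  {H of CompleteNormedModule_isHilbert R H & CompleteNormedModule R[i] H}.

Section HilbertSpace.
Variables (R : realType) (H : hilbertType R).
Implicit Types (A B G K P V X : H -> H) (S : set H).

Definition separable := exists2 D : set H, countable D & dense D.

(* [S] is a linear subspace of dimension [n] *)
Definition has_dim S (n : nat) := exists e : 'I_n -> H,
  (forall c : 'I_n -> R[i], \sum_i c i *: e i = 0 -> forall i, c i = 0) /\
  S = [set x | exists c : 'I_n -> R[i], x = \sum_i c i *: e i].

Definition infinite_dimensional := forall n, ~ has_dim setT n.

(* Operators are plain functions; membership in B(H) is a predicate. *)
Definition bounded_op A :=
  linear A /\ exists M : R[i], forall x, `|A x| <= M * `|x|.

Definition compact_op A :=
  bounded_op A /\ forall S, bounded_set S -> precompact (A @` S).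

Definition nullspace A : set H := [set x | A x = 0].

Definition orthogonal_complement S : set H :=
  [set x | forall y, S y -> ip x y = 0].

Definition is_orthogonal_projection S P :=
  forall x, S (P x) /\ orthogonal_complement S (x - P x).

(* The objects below that are characterised up to uniqueness are obtained with
   [xget], whose default value 0 is irrelevant when the object exists. *)
Definition adjoint A : H -> H :=
  xget 0 [set B | bounded_op B /\ forall x y, ip (A x) y = ip x (B y)].

Definition positive_op P := bounded_op P /\ forall x, 0 <= ip (P x) x.

Definition sqrt_op A : H -> H := xget 0 [set P | positive_op P /\ P \o P = A].

Definition abs_op A : H -> H := sqrt_op (adjoint A \o A).

Definition partial_isometry V :=
  bounded_op V /\
  forall x, orthogonal_complement (nullspace V) x -> `|V x| = `|x|.

Definition polar_isometry A : H -> H :=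
  xget 0 [set V | [/\ partial_isometry V, nullspace V = nullspace A
                    & A = V \o abs_op A]].

Definition closed_range_op A := bounded_op A /\ closed (range A).

Definition moore_penrose A : H -> H :=
  xget 0 [set X | [/\ bounded_op X, A \o X \o A = A, X \o A \o X = X,
    is_orthogonal_projection (range A) (A \o X) &
    is_orthogonal_projection (orthogonal_complement (nullspace A)) (X \o A)]].

Definition eigenspace_op A (l : R) : set H := [set x | A x = l%:C *: x].

(* [s k] is the (k+1)-st largest eigenvalue of [abs_op A], eigenvalues being
   repeated according to multiplicity; the sequence is padded with zeros when
   [A] has finite rank. *)
Definition is_singular_value_seq A (s : nat -> R) :=
  [/\ nonincreasing_seq s, (forall k, 0 <= s k) &
      forall l, 0 < l -> exists2 n, has_dim (eigenspace_op (abs_op A) l) n &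
        ([set k | s k = l] #= `I_n)%card].

Definition singular_values A : nat -> R := xget 0 (is_singular_value_seq A).

Definition weakly_majorized (t s : nat -> R) :=
  forall n, \sum_(i < n.+1) t i <= \sum_(i < n.+1) s i.

Definition c00 : set (nat -> R) :=
  [set a | exists n, forall k, (n <= k)%N -> a k = 0].

(* the sequence (a_0, ..., a_(n-1), 0, 0, ...) *)
Definition pad0 n (a : 'I_n -> R) : nat -> R :=
  fun k => if insub k is Some i then a i else 0.

(* Only the values of [Phi] on [c00] matter. *)
Record symmetric_norming_function (Phi : (nat -> R) -> R) : Prop := {
  snf_ge0 : forall a, c00 a -> 0 <= Phi a ;
  snf_eq0 : forall a, c00 a -> Phi a = 0 -> a = 0 ;
  snfZ : forall (c : R) a, c00 a -> Phi (fun k => c * a k) = `|c| * Phi a ;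
  snf_triangle : forall a b, c00 a -> c00 b ->
    Phi (fun k => a k + b k) <= Phi a + Phi b ;
  snf1 : Phi (fun k => (k == 0)%N%:R) = 1 ;
  snf_sym : forall n (a : 'I_n -> R) (s : 'S_n), (0 < n)%N ->
    Phi (pad0 a) = Phi (pad0 (fun i => `|a (s i)|))
}.

Definition symmetric_norm (Phi : (nat -> R) -> R) A : \bar R :=
  if `[< compact_op A >] then
    ereal_sup (range (fun k : nat =>
      (Phi (pad0 (fun i : 'I_k.+1 => singular_values A i)))%:E))
  else +oo%E.

Definition symmetric_ideal (Phi : (nat -> R) -> R) : set (H -> H) :=
  [set A | compact_op A /\ (symmetric_norm Phi A < +oo)%E].

Definition strictly_schur_convex (Phi : (nat -> R) -> R) :=
  forall A B, symmetric_ideal Phi A -> symmetric_ideal Phi B ->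
    weakly_majorized (singular_values B) (singular_values A) ->
    symmetric_norm Phi B = symmetric_norm Phi A ->
    singular_values A = singular_values B.

Definition is_inverse_op G X :=
  [/\ bounded_op X, G \o X = idfun & X \o G = idfun].

Definition GL_ideal (J : set (H -> H)) : set (H -> H) :=
  [set G | [/\ bounded_op G, exists X, is_inverse_op G X & J (G \- idfun)]].

Definition left_orbit (J : set (H -> H)) A : set (H -> H) :=
  [set G \o A | G in GL_ideal J].

Definition two_sided_orbit (J : set (H -> H)) A : set (H -> H) :=
  [set B | exists G K X, [/\ GL_ideal J G, GL_ideal J K, is_inverse_op K X
                           & B = G \o A \o X]].

End HilbertSpace.

(* Main.v *)
Require Import Defs.
From HB Require Import structures.
From mathcomp Require Import all_boot all_order all_algebra all_fingroup.
From mathcomp Require Import sesquilinear complex ring lra finmap.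
From mathcomp Require Import all_classical all_reals all_analysis.

Set Implicit Arguments.
Unset Strict Implicit.
Unset Printing Implicit Defensive.

Import Order.TTheory GRing.Theory Num.Theory.
Import numFieldNormedType.Exports.

Local Open Scope classical_set_scope.
Local Open Scope ring_scope.
Local Open Scope complex_scope.

(* Write A = U|A| with U = V_A and let P be the projection onto the orthogonal
   complement of N(A). By Ky Fan dominance the norm inequalities reduce to weak
   majorization of singular values.

   (1) If V lies in the orbit then A - V is compact, hence so is W = |A| - P. Let
   W e_i = w_i e_i. The singular values of A - V_A are the |w_i|, and one has to
   show |w_1| + ... + |w_n| <= s_1(A - V) + ... + s_n(A - V). On H x H consider the
   forms 2 Re <Au, v> and 2 Re <Vu, v>, and split the indices into those with w_i > 0
   and those with w_j <= 0. Since N(V) is the image of N(A) under an invertible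
   operator of the form 1 + compact, a Fredholm index argument yields one
   orthonormal vector g_j in the complement of N(V) for each j of the second kind,
   with (g_j, -V g_j) orthogonal to (x, -Ux) whenever x in N(A)^perp is orthogonal to
   the e_j of the second kind. Let K be the span of the (e_i, U e_i) of the first kind
   and of the (g_j, -V g_j). In an orthonormal basis of K starting with the first
   family the trace of the A-form is at least sum (1 + w_i) - sum (1 + w_j); in a
   basis starting with the second family the trace of the V-form is at most the
   number of i's minus the number of j's. The difference of the two traces is at
   most the Ky Fan norm of A - V.

   In the case of equality A - V and A - V_A have the same singular values. Applying
   the inequality to V_A + (1 + d)(A - V_A), for a small d > 0, gives equality in
   Ky Fan's triangle inequality for A - V and d(A - V_A), for all n at once; so the
   two operators have common singular vectors, and V = V_A.

   (2) If Q is the projection onto R(A) then QB is the Moore-Penrose inverse of A^*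
   and A - QB = Q(A - B), so the singular values decrease termwise; when they are
   equal, (1 - Q)(A - B) vanishes on every singular vector of Q(A - B). *)

(** The expression 2 Re <Tu, v> is the quadratic form of the self-adjoint operator on H x H with T
    and its adjoint off the diagonal. Its eigenvalues are the singular values of T with both signs,
    so over n orthonormal pairs it sums to at most s_1(T) + ... + s_n(T); this is why a space K of
    test pairs yields a lower bound for the singular values of A - V. For w_i > 0 the pair (e_i, U
    e_i) is good for A, and V need only be a contraction there. For w_j <= 0 one wants a pair on
    which V has value exactly -1 while A loses no more than 1 + w_j; the pair (e_j, -U e_j) fails,
    as U and V have different initial spaces. The conditions imposed on g_j are infinitely many, so
    counting dimensions does not help; they describe the kernel of a compact perturbation of the
    identity whose range is orthogonal to the e_j, and index zero supplies enough vectors.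
    Positivity of |A| enters as 1 + w_i >= 0. In the equality case A - V_A is enlarged with V_A and
    V kept fixed; A is bounded below on N(A)^perp, which leaves room for the factor 1 + d. *)

Section Cplx.
Variable R : rcfType.
Implicit Types z w : R[i].

Definition csq z : R := complex.Re z ^+ 2 + complex.Im z ^+ 2.

Lemma csq_ge0 z : 0 <= csq z.
Proof. by rewrite addr_ge0 // sqr_ge0. Qed.

Lemma csq_eq0 z : csq z = 0 -> z = 0.
Proof.
case: z => a b /eqP; rewrite /csq /= paddr_eq0 ?sqr_ge0 // !sqrf_eq0.
by move=> /andP[/eqP-> /eqP->].
Qed.

Lemma cReD z w : complex.Re (z + w) = complex.Re z + complex.Re w.
Proof. by case: z w => a b []. Qed.

Lemma cReN z : complex.Re (- z) = - complex.Re z.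
Proof. by case: z. Qed.

Lemma cReB z w : complex.Re (z - w) = complex.Re z - complex.Re w.
Proof. by rewrite cReD cReN. Qed.

Lemma cReM z w : complex.Re (z * w) =
  complex.Re z * complex.Re w - complex.Im z * complex.Im w.
Proof. by case: z w => a b []. Qed.

Lemma cReZ (r : R) z : complex.Re (r%:C * z) = r * complex.Re z.
Proof. by case: z => a b /=; rewrite mul0r subr0. Qed.

Lemma cRe_conj z : complex.Re (Num.conj z) = complex.Re z.
Proof. by case: z. Qed.

Lemma cIm_conj z : complex.Im (Num.conj z) = - complex.Im z.
Proof. by case: z. Qed.

Lemma cRe_sum I (r : seq I) (P : pred I) (F : I -> R[i]) :
  complex.Re (\sum_(i <- r | P i) F i) = \sum_(i <- r | P i) complex.Re (F i).
Proof. by elim/big_rec2: _ => // i y1 y2 _ <-; rewrite cReD. Qed.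

Lemma csq_conj z : csq (Num.conj z) = csq z.
Proof. by case: z => a b; rewrite /csq /= sqrrN. Qed.

Lemma conj_realE (r : R) : Num.conj r%:C = r%:C.
Proof. by apply/eqP; rewrite eq_complex /= oppr0 !eqxx. Qed.

Lemma csqM z w : csq (z * w) = csq z * csq w.
Proof. by case: z w => a b [c d]; rewrite /csq /=; ring. Qed.

Lemma mul_conj z : z * Num.conj z = (csq z)%:C.
Proof.
by case: z => a b; apply/eqP; rewrite eq_complex /csq /=; apply/andP; split;
  apply/eqP; ring.
Qed.

Lemma conj_mul z : Num.conj z * z = (csq z)%:C.
Proof. by rewrite mulrC mul_conj. Qed.

Lemma csq_real (r : R) : csq r%:C = r ^+ 2.
Proof. by rewrite /csq /= expr0n addr0. Qed.

End Cplx.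

(** * Sesquilinear forms *)

Section Form.
Variables (R : realType) (U : lmodType R[i]) (f : {dot U for (Num.conj : R[i] -> R[i])}).
Implicit Types (x y b : U) (bs cs : seq U) (a : R[i]).

Definition sqn x : R := complex.Re (f x x).

Lemma dotC x y : f y x = Num.conj (f x y).
Proof. by rewrite (hermC f) expr0 mul1r. Qed.

Lemma sqnE x : f x x = (sqn x)%:C.
Proof.
rewrite /sqn RRe_real //; apply: ger0_real; exact: dnorm_ge0.
Qed.

Lemma sqn_ge0 x : 0 <= sqn x.
Proof. by rewrite -ler0c -sqnE dnorm_ge0. Qed.

Lemma sqn_eq0 x : sqn x = 0 -> x = 0.
Proof. by move=> h; apply/eqP; rewrite -(dnorm_eq0 f) sqnE h. Qed.

Lemma dotDl x y z : f (x + y) z = f x z + f y z. Proof. exact: linearDl. Qed.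
Lemma dotDr x y z : f z (x + y) = f z x + f z y. Proof. exact: linearDr. Qed.
Lemma dotNl x z : f (- x) z = - f x z. Proof. exact: linearNl. Qed.
Lemma dotNr x z : f z (- x) = - f z x. Proof. exact: linearNr. Qed.
Lemma dotBl x y z : f (x - y) z = f x z - f y z. Proof. exact: linearBl. Qed.
Lemma dotBr x y z : f z (x - y) = f z x - f z y. Proof. exact: linearBr. Qed.
Lemma dot0l z : f 0 z = 0. Proof. exact: linear0l. Qed.
Lemma dot0r z : f z 0 = 0. Proof. exact: linear0r. Qed.
Lemma dotZl a x y : f (a *: x) y = a * f x y. Proof. exact: linearZl_LR. Qed.
Lemma dotZr a x y : f x (a *: y) = Num.conj a * f x y.
Proof. exact: linearZr_LR. Qed.

Lemma dot_suml I (r : seq I) (P : pred I) (F : I -> U) y :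
  f (\sum_(i <- r | P i) F i) y = \sum_(i <- r | P i) f (F i) y.
Proof. by elim/big_rec2: _ => [|i y1 y2 _ <-]; rewrite ?dot0l ?dotDl. Qed.

Lemma dot_sumr I (r : seq I) (P : pred I) (F : I -> U) y :
  f y (\sum_(i <- r | P i) F i) = \sum_(i <- r | P i) f y (F i).
Proof. by elim/big_rec2: _ => [|i y1 y2 _ <-]; rewrite ?dot0r ?dotDr. Qed.

Lemma dot_eq0C x y : f x y = 0 -> f y x = 0.
Proof. by move=> h; rewrite dotC h conjC0. Qed.

Lemma dotReC x y : complex.Re (f y x) = complex.Re (f x y).
Proof. by rewrite dotC cRe_conj. Qed.

Lemma csq_dotC x y : csq (f y x) = csq (f x y).
Proof. by rewrite dotC csq_conj. Qed.

Lemma sqn0 : sqn 0 = 0. Proof. by rewrite /sqn dot0l. Qed.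

Lemma sqnD x y : sqn (x + y) = sqn x + sqn y + 2 * complex.Re (f x y).
Proof. by rewrite /sqn dotDl !dotDr !cReD (dotReC x y); ring. Qed.

Lemma sqnB x y : sqn (x - y) = sqn x + sqn y - 2 * complex.Re (f x y).
Proof. by rewrite /sqn dotBl !dotBr !cReB (dotReC x y); ring. Qed.

Lemma sqnN x : sqn (- x) = sqn x.
Proof. by rewrite /sqn dotNl dotNr opprK. Qed.

Lemma sqnZ a x : sqn (a *: x) = csq a * sqn x.
Proof. by rewrite /sqn dotZl dotZr mulrA mul_conj cReZ. Qed.

Lemma sqnDd x y : f x y = 0 -> sqn (x + y) = sqn x + sqn y.
Proof. by move=> h; rewrite sqnD h /= mulr0 addr0. Qed.

Lemma cauchy_schwarz x y : csq (f x y) <= sqn x * sqn y.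
Proof.
have [y0|y_neq0] := eqVneq (sqn y) 0.
  by rewrite (sqn_eq0 y0) dot0r /csq /= expr0n addr0 mulr_ge0 ?sqn_ge0.
have y_gt0 : 0 < sqn y by rewrite lt_def y_neq0 sqn_ge0.
have := sqn_ge0 ((sqn y)%:C *: x - f x y *: y).
rewrite sqnB !sqnZ dotZl dotZr conj_mul csq_real.
rewrite !cReZ /= => h.
rewrite -(ler_pM2l y_gt0) -subr_ge0; apply: le_trans h _.
by rewrite le_eqVlt; apply/orP; left; apply/eqP; ring.
Qed.

Definition orth2 x y := f x y == 0.

(** [subon], enough for Bessel, admits pairs in which a left singular vector vanishes; [on0] lets
    Gram-Schmidt return 0 for a dependent vector and so keep the length of the list. *)
Definition subon bs := pairwise orth2 bs && all (fun b => sqn b <= 1) bs.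
Definition on0 bs :=
  pairwise orth2 bs && all (fun b => (sqn b == 0) || (sqn b == 1)) bs.
Definition on1 bs := pairwise orth2 bs && all (fun b => sqn b == 1) bs.

Lemma on0_subon bs : on0 bs -> subon bs.
Proof.
by move=> /andP[p a]; rewrite /subon p /=; apply: sub_all a => b /orP[]/eqP-> //.
Qed.

Lemma on1_on0 bs : on1 bs -> on0 bs.
Proof.
by move=> /andP[p a]; rewrite /on0 p /=; apply: sub_all a => b ->; rewrite orbT.
Qed.

Lemma on1_subon bs : on1 bs -> subon bs.
Proof. by move=> /on1_on0/on0_subon. Qed.

Lemma subon_cons b bs :
  subon (b :: bs) = [&& sqn b <= 1, all (orth2 b) bs & subon bs].
Proof. by rewrite /subon /=; case: all; case: pairwise; case: (_ <= _). Qed.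

Lemma on0_cons b bs :
  on0 (b :: bs) = [&& (sqn b == 0) || (sqn b == 1), all (orth2 b) bs & on0 bs].
Proof.
by rewrite /on0 /=; case: (all (orth2 _)); case: pairwise; case: (_ || _).
Qed.

Lemma on1_cons b bs :
  on1 (b :: bs) = [&& sqn b == 1, all (orth2 b) bs & on1 bs].
Proof.
by rewrite /on1 /=; case: (all (orth2 _)); case: pairwise; case: (_ == _).
Qed.

Lemma on0_cat bs cs :
  on0 (bs ++ cs) = [&& allrel orth2 bs cs, on0 bs & on0 cs].
Proof.
rewrite /on0 pairwise_cat all_cat.
by case: allrel; case: (pairwise _ bs); case: (pairwise _ cs); rewrite ?andbF.
Qed.

Lemma bessel bs x : subon bs -> \sum_(b <- bs) csq (f x b) <= sqn x.
Proof.
elim: bs x => [|b bs IH] x; first by rewrite big_nil sqn_ge0.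
rewrite subon_cons big_cons => /and3P[b1 /allP ob son].
have := IH (x - f x b *: b) son.
rewrite (_ : \sum_(_ <- _) _ = \sum_(c <- bs) csq (f x c)); last first.
  apply: eq_big_seq => c /ob/eqP obc.
  by rewrite dotBl dotZl obc mulr0 subr0.
rewrite sqnB sqnZ dotZr conj_mul /= => h.
have := csq_ge0 (f x b); nra.
Qed.

(** The orthogonal projection onto the span once [bs] is [on0]; for other lists merely a finite-rank
    map. *)
Definition dproj bs x : U := \sum_(b <- bs) f x b *: b.

Lemma dprojD bs x y : dproj bs (x + y) = dproj bs x + dproj bs y.
Proof. by rewrite -big_split; apply: eq_bigr => b _; rewrite dotDl scalerDl. Qed.

Lemma dprojZ bs a x : dproj bs (a *: x) = a *: dproj bs x.
Proof.
by rewrite scaler_sumr; apply: eq_bigr => b _; rewrite dotZl scalerA.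
Qed.

Lemma dot_proj bs x y : f (dproj bs x) y = \sum_(b <- bs) f x b * f b y.
Proof. by rewrite dot_suml; apply: eq_bigr => b _; rewrite dotZl. Qed.

Lemma dot_projC bs x y : f (dproj bs x) y = f x (dproj bs y).
Proof.
rewrite dot_proj dot_sumr; apply: eq_bigr => b _.
by rewrite dotZr [f y b]dotC conjCK mulrC.
Qed.

Lemma on0_projE bs b : on0 bs -> b \in bs -> dproj bs b = b.
Proof.
elim: bs => // c bs IH; rewrite on0_cons => /and3P[c1 /allP oc onb].
rewrite inE /dproj big_cons => /orP[/eqP->|bbs].
  rewrite big_seq big1 ?addr0 => [|d /oc/eqP->]; last by rewrite scale0r.
  case/orP: c1 => /eqP c1; last by rewrite sqnE c1 scale1r.
  by rewrite (sqn_eq0 c1) scaler0.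
have /eqP/dot_eq0C-> := oc _ bbs.
by rewrite scale0r add0r; apply: IH.
Qed.

Lemma on0_proj_orth bs x b : on0 bs -> b \in bs -> f (x - dproj bs x) b = 0.
Proof.
by move=> onb bbs; rewrite dotBl dot_projC on0_projE // subrr.
Qed.

Lemma sqn_proj bs x : on0 bs -> sqn (dproj bs x) = \sum_(b <- bs) csq (f x b).
Proof.
move=> onb; rewrite /sqn dot_projC /dproj dot_sumr cRe_sum big_seq [RHS]big_seq.
apply: eq_bigr => b bbs; rewrite dotZr dot_projC on0_projE //.
by rewrite conj_mul.
Qed.

Lemma sqn_subproj bs x : on0 bs ->
  sqn x = \sum_(b <- bs) csq (f x b) + sqn (x - dproj bs x).
Proof.
move=> onb; rewrite -sqn_proj // -[in LHS](subrK (dproj bs x) x) [LHS]sqnDd; last first.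
  rewrite /dproj dot_sumr -/(dproj bs x) big_seq big1 // => b bbs.
  by rewrite dotZr on0_proj_orth // mulr0.
by rewrite addrC.
Qed.

Lemma normalize x : exists2 u : U, (sqn u == 0) || (sqn u == 1) &
  exists2 r : R, 0 <= r & x = r%:C *: u /\ exists a : R[i], u = a *: x.
Proof.
have [x0|x_neq0] := eqVneq (sqn x) 0.
  exists 0; rewrite ?sqn0 ?eqxx //; exists 0 => //.
  by split; [rewrite scaler0 (sqn_eq0 x0)|exists 0; rewrite scale0r].
have x_gt0 : 0 < sqn x by rewrite lt_def x_neq0 sqn_ge0.
have s_gt0 : 0 < Num.sqrt (sqn x) by rewrite sqrtr_gt0.
exists ((Num.sqrt (sqn x))^-1%:C *: x).
  rewrite sqnZ csq_real exprVn sqr_sqrtr ?sqn_ge0 // mulVf // eqxx orbT //.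
exists (Num.sqrt (sqn x)); first exact: ltW.
split; last by eexists.
by rewrite scalerA -rmorphM /= divff ?scale1r // gt_eqF.
Qed.

Definition lin_sub (S : set U) :=
  [/\ S 0, forall x y, S x -> S y -> S (x + y) & forall a x, S x -> S (a *: x)].

Lemma lin_sub_sum (S : set U) I (r : seq I) (F : I -> U) : lin_sub S ->
  (forall i, S (F i)) -> S (\sum_(i <- r) F i).
Proof. by move=> [S0 SD _] SF; elim/big_rec: _ => // i x _; apply: SD. Qed.

Lemma lin_sub_sum_seq (S : set U) (bs : seq U) (F : U -> U) : lin_sub S ->
  (forall i, i \in bs -> S (F i)) -> S (\sum_(i <- bs) F i).
Proof.
by move=> [S0 SD _] SF; rewrite big_seq; elim/big_rec: _ => // i x /SF; apply: SD.
Qed.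

Lemma lin_subB (S : set U) x y : lin_sub S -> S x -> S y -> S (x - y).
Proof. by move=> [_ SD SZ] Sx Sy; rewrite -scaleN1r; apply/SD/SZ. Qed.

Lemma lin_sub_proj bs : lin_sub [set x | dproj bs x = x].
Proof.
split => /= [|x y|a x].
- by rewrite -[0 in LHS](scale0r 0) dprojZ scale0r.
- by rewrite dprojD => -> ->.
- by rewrite dprojZ => ->.
Qed.

(** Extending [bs] by [cs] and extending [cs] by [bs] give the same span: the third clause yields
    one inclusion, the last one the other. A dependent vector contributes 0, which preserves the
    size. *)
Lemma gram_schmidt bs cs : on0 bs -> exists hs,
  [/\ on0 (bs ++ hs), size hs = size cs,
      forall c, c \in cs -> dproj (bs ++ hs) c = c &
      forall S : set U, lin_sub S -> (forall b, b \in bs -> S b) ->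
        (forall c, c \in cs -> S c) -> forall h, h \in hs -> S h].
Proof.
move=> onb; elim: cs => [|c cs [hs [onh shs prc hS]]].
  by exists [::]; rewrite cats0.
have [u u01 [r r0 [cE [a uE]]]] := normalize (c - dproj (bs ++ hs) c).
have uo b : b \in bs ++ hs -> f u b = 0.
  by move=> bin; rewrite uE dotZl on0_proj_orth // mulr0.
have onu : on0 (bs ++ rcons hs u).
  rewrite -rcons_cat -cats1 on0_cat onh /on0 /= u01 !andbT.
  apply/allrelP => x y xin; rewrite inE => /eqP->.
  by apply/eqP/dot_eq0C/uo.
exists (rcons hs u); split => //.
- by rewrite size_rcons shs.
- have pr x : dproj (bs ++ hs) x = x -> dproj (bs ++ rcons hs u) x = x.
    move=> px; have h := @lin_sub_sum_seq _ (bs ++ hs) (fun b => f x b *: b)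
      (lin_sub_proj (bs ++ rcons hs u)).
    rewrite -px; apply: h => b bin /=.
    rewrite dprojZ on0_projE //.
    by move: bin; rewrite !mem_cat mem_rcons inE => /orP[]->; rewrite ?orbT.
  move=> d; rewrite inE => /orP[/eqP->|/prc/pr//].
  have -> : c = dproj (bs ++ hs) c + r%:C *: u by rewrite -cE addrC subrK.
  have [_ SD SZ] := lin_sub_proj (bs ++ rcons hs u).
  apply: SD; last first.
    by apply: SZ => /=; apply: on0_projE => //; rewrite mem_cat mem_rcons inE eqxx orbT.
  apply: pr.
  apply: (@lin_sub_sum_seq _ (bs ++ hs) (fun b => f c b *: b)
    (lin_sub_proj (bs ++ hs))) => b bin /=.
  by rewrite dprojZ on0_projE.
- move=> S Ssub Sb Sc h; rewrite mem_rcons inE => /orP[/eqP->|hin]; last first.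
    by apply: (hS S) => // d din; apply: Sc; rewrite inE din orbT.
  have [S0 SD SZ] := Ssub.
  rewrite uE; apply: (SZ); apply: lin_subB => //; first by apply: Sc; rewrite inE eqxx.
  apply: lin_sub_sum_seq => // b; rewrite mem_cat => /orP[/Sb|bin]; first exact: SZ.
  by apply/SZ/(hS S) => // d din; apply: Sc; rewrite inE din orbT.
Qed.

(** Both sides equal the double sum of [f b c * t c b]: expand the first argument of [t b b] along
    [cs], or the second argument of [t c c] along [bs]. *)
Lemma trace_indep (t : U -> U -> R[i]) bs cs :
  (forall y, linear_for *%R (t^~ y)) ->
  (forall x y z, t x (y + z) = t x y + t x z) ->
  (forall a x y, t x (a *: y) = Num.conj a * t x y) ->
  (forall b, b \in bs -> dproj cs b = b) -> (forall c, c \in cs -> dproj bs c = c) ->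
  \sum_(b <- bs) t b b = \sum_(c <- cs) t c c.
Proof.
move=> tl tD tZ pb pc.
have t0l y : t 0 y = 0 by have := tl y (-1) 0 0; rewrite scaleN1r oppr0 addr0 mulN1r addNr.
have t0r x : t x 0 = 0 by rewrite -(scale0r 0) tZ conjC0 mul0r.
have tsl I (r : seq I) (g : I -> R[i]) (F : I -> U) y :
    t (\sum_(i <- r) g i *: F i) y = \sum_(i <- r) g i * t (F i) y.
  elim: r => [|i r IH]; first by rewrite !big_nil.
  by rewrite !big_cons tl IH.
have tsr I (r : seq I) (g : I -> R[i]) (F : I -> U) x :
    t x (\sum_(i <- r) g i *: F i) = \sum_(i <- r) Num.conj (g i) * t x (F i).
  elim: r => [|i r IH]; first by rewrite !big_nil.
  by rewrite !big_cons tD tZ IH.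
transitivity (\sum_(b <- bs) \sum_(c <- cs) f b c * t c b).
  by apply: eq_big_seq => b /pb {1}<-; rewrite /dproj tsl.
rewrite exchange_big; apply: eq_big_seq => c /pc {4}<- /=.
by rewrite /dproj tsr; apply: eq_bigr => b _; rewrite -dotC.
Qed.

End Form.

(** * The inner product on H x H *)

Section PairForm.
Variables (R : realType) (U : lmodType R[i]) (f : {dot U for (Num.conj : R[i] -> R[i])}).

Definition pair_form (f : U -> U -> R[i]) (p q : U * U) : R[i] :=
  f p.1 q.1 + f p.2 q.2.

Let pf : U * U -> U * U -> R[i] := pair_form f.

Lemma pair_form_linl p : GRing.linear_for *%R (pf ^~ p).
Proof.
by move=> a x y; rewrite /pf /pair_form /= !dotDl !dotZl mulrDr addrACA.
Qed.

Lemma pair_form_linr p : GRing.linear_for (Num.conj \; *%R) (pf p).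
Proof.
by move=> a x y; rewrite /pf /pair_form /= !dotDr !dotZr mulrDr addrACA.
Qed.

HB.instance Definition _ := bilinear_isBilinear.Build R[i] (U * U)%type (U * U)%type
  R[i] *%R (Num.conj \; *%R) pf (pair_form_linl, pair_form_linr).

Lemma pair_form_sym p q : pf p q = (-1) ^+ false * Num.conj (pf q p).
Proof.
by rewrite expr0 mul1r /pf /pair_form rmorphD /= -!dotC.
Qed.

HB.instance Definition _ := isHermitianSesquilinear.Build R[i] (U * U)%type false
  (Num.conj : R[i] -> R[i]) pf pair_form_sym.

Lemma pair_form_gt0 p : p != 0 -> 0 < pf p p.
Proof.
case: p => x y; rewrite /pf /pair_form /= => pn0.
rewrite lt_def addr_ge0 ?dnorm_ge0 // andbT paddr_eq0 ?dnorm_ge0 //.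
rewrite !dnorm_eq0; apply: contra_neqN pn0 => /andP[/eqP-> /eqP->] //.
Qed.

HB.instance Definition _ := isDotProduct.Build R[i] (U * U)%type pf pair_form_gt0.

Definition pair_dot : {dot (U * U)%type for (Num.conj : R[i] -> R[i])} := pf.

Lemma pair_dotE p q : pair_dot p q = f p.1 q.1 + f p.2 q.2.
Proof. by []. Qed.

Lemma sqn_pair p : sqn pair_dot p = sqn f p.1 + sqn f p.2.
Proof. by rewrite /sqn pair_dotE cReD. Qed.

End PairForm.

(** * Norms, sequential limits and the projection theorem *)

Section Basic.
Variables (R : realType) (H : hilbertType R).
Implicit Types (x y z : H) (A B : H -> H) (a : R[i]) (S : set H).

Definition hn x : R := sqn (@ip R H) x.
Definition nm x : R := Num.sqrt (hn x).

Lemma hn_ge0 x : 0 <= hn x. Proof. exact: sqn_ge0. Qed.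
Lemma nm_ge0 x : 0 <= nm x. Proof. exact: sqrtr_ge0. Qed.

Lemma nm2 x : nm x ^+ 2 = hn x. Proof. by rewrite sqr_sqrtr // hn_ge0. Qed.

Lemma ipxx x : ip x x = (hn x)%:C. Proof. exact: sqnE. Qed.

Lemma normE x : `|x| = (nm x)%:C.
Proof.
have := sqr_norm_ip x; rewrite ipxx -nm2 rmorphXn /= => /eqP.
by rewrite eqrXn2 // ?lecR ?nm_ge0 // => /eqP.
Qed.

Lemma hn0 : hn 0 = 0. Proof. exact: sqn0. Qed.
Lemma nm0 : nm 0 = 0. Proof. by rewrite /nm hn0 sqrtr0. Qed.
Lemma hn_eq0 x : hn x = 0 -> x = 0. Proof. exact: sqn_eq0. Qed.
Lemma nm_eq0 x : nm x = 0 -> x = 0.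
Proof. by move=> h; apply: hn_eq0; rewrite -nm2 h expr0n. Qed.

Lemma nm_gt0 x : x != 0 -> 0 < nm x.
Proof. by move=> xn0; rewrite lt_def nm_ge0 andbT; apply: contra_neq xn0 => /nm_eq0. Qed.

Lemma hnN x : hn (- x) = hn x. Proof. exact: sqnN. Qed.
Lemma nmN x : nm (- x) = nm x. Proof. by rewrite /nm hnN. Qed.
Lemma nmBC x y : nm (x - y) = nm (y - x). Proof. by rewrite -nmN opprB. Qed.
Lemma hnZ a x : hn (a *: x) = csq a * hn x. Proof. exact: sqnZ. Qed.
Lemma hnZr (r : R) x : hn (r%:C *: x) = r ^+ 2 * hn x.
Proof. by rewrite hnZ csq_real. Qed.
Lemma nmZ (a : R[i]) x : nm (a *: x) = Num.sqrt (csq a) * nm x.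
Proof. by rewrite /nm hnZ sqrtrM ?csq_ge0. Qed.
Lemma nmZr (r : R) x : 0 <= r -> nm (r%:C *: x) = r * nm x.
Proof. by move=> r0; rewrite nmZ csq_real sqrtr_sqr ger0_norm. Qed.

Lemma hnD x y : hn (x + y) = hn x + hn y + 2 * complex.Re (ip x y).
Proof. exact: sqnD. Qed.
Lemma hnB x y : hn (x - y) = hn x + hn y - 2 * complex.Re (ip x y).
Proof. exact: sqnB. Qed.
Lemma hnDd x y : ip x y = 0 -> hn (x + y) = hn x + hn y.
Proof. exact: sqnDd. Qed.

Lemma le_nm x y : (nm x <= nm y) = (hn x <= hn y).
Proof. by rewrite -!nm2 ler_sqr // nnegrE nm_ge0. Qed.

Lemma nm_leP x (r : R) : 0 <= r -> (nm x <= r) = (hn x <= r ^+ 2).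
Proof. by move=> r0; rewrite -nm2 ler_sqr // nnegrE ?nm_ge0. Qed.

Lemma nm_ltP x (r : R) : 0 <= r -> (nm x < r) = (hn x < r ^+ 2).
Proof. by move=> r0; rewrite -nm2 ltr_sqr // nnegrE ?nm_ge0. Qed.

Lemma nmD x y : nm (x + y) <= nm x + nm y.
Proof. by have := ler_normD x y; rewrite !normE -rmorphD /= lecR. Qed.

Lemma nmB x y : nm (x - y) <= nm x + nm y.
Proof. by rewrite -(nmN y) nmD. Qed.

Lemma nm_tri x y z : nm (x - z) <= nm (x - y) + nm (y - z).
Proof. by apply: le_trans (nmD _ _); rewrite addrA subrK. Qed.

Lemma csq_ip x y : csq (ip x y) <= hn x * hn y. Proof. exact: cauchy_schwarz. Qed.

Lemma Re_le_csq a : complex.Re a ^+ 2 <= csq a.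
Proof. by rewrite /csq lerDl sqr_ge0. Qed.

Lemma Re_ip_le x y : complex.Re (ip x y) <= nm x * nm y.
Proof.
have h : `|complex.Re (ip x y)| <= nm x * nm y.
  rewrite -ler_sqr ?nnegrE ?mulr_ge0 ?nm_ge0 // real_normK ?num_real //.
  by rewrite exprMn !nm2; apply: le_trans (csq_ip x y); apply: Re_le_csq.
exact: le_trans (ler_norm _) h.
Qed.

Lemma cpos_real a : 0 < a -> exists2 r : R, 0 < r & a = r%:C.
Proof.
by case: a => r i; rewrite ltcE /= => /andP[/eqP-> r0]; exists r.
Qed.

Definition tends (u : nat -> H) x :=
  forall e : R, 0 < e -> exists N, forall n, (N <= n)%N -> nm (u n - x) < e.

Lemma hballE x (e : R) y : ball x e%:C y = (nm (x - y) < e) :> Prop.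
Proof. by rewrite -ball_normE /= normE ltcR. Qed.

Lemma complete_seq (u : nat -> H) :
  (forall e : R, 0 < e -> exists N, forall m n, (N <= m)%N -> (N <= n)%N ->
    nm (u m - u n) < e) -> exists x, tends u x.
Proof.
move=> cu.
have /cauchy_cvg : cauchy (u @ \oo).
  apply/cauchy_exP => _ /cpos_real[e e0 ->].
  have [N hN] := cu _ e0; exists (u N); exists N => // n /= Nn.
  by rewrite hballE hN.
move=> /cvg_ex[l ul]; exists l => e e0.
have e0C : (0 : R[i]) < e%:C by rewrite ltcR.
move/cvg_ballP: ul => /(_ _ e0C)[N _ hN]; exists N => n /hN.
by rewrite hballE nmBC.
Qed.

Lemma tends_unique u x y : tends u x -> tends u y -> x = y.
Proof.
move=> ux uy; apply/eqP; rewrite -subr_eq0; apply/negPn/negP => /nm_gt0 d0.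
have d2 : 0 < nm (x - y) / 2 by rewrite divr_gt0.
have [N hN] := ux _ d2; have [M hM] := uy _ d2.
have := hN _ (leq_maxl N M); have := hM _ (leq_maxr N M).
by have := nm_tri x (u (maxn N M)) y; rewrite [nm (x - u _)]nmBC; lra.
Qed.

Lemma small_tends u x (r : nat -> R) : (forall n, nm (u n - x) <= r n) ->
  (forall e, 0 < e -> exists N, forall n, (N <= n)%N -> r n < e) -> tends u x.
Proof.
move=> h hr e /hr[N hN]; exists N => n /hN; exact: le_lt_trans.
Qed.

Lemma inv_small (e : R) : 0 < e ->
  exists N, forall n, (N <= n)%N -> (n.+1%:R)^-1 < e :> R.
Proof.
move=> e0; exists (Num.truncn e^-1) => n hn.
rewrite invf_plt ?posrE //; apply: lt_le_trans (truncnS_gt _) _.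
by rewrite ler_nat ltnS.
Qed.

Definition seq_closed S := forall u x, (forall n, S (u n)) -> tends u x -> S x.

Lemma closed_seq_closed S : closed S -> seq_closed S.
Proof.
move=> cS u x Su ux; apply: cS => B /nbhs_ballP[_ /= /cpos_real[e e0 ->] hB].
have [N /(_ N (leqnn N)) hN] := ux _ e0; exists (u N); split => //.
by apply: hB; rewrite hballE nmBC.
Qed.

Lemma projection_thm S : lin_sub S -> seq_closed S ->
  forall x, exists p, S p /\ forall y, S y -> ip (x - p) y = 0.
Proof.
move=> lS cS x; have [S0 SD SZ] := lS.
pose E := [set nm (x - y) | y in S].
have infE : has_inf E.
  by split; [exists (nm (x - 0)), 0|exists 0 => _ [y _ <-]; apply: nm_ge0].
pose d := inf E.
have d0 : 0 <= d.
  by apply: lb_le_inf; [exact: infE.1|move=> _ [y _ <-]; apply: nm_ge0].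
have d_le y : S y -> d <= nm (x - y).
  by move=> Sy; apply: ge_inf; [exact: infE.2|exists y].
have ex n : exists y, S y /\ nm (x - y) < d + n.+1%:R^-1.
  have n0 : 0 < n.+1%:R^-1 :> R by rewrite invr_gt0.
  by have [_ [y Sy <-] h] := inf_adherent n0 infE; exists y.
have /boolp.choice[u hu] := ex.
have i1 n : 0 < (n.+1%:R^-1 : R) <= 1.
  rewrite invr_gt0 ltr0n /=; by rewrite invf_le1 ?ltr0n // ler1n.
(* Parallelogram law: with excesses a, b over the distance d, 2(d + a)^2 + 2(d + b)^2 - 4d^2 is at
   most (4d + 2)(a + b) because a, b <= 1. *)
have par m n : hn (u m - u n) <= (4 * d + 2) * (m.+1%:R^-1 + n.+1%:R^-1).
  have := d_le (2^-1%:C *: (u m + u n)) (SZ _ _ (SD _ _ (hu m).1 (hu n).1)).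
  have -> : x - 2^-1%:C *: (u m + u n) = 2^-1%:C *: ((x - u m) + (x - u n)).
    rewrite addrACA -opprD scalerBr; congr (_ - _).
    by rewrite -mulr2n -(scaler_nat 2 x) scalerA -(rmorph_nat (real_complex R)) -rmorphM
      mulVf ?pnatr_eq0 // scale1r.
  have -> : u m - u n = (x - u n) - (x - u m).
    by rewrite opprB [RHS]addrC addrA subrK.
  rewrite nmZr ?invr_ge0 // => h3; rewrite hnB -!nm2.
  have [_ h1] := hu m; have [_ h2] := hu n.
  have := hnD (x - u m) (x - u n); rewrite -!nm2 (dotReC _ (x - u m) (x - u n)).
  have := i1 m; have := i1 n; move: h1 h2 h3.
  have := nm_ge0 (x - u m); have := nm_ge0 (x - u n).
  have := nm_ge0 (x - u m + (x - u n)).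
  move: (nm _) (nm _) (nm _) (complex.Re _) (m.+1%:R^-1) (n.+1%:R^-1) => q r p c a b.
  move=> p0 r0 q0 h1 h2 h3 /andP[b0 b1] /andP[a0 a1] e.
  have : (2 * d) ^+ 2 <= p ^+ 2.
    rewrite ler_sqr ?nnegrE ?mulr_ge0 //; lra.
  have : q ^+ 2 <= (d + a) ^+ 2 by rewrite ler_sqr ?nnegrE ?addr_ge0 //; lra.
  have : r ^+ 2 <= (d + b) ^+ 2 by rewrite ler_sqr ?nnegrE ?addr_ge0 //; lra.
  nra.
have [p up] : exists p, tends u p.
  apply: complete_seq => e e0.
  have e4 : 0 < e ^+ 2 / (8 * d + 4) by rewrite divr_gt0 ?exprn_gt0 //; lra.
  have [N hN] := inv_small e4; exists N => m n /hN hm /hN hn.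
  rewrite nm_ltP 1?ltW //; apply: le_lt_trans (par m n) _.
  have D0 : 0 < 4 * d + 2 by lra.
  rewrite -ltr_pdivlMl // mulrC.
  have -> : e ^+ 2 / (4 * d + 2) = e ^+ 2 / (8 * d + 4) + e ^+ 2 / (8 * d + 4).
    by field; rewrite !gt_eqF //; lra.
  exact: ltrD.
have Sp : S p by apply: cS up => n; exact: (hu n).1.
have dp : nm (x - p) <= d.
  apply/ler_addgt0Pr => e e0; have e2 : 0 < e / 2 by lra.
  have [N hN] := up _ e2; have [M hM] := inv_small e2.
  have := hN _ (leq_maxl N M); have := hM _ (leq_maxr N M).
  have := nm_tri x (u (maxn N M)) p; have := (hu (maxn N M)).2.
  move: (_^-1) (nm _) (nm _) (nm _) => /= a b c g; lra.
exists p; split => // y Sy.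
have [y0|yn0] := eqVneq y 0; first by rewrite y0 dot0r.
have hy : 0 < hn y.
  by rewrite lt_def hn_ge0 andbT; apply: contra_neq yn0 => /hn_eq0.
pose c := ip (x - p) y.
(* The best shift of [p] along [y]: it would lower the squared distance by |c|^2 / |y|^2, so
   minimality forces c = 0. *)
have := le_trans dp (d_le (p + (c * ((hn y)^-1)%:C) *: y) (SD _ _ Sp (SZ _ _ Sy))).
rewrite le_nm opprD addrA (hnB (x - p)) hnZ dotZr csqM csq_real.
have -> : Num.conj (c * (hn y)^-1%:C) * ip (x - p) y = (csq c * (hn y)^-1)%:C.
  rewrite rmorphM /= mulrAC conj_mul.
  by rewrite rmorphM conj_realE.
rewrite /= => h; apply: csq_eq0; rewrite -/c.
have iy : 0 < (hn y)^-1 by rewrite invr_gt0.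
have e1 : csq c * (hn y)^-1 ^+ 2 * hn y = csq c * (hn y)^-1.
  by rewrite expr2 -!mulrA mulVf ?mulr1 // gt_eqF.
have := csq_ge0 c; rewrite e1 in h; nra.
Qed.

End Basic.

(** * Bounded operators *)

Section Operators.
Variables (R : realType) (H : hilbertType R).
Implicit Types (x y z : H) (A B P : H -> H) (a : R[i]) (S : set H).

Lemma opD A : linear A -> forall x y, A (x + y) = A x + A y.
Proof. by move=> lA x y; rewrite -[x in LHS]scale1r lA scale1r. Qed.

Lemma op0 A : linear A -> A 0 = 0.
Proof. by move=> lA; apply: (@addIr _ (A 0)); rewrite -(opD lA) !add0r. Qed.

Lemma opZ A : linear A -> forall a x, A (a *: x) = a *: A x.
Proof. by move=> lA a x; rewrite -[a *: x]addr0 lA (op0 lA) addr0. Qed.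

Lemma opN A : linear A -> forall x, A (- x) = - A x.
Proof. by move=> lA x; rewrite -scaleN1r (opZ lA) scaleN1r. Qed.

Lemma opB A : linear A -> forall x y, A (x - y) = A x - A y.
Proof. by move=> lA x y; rewrite (opD lA) (opN lA). Qed.

Lemma op_sum A : linear A -> forall I (r : seq I) (F : I -> H),
  A (\sum_(i <- r) F i) = \sum_(i <- r) A (F i).
Proof.
by move=> lA I r F; elim/big_rec2: _ => [|i u v _ <-]; rewrite ?(op0 lA) ?(opD lA).
Qed.

Lemma mk_linear A : (forall x y, A (x + y) = A x + A y) ->
  (forall a x, A (a *: x) = a *: A x) -> linear A.
Proof. by move=> AD AZ a x y; rewrite AD AZ. Qed.

Definition bounded_lin A := linear A /\
  exists M : R, 0 <= M /\ forall x, nm (A x) <= M * nm x.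

Lemma bopP A : bounded_op A <-> bounded_lin A.
Proof.
split=> -[lA [M hM]]; split => //.
  exists `|complex.Re M|; split => // x.
  have := hM x; rewrite !normE lecE cReM /= mulr0 subr0 => /andP[_ h].
  by apply: le_trans h _; rewrite ler_wpM2r ?nm_ge0 // ler_norm.
exists M%:C => x; rewrite !normE -rmorphM /= lecR; exact: hM.2.
Qed.

Lemma bop_id : bounded_lin (@idfun H).
Proof. by split => //; exists 1; split => // x; rewrite mul1r. Qed.

Lemma bop_comp A B : bounded_lin A -> bounded_lin B -> bounded_lin (A \o B).
Proof.
move=> [lA [M [M0 hM]]] [lB [N [N0 hN]]]; split.
  by apply: mk_linear => [x y|a x] /=; rewrite ?(opD lB) ?(opD lA) ?(opZ lB) ?(opZ lA).
exists (M * N); split; first exact: mulr_ge0.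
by move=> x /=; apply: le_trans (hM _) _; rewrite -mulrA ler_wpM2l.
Qed.

Lemma bopD A B : bounded_lin A -> bounded_lin B -> bounded_lin (fun x => A x + B x).
Proof.
move=> [lA [M [M0 hM]]] [lB [N [N0 hN]]]; split.
  by apply: mk_linear => [x y|a x] /=; rewrite ?(opD lA) ?(opD lB) ?(opZ lA) ?(opZ lB) ?scalerDr //
    addrACA.
exists (M + N); split; first exact: addr_ge0.
by move=> x /=; apply: le_trans (nmD _ _) _; rewrite mulrDl lerD.
Qed.

Lemma bopZ a A : bounded_lin A -> bounded_lin (fun x => a *: A x).
Proof.
move=> [lA [M [M0 hM]]]; split.
  by apply: mk_linear => [x y|b x] /=; rewrite ?(opD lA) ?(opZ lA) ?scalerDr // !scalerA mulrC.
exists (Num.sqrt (csq a) * M); split; first by rewrite mulr_ge0 ?sqrtr_ge0.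
by move=> x /=; rewrite nmZ -mulrA ler_wpM2l ?sqrtr_ge0.
Qed.

Lemma bopN A : bounded_lin A -> bounded_lin (fun x => - A x).
Proof.
by move=> /(bopZ (-1)); congr (bounded_lin _); apply/funext => x; rewrite scaleN1r.
Qed.

Lemma bopB A B : bounded_lin A -> bounded_lin B -> bounded_lin (fun x => A x - B x).
Proof. by move=> bA /bopN; apply: bopD. Qed.

Lemma bop_rank1 y z : bounded_lin (fun x => ip x y *: z).
Proof.
split; first by apply: mk_linear => [u v|a u]; rewrite ?dotDl ?dotZl ?scalerDl ?scalerA.
exists (nm y * nm z); split; first by rewrite mulr_ge0 ?nm_ge0.
move=> x; rewrite nmZ mulrAC ler_wpM2r ?nm_ge0 //.
rewrite -ler_sqr ?nnegrE ?mulr_ge0 ?sqrtr_ge0 ?nm_ge0 //.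
by rewrite exprMn !nm2 sqr_sqrtr ?csq_ge0 // mulrC csq_ip.
Qed.

Lemma bop0 : bounded_lin (fun _ => 0).
Proof.
split; first by apply: mk_linear => *; rewrite ?addr0 ?scaler0.
by exists 0; split => // x; rewrite nm0 mul0r.
Qed.

Lemma bop_sum I (r : seq I) (F : I -> H -> H) : (forall i, bounded_lin (F i)) ->
  bounded_lin (fun x => \sum_(i <- r) F i x).
Proof.
move=> bF; elim: r => [|i r IH].
  by have := bop0; congr (bounded_lin _); apply/funext => x; rewrite big_nil.
by have := bopD (bF i) IH; congr (bounded_lin _); apply/funext => x; rewrite big_cons.
Qed.

Lemma bop_proj (bs : seq H) : bounded_lin (dproj (@ip R H) bs).
Proof. by apply: bop_sum => b; apply: bop_rank1. Qed.

Lemma tends_bop A (u : nat -> H) x : bounded_lin A -> tends u x -> tends (A \o u) (A x).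
Proof.
move=> [lA [M [M0 hM]]] ux e e0.
have M1 : 0 < M + 1 by lra.
have e1 : 0 < e / (M + 1) by rewrite divr_gt0.
have [N hN] := ux _ e1; exists N => n /hN /= h.
rewrite -(opB lA); apply: le_lt_trans (hM _) _.
move: h; rewrite ltr_pdivlMr //; have := nm_ge0 (u n - x); nra.
Qed.

Lemma tendsD (u v : nat -> H) x y : tends u x -> tends v y ->
  tends (fun n => u n + v n) (x + y).
Proof.
move=> ux vy e e0; have e2 : 0 < e / 2 by rewrite divr_gt0.
have [N hN] := ux _ e2; have [M hM] := vy _ e2; exists (maxn N M) => n.
rewrite geq_max => /andP[/hN h1 /hM h2].
have -> : u n + v n - (x + y) = (u n - x) + (v n - y) by rewrite opprD addrACA.
by apply: le_lt_trans (nmD _ _) _; lra.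
Qed.

Lemma tends_cst x : tends (fun _ => x) x.
Proof. by move=> e e0; exists 0%N => n _; rewrite subrr nm0. Qed.

Lemma tends_shift (u : nat -> H) x : tends u x -> tends (fun n => u n.+1) x.
Proof. by move=> ux e /ux[N hN]; exists N => n Nn; apply: hN; apply: leqW. Qed.

Lemma eq_tends (u v : nat -> H) x : u =1 v -> tends u x -> tends v x.
Proof. by move=> /funext->. Qed.

Lemma ip_tends0 (u : nat -> H) x y : tends u x -> (forall n, ip (u n) y = 0) ->
  ip x y = 0.
Proof.
move=> ux uy; have [->|yn0] := eqVneq y 0; first by rewrite dot0r.
have t1 := tends_bop (bop_rank1 y y) ux.
have t2 : tends ((fun x => ip x y *: y) \o u) 0.
  by apply: eq_tends (tends_cst 0) => n /=; rewrite uy scale0r.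
by have /eqP := tends_unique t1 t2; rewrite scaler_eq0 (negPf yn0) orbF => /eqP.
Qed.

Lemma orth_lin_sub S : lin_sub (orthogonal_complement S).
Proof.
split => [y _|x y Sx Sy z Sz|a x Sx z Sz]; first by rewrite dot0l.
  by rewrite dotDl Sx // Sy // addr0.
by rewrite dotZl Sx // mulr0.
Qed.

Lemma null_seq_closed A : bounded_lin A -> seq_closed (nullspace A).
Proof.
move=> bA u x Su ux; apply: tends_unique (tends_bop bA ux) _.
by apply: eq_tends (tends_cst 0) => n /=; rewrite Su.
Qed.

Lemma null_lin_sub A : linear A -> lin_sub (nullspace A).
Proof.
move=> lA; split => [|x y /= Sx Sy|a x /= Sx]; rewrite /nullspace /=.
- exact: op0.
- by rewrite (opD lA) Sx Sy addr0.
- by rewrite (opZ lA) Sx scaler0.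
Qed.

Lemma ip_inj x y : (forall z, ip x z = ip y z) -> x = y.
Proof.
move=> h; apply/eqP; rewrite -subr_eq0; apply/eqP/hn_eq0.
by rewrite /hn /sqn dotBl h subrr.
Qed.

Lemma ip_injr x y : (forall z, ip z x = ip z y) -> x = y.
Proof. by move=> h; apply: ip_inj => z; rewrite dotC h -dotC. Qed.

Lemma riesz (phi : H -> R[i]) : (forall a x y, phi (a *: x + y) = a * phi x + phi y) ->
  (exists M : R, forall x, csq (phi x) <= M * hn x) -> exists z, forall x, phi x = ip x z.
Proof.
move=> lphi [M hM].
have phi0 : phi 0 = 0.
  by have := lphi (-1) 0 0; rewrite scaler0 addr0 mulN1r addNr.
have phiZ a x : phi (a *: x) = a * phi x by rewrite -[a *: x]addr0 lphi phi0 addr0.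
have phiB x y : phi (x - y) = phi x - phi y.
  by rewrite -scaleN1r addrC lphi mulN1r addrC.
have [all0|] := pselect (forall x, phi x = 0).
  by exists 0 => x; rewrite all0 dot0r.
move=> /existsNP[x0 phix0].
pose S := [set x | phi x = 0].
have lS : lin_sub S.
  split => [|x y /= hx hy|a x /= hx]; rewrite /S /=.
  - by [].
  - by rewrite -[x]scale1r lphi hx hy mulr0 addr0.
  - by rewrite phiZ hx mulr0.
have cS : seq_closed S.
  move=> u x Su ux; apply: csq_eq0; apply/eqP; rewrite eq_le csq_ge0 andbT.
  apply/ler_addgt0Pr => e e0; rewrite add0r.
  have M1 : 0 < `|M| + 1 by have := normr_ge0 M; lra.
  have e1 : 0 < e / (`|M| + 1) by rewrite divr_gt0.
  have e2 : 0 < Num.sqrt (e / (`|M| + 1)) by rewrite sqrtr_gt0.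
  have [N /(_ N (leqnn N))] := ux _ e2.
  rewrite nm_ltP ?sqrtr_ge0 // sqr_sqrtr ?(ltW e1) // ltr_pdivlMr // => h.
  have := hM (u N - x); rewrite phiB Su sub0r.
  have -> : csq (- phi x) = csq (phi x) by rewrite -mulN1r csqM
    /csq /= sqrrN expr1n oppr0 expr0n addr0 mul1r.
  move=> h2; have := hn_ge0 (u N - x); have := ler_norm M; nra.
have [p [Sp po]] := projection_thm lS cS x0.
pose w := x0 - p.
have phiw : phi w != 0 by rewrite phiB Sp subr0; apply/eqP.
have wn0 : hn w != 0.
  by apply: contra_neq phiw => /hn_eq0->.
exists ((Num.conj (phi w) * (hn w)^-1%:C) *: w) => x.
have Sx : S (x - (phi x / phi w) *: w).
  by rewrite /S /= phiB phiZ mulfVK // subrr.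
have := dot_eq0C (po _ Sx); rewrite dotBl dotZl -/w => /eqP; rewrite subr_eq0 => /eqP h.
rewrite dotZr h ipxx rmorphM /= conjCK.
have -> : Num.conj ((hn w)^-1%:C) = (hn w)^-1%:C by exact: conj_realE.
rewrite mulrACA [phi w * _]mulrC mulfVK // -rmorphM mulVf //= mulr1 //.
Qed.

Lemma adjoint_exists A : bounded_lin A ->
  exists B, bounded_lin B /\ forall x y, ip (A x) y = ip x (B y).
Proof.
move=> bA; have [lA [M [M0 hM]]] := bA.
have /boolp.choice[B hB] : forall y, exists z, forall x, ip (A x) y = ip x z.
  move=> y; apply: riesz; first by move=> a x z; rewrite (opD lA) (opZ lA) dotDl dotZl.
  exists (M ^+ 2 * hn y) => x; apply: le_trans (csq_ip _ _) _.
  rewrite -!nm2 [leRHS]mulrAC ler_wpM2r ?sqr_ge0 // -exprMn.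
  by rewrite ler_sqr ?nnegrE ?mulr_ge0 ?nm_ge0.
exists B; split; last by move=> x y; apply: hB.
split.
  apply: mk_linear => [x y|a x]; apply: ip_injr => z.
    by rewrite dotDr -!hB dotDr.
  by rewrite dotZr -!hB dotZr.
exists M; split => // y.
have h : hn (B y) <= M * nm (B y) * nm y.
  rewrite /hn /sqn -hB; apply: le_trans (Re_ip_le _ _) _.
  by rewrite ler_wpM2r ?nm_ge0.
have [->|/nm_gt0 By0] := eqVneq (B y) 0; first by rewrite nm0 mulr_ge0 ?nm_ge0.
by rewrite -(ler_pM2l By0) -expr2 nm2 mulrCA mulrA.
Qed.

Lemma adjointP A : bounded_lin A ->
  bounded_lin (adjoint A) /\ forall x y, ip (A x) y = ip x (adjoint A y).
Proof.
move=> /adjoint_exists[B [bB hB]].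
have : [set B | bounded_op B /\ forall x y, ip (A x) y = ip x (B y)] (adjoint A).
  by apply: xgetPex; exists B; split => //; apply/bopP.
by move=> [/bopP bA hA].
Qed.

Lemma adj_bop A : bounded_lin A -> bounded_lin (adjoint A). Proof. by move=> /adjointP[]. Qed.

Lemma adjE A : bounded_lin A -> forall x y, ip (A x) y = ip x (adjoint A y).
Proof. by move=> /adjointP[]. Qed.

Lemma adjEr A : bounded_lin A -> forall x y, ip (adjoint A x) y = ip x (A y).
Proof. by move=> bA x y; rewrite dotC -adjE // -dotC. Qed.

Definition self_adjoint A := bounded_lin A /\ forall x y, ip (A x) y = ip x (A y).

Lemma positive_sa P : positive_op P -> self_adjoint P.
Proof.
move=> [/bopP bP P0]; split => //.
have lP := bP.1.
pose g x y := ip (P x) y - ip x (P y).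
have gxx x : g x x = 0.
  rewrite /g [ip x _]dotC; have := P0 x; case: (ip _ _) => r i.
  rewrite lecE /= => /andP[/eqP-> _]; apply/eqP; rewrite eq_complex /=.
  by rewrite !subrr oppr0 subrr !eqxx.
have gD x y : g x y + g y x = 0.
  have := gxx (x + y); rewrite /g (opD lP) !dotDl !dotDr.
  have := gxx x; have := gxx y; rewrite /g => /eqP + /eqP.
  rewrite !subr_eq0 => /eqP-> /eqP->; move: (ip _ _) (ip _ _) (ip _ _) (ip _ _).
  move=> a b c d; move: (ip _ _) (ip _ _) => e f <-; ring.
(* [g] vanishes on the diagonal and is therefore antisymmetric; evaluated at i y, sesquilinearity
   makes it symmetric as well, hence zero. *)
have gI x y : g x y - g y x = 0.
  have := gD x ('i%C *: y); rewrite /g !(opZ lP) !dotZl !dotZr.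
  rewrite (_ : Num.conj 'i%C = - 'i%C); last first.
    by apply/eqP; rewrite eq_complex /= oppr0 !eqxx.
  move: (ip _ _) (ip _ _) (ip _ _) (ip _ _) => a b c d h.
  have : 'i%C * (- (a - b) + (c - d)) = 0 :> R[i] by rewrite -[RHS]h; ring.
  move=> /eqP; rewrite mulf_eq0 => /orP[|/eqP h2].
    by rewrite eq_complex /= oner_eq0 andbF.
  by rewrite -[RHS]oppr0 -h2; ring.
move=> x y; apply/eqP; rewrite -subr_eq0 -/(g x y); apply/eqP.
have := gD x y; have := gI x y; move: (g x y) (g y x) => a b h1 h2.
have : 2 * a = 0 by rewrite -[RHS]addr0 -{1}h1 -h2; ring.
by move=> /eqP; rewrite mulf_eq0 pnatr_eq0 => /eqP.
Qed.

End Operators.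

(** * Square roots of positive operators *)

Section SquareRoot.
Variables (R : realType) (H : hilbertType R).
Implicit Types (x y z : H) (A B P : H -> H) (a : R[i]) (S : set H).

(** The recursion of [sqrt_iter] for the scalar X = 1. It dominates the norms of the iterates, and
    its increments dominate their consecutive differences, so convergence reduces to that of a
    bounded monotone real sequence. *)
Fixpoint sqrt_bound n : R := if n is m.+1 then (1 + sqrt_bound m ^+ 2) / 2 else 0.

Lemma sqrt_bound01 n : 0 <= sqrt_bound n <= 1.
Proof.
elim: n => [|n /andP[h0 h1]] /=; first by rewrite lexx ler01.
by apply/andP; split; nra.
Qed.

Lemma sqrt_bound_le n : sqrt_bound n <= sqrt_bound n.+1.
Proof. by have /andP[h0 h1] := sqrt_bound01 n => /=; nra. Qed.

Lemma sqrt_bound_cauchy (e : R) : 0 < e -> exists N, forall n, (N <= n)%N ->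
  sqrt_bound n - sqrt_bound N < e.
Proof.
move=> e0; have sE : has_sup (range sqrt_bound).
  split; first by exists 0, 0%N.
  by exists 1 => _ [n _ <-]; have /andP[] := sqrt_bound01 n.
have [_ [N _ <-] hN] := sup_adherent e0 sE; exists N => n _.
have := @sup_upper_bound _ _ sE (sqrt_bound n) (ex_intro2 _ _ n I erefl); lra.
Qed.

(* Y_0 = 0 and Y_(n+1) = (X + Y_n^2)/2 converges in norm to a solution of
   (1 - Y)^2 = 1 - X as soon as |X| <= 1. *)
Fixpoint sqrt_iter (X : H -> H) n : H -> H :=
  if n is m.+1 then fun x => 2^-1%:C *: (X x + sqrt_iter X m (sqrt_iter X m x))
  else fun _ => 0.

Section Iter.
Variable X : H -> H.
Hypotheses (saX : self_adjoint X) (X1 : forall x, nm (X x) <= nm x).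
Let Y := sqrt_iter X.

Lemma sqrt_iter_bop n : bounded_lin (Y n).
Proof.
elim: n => [|n IH]; first exact: bop0.
exact: bopZ (bopD saX.1 (bop_comp IH IH)).
Qed.

Lemma sqrt_iter_sa n x y : ip (Y n x) y = ip x (Y n y).
Proof.
elim: n x y => [|n IH] x y /=; first by rewrite dot0l dot0r.
rewrite dotZl dotZr dotDl dotDr saX.2 !IH; congr (_ * _).
by apply/eqP; rewrite eq_complex /= oppr0 !eqxx.
Qed.

Lemma sqrt_iter_le n x : nm (Y n x) <= sqrt_bound n * nm x.
Proof.
elim: n x => [|n IH] x; first by rewrite /= nm0 mul0r.
rewrite [Y _]/= nmZr ?invr_ge0 //=; have /andP[h0 h1] := sqrt_bound01 n.
have h2 := nmD (X x) (Y n (Y n x)); have h3 := IH (Y n x).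
have h4 := ler_wpM2l h0 (IH x).
rewrite -/Y; have h5 := X1 x.
rewrite mulrAC mulrC ler_pM2r ?invr_gt0 // mulrDl mul1r expr2 -mulrA.
apply: le_trans h2 _; apply: lerD => //; exact: le_trans h3 h4.
Qed.

Lemma sqrt_iter_le1 n x : nm (Y n x) <= nm x.
Proof.
apply: le_trans (sqrt_iter_le n x) _; have /andP[h0 h1] := sqrt_bound01 n.
by rewrite ler_piMl ?nm_ge0.
Qed.

(** Halving Y_(n+1)^2 - Y_n^2 = Y_(n+1) (Y_(n+1) - Y_n) + (Y_(n+1) - Y_n) Y_n and bounding each
    factor reproduces exactly the next increment of [sqrt_bound]. *)
Lemma sqrt_iter_step n x :
  nm (Y n.+1 x - Y n x) <= (sqrt_bound n.+1 - sqrt_bound n) * nm x.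
Proof.
elim: n x => [|n IH] x.
  by have := sqrt_iter_le 1 x; rewrite /= !subr0.
have -> : Y n.+2 x - Y n.+1 x = 2^-1%:C *:
    (Y n.+1 (Y n.+1 x - Y n x) + (Y n.+1 (Y n x) - Y n (Y n x))).
  rewrite (opB (sqrt_iter_bop n.+1).1) addrA subrK.
  rewrite -[Y n.+2 x]/(2^-1%:C *: (X x + Y n.+1 (Y n.+1 x))).
  rewrite -[Y n.+1 x in X in _ - X]/(2^-1%:C *: (X x + Y n (Y n x))).
  by rewrite -scalerBr opprD addrACA subrr add0r.
rewrite nmZr ?invr_ge0 //.
have /andP[q0 q1] := sqrt_bound01 n; have /andP[p0 p1] := sqrt_bound01 n.+1.
have d0 : 0 <= sqrt_bound n.+1 - sqrt_bound n by rewrite subr_ge0 sqrt_bound_le.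
have h1 := le_trans (sqrt_iter_le n.+1 (Y n.+1 x - Y n x)) (ler_wpM2l p0 (IH x)).
have h2 := le_trans (IH (Y n x)) (ler_wpM2l d0 (sqrt_iter_le n x)).
have h3 := le_trans (nmD _ _) (lerD h1 h2).
rewrite -[sqrt_bound n.+2]/((1 + sqrt_bound n.+1 ^+ 2) / 2).
apply: le_trans (ler_wpM2l _ h3) _; rewrite ?invr_ge0 //.
have e1 : sqrt_bound n.+1 = (1 + sqrt_bound n ^+ 2) / 2 by [].
move: (sqrt_bound n.+1) (sqrt_bound n) e1 => p q e1.
rewrite -subr_ge0 le_eqVlt; apply/orP; left; apply/eqP.
transitivity (((1 + q ^+ 2) / 2 - p) * nm x); last by field.
by rewrite -e1 subrr mul0r.
Qed.

Lemma sqrt_iter_dist m n x :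
  nm (Y (n + m) x - Y n x) <= (sqrt_bound (n + m) - sqrt_bound n) * nm x.
Proof.
elim: m => [|m IH]; first by rewrite addn0 !subrr nm0 mul0r.
rewrite addnS; apply: le_trans (nm_tri _ (Y (n + m) x) _) _.
by have := sqrt_iter_step (n + m) x; move: IH; lra.
Qed.

Lemma sqrt_iter_lim : exists Z : H -> H, [/\ forall x, tends (Y^~ x) (Z x), bounded_lin Z,
  (forall x, nm (Z x) <= nm x), (forall x y, ip (Z x) y = ip x (Z y)) &
  forall x, Z x = 2^-1%:C *: (X x + Z (Z x))].
Proof.
have /boolp.choice[Z hZ] : forall x, exists l, tends (Y^~ x) l.
  move=> x; apply: complete_seq => e e0.
  have n1 : 0 < nm x + 1 by have := nm_ge0 x; lra.
  have e2 : 0 < e / 2 / (nm x + 1) by rewrite !divr_gt0.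
  have [N hN] := sqrt_bound_cauchy e2; exists N.
  have h n : (N <= n)%N -> nm (Y n x - Y N x) < e / 2.
    move=> Nn; have := sqrt_iter_dist (n - N) N x; rewrite subnKC // => h.
    apply: le_lt_trans h _; have := hN _ Nn; rewrite ltr_pdivlMr // => h.
    have := nm_ge0 x.
    have : sqrt_bound N <= sqrt_bound n.
      by apply: (homo_leq (@lexx _ _) le_trans) Nn => i; apply: sqrt_bound_le.
    nra.
  move=> m n /h hm /h hn; apply: le_lt_trans (nm_tri _ (Y N x) _) _.
  by rewrite [nm (Y N x - _)]nmBC; lra.
have lY n := (sqrt_iter_bop n).1.
have lZ : linear Z.
  move=> a x y; apply: tends_unique (hZ _) _.
  apply: eq_tends (tendsD (tends_bop (bopZ a (bop_id H)) (hZ x)) (hZ y)) => n /=.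
  by rewrite lY.
have Z1 x : nm (Z x) <= nm x.
  apply/ler_addgt0Pr => e e0; have [N /(_ N (leqnn N)) hN] := hZ x _ e0.
  have := nmD (Z x - Y N x) (Y N x); rewrite subrK nmBC.
  have := sqrt_iter_le1 N x; lra.
have bZ : bounded_lin Z by split => //; exists 1; split => // x; rewrite mul1r.
exists Z; split => //.
- move=> x y; apply/eqP; rewrite -subr_eq0; apply/eqP.
  pose z := ip (Z x) y - ip x (Z y).
  apply: csq_eq0; apply/eqP; rewrite eq_le csq_ge0 andbT -/z.
  apply/ler_addgt0Pr => e e0; rewrite add0r.
  have M1 : 0 < nm x + nm y + 1 by have := nm_ge0 x; have := nm_ge0 y; lra.
  have e1 : 0 < Num.sqrt e / (2 * (nm x + nm y + 1)).
    by rewrite divr_gt0 ?sqrtr_gt0 // mulr_gt0.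
  have [N1 hN1] := hZ x _ e1; have [N2 hN2] := hZ y _ e1.
  have := hN1 _ (leq_maxl N1 N2); have := hN2 _ (leq_maxr N1 N2).
  set n := maxn _ _ => h2 h1.
  have -> : z = ip (Z x - Y n x) y - ip x (Z y - Y n y).
    by rewrite dotBl dotBr sqrt_iter_sa /z; ring.
  set a := ip _ _; set b := ip _ _.
  have ha : csq a <= (Num.sqrt e / 2) ^+ 2.
    apply: le_trans (csq_ip _ _) _; rewrite -!nm2 -exprMn ler_sqr ?nnegrE ?mulr_ge0 ?nm_ge0
      ?divr_ge0 ?sqrtr_ge0 //.
    rewrite nmBC; move: h1; rewrite ltr_pdivlMr ?mulr_gt0 //.
    have := nm_ge0 (Y n x - Z x); have := nm_ge0 x; have := nm_ge0 y.
    rewrite /=; nra.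
  have hb : csq b <= (Num.sqrt e / 2) ^+ 2.
    apply: le_trans (csq_ip _ _) _; rewrite -!nm2 -exprMn ler_sqr ?nnegrE ?mulr_ge0 ?nm_ge0
      ?divr_ge0 ?sqrtr_ge0 //.
    rewrite [nm (Z y - _)]nmBC; move: h2; rewrite ltr_pdivlMr ?mulr_gt0 //.
    have := nm_ge0 (Y n y - Z y); have := nm_ge0 x; have := nm_ge0 y.
    rewrite /=; nra.
  have : csq (a - b) <= 2 * csq a + 2 * csq b.
    case: (a) (b) => p q [r s]; rewrite /csq /=.
    have := sqr_ge0 (p + r); have := sqr_ge0 (q + s); nra.
  move: ha hb; rewrite expr_div_n sqr_sqrtr ?(ltW e0) //; lra.
- move=> x; apply: tends_unique (tends_shift (hZ x)) _ => /=.
  have t : tends (fun n => X x + Y n (Y n x)) (X x + Z (Z x)).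
    apply: tendsD; first exact: tends_cst.
    move=> e e0; have e2 : 0 < e / 2 by lra.
    have [N1 hN1] := hZ x _ e2; have [N2 hN2] := hZ (Z x) _ e2.
    exists (maxn N1 N2) => n; rewrite geq_max => /andP[/hN1 h1 /hN2 h2].
    apply: le_lt_trans (nm_tri _ (Y n (Z x)) _) _.
    rewrite -(opB (lY n)); have := sqrt_iter_le1 n (Y n x - Z x); lra.
  exact: tends_bop (bopZ _ (bop_id H)) t.
Qed.

End Iter.

(** For M above the norm of A, X = 1 - M^-2 A*A is a contraction. The limit Y of the iteration gives
    the root M (1 - Y), which is positive because |Y| <= 1. *)
Lemma psqrt_exists A : bounded_lin A -> exists P, positive_op P /\ P \o P = adjoint A \o A.
Proof.
move=> bA; have [lA [M0 [M00 hM0]]] := bA.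
pose M := M0 + 1.
have M_gt0 : 0 < M by rewrite /M; lra.
have hM x : nm (A x) <= M * nm x.
  by apply: le_trans (hM0 x) _; rewrite ler_wpM2r ?nm_ge0 // /M; lra.
have bA' := adj_bop bA.
pose T x := (M ^- 2)%:C *: adjoint A (A x).
pose X x := x - T x.
have bT : bounded_lin T by apply: bopZ (bop_comp bA' bA).
have cM : Num.conj ((M ^- 2)%:C) = (M ^- 2)%:C by exact: conj_realE.
have sT x y : ip (T x) y = ip x (T y).
  by rewrite dotZl dotZr cM adjEr // adjE.
have saX : self_adjoint X.
  split; first exact: bopB (bop_id H) bT.
  by move=> x y; rewrite dotBl dotBr sT.
have hA' x : nm (adjoint A (A x)) <= M * nm (A x).
  set y := A x; set z := adjoint A y.
  have h : hn z <= nm y * (M * nm z).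
    rewrite /hn /sqn /z adjEr //; apply: le_trans (Re_ip_le _ _) _.
    by rewrite ler_wpM2l ?nm_ge0.
  have [->|/nm_gt0 z0] := eqVneq z 0; first by rewrite nm0 mulr_ge0 ?nm_ge0 // ltW.
  by rewrite -(ler_pM2l z0) -expr2 nm2; apply: le_trans h _; rewrite le_eqVlt; apply/orP; left;
    apply/eqP; ring.
have X1 x : nm (X x) <= nm x.
  rewrite le_nm /X hnB dotZr cM cReZ -adjE // -/(sqn _ (A x)) -/(hn (A x)).
  rewrite hnZr -!nm2.
  have := hA' x; move: (nm (adjoint _ _)) (nm_ge0 (adjoint A (A x))) => q q0.
  move: (nm (A x)) (nm_ge0 (A x)) => r r0 qr.
  have h : q ^+ 2 <= M ^+ 2 * r ^+ 2.
    by rewrite -exprMn ler_sqr ?nnegrE // mulr_ge0 // ltW.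
  have i0 : 0 < M ^- 2 by rewrite invr_gt0 exprn_gt0.
  have h2 : (M ^- 2) ^+ 2 * q ^+ 2 <= M ^- 2 * r ^+ 2.
    rewrite [(M ^- 2) ^+ 2]expr2 -mulrA ler_pM2l // ler_pdivrMl ?exprn_gt0 //.
  have := sqr_ge0 r; nra.
have [Y [_ bY Y1 sY YE]] := sqrt_iter_lim saX X1.
exists (fun x => M%:C *: (x - Y x)); split.
  split; first by apply/bopP; apply: bopZ (bopB (bop_id H) bY).
  move=> x; rewrite dotZl dotBl ipxx.
  have h : complex.Im (ip (Y x) x) = 0.
    have := congr1 (@complex.Im _) (sY x x); rewrite [ip x _]dotC cIm_conj.
    move: (complex.Im _) => r; lra.
  have hle : complex.Re (ip (Y x) x) <= hn x.
    by apply: le_trans (Re_ip_le _ _) _; rewrite -nm2 expr2 ler_wpM2r ?nm_ge0.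
  move: h hle; case: (ip (Y x) x) => r i /= -> hle.
  rewrite lecE /= !(mul0r, mulr0, oppr0, subr0, addr0) eqxx /=.
  by rewrite mulr_ge0 ?subr_ge0 // ltW.
apply/funext => x /=.
have lY := bY.1.
rewrite (opZ lY) -scalerBr scalerA (opB lY).
have YY : Y (Y x) = 2%:C *: Y x - X x.
  rewrite [in RHS](YE x) scalerA -rmorphM /= divff ?pnatr_eq0 // scale1r.
  by rewrite addrC addKr.
rewrite YY /X.
have -> : x - Y x - (Y x - (2%:C *: Y x - (x - T x))) = T x.
  have -> : 2%:C *: Y x = Y x + Y x.
    by rewrite -mulr2n -(scaler_nat 2 (Y x)) -(rmorph_nat (real_complex R)).
  rewrite !opprB; move: (T x) => t.
  by rewrite [Y x + Y x + _ - _]addrAC addrK addrA subrK addrC subrK.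
rewrite /T scalerA -!rmorphM /= -expr2 mulfV ?scale1r //.
by rewrite expf_neq0 // gt_eqF.
Qed.

Lemma abs_opP A : bounded_lin A -> positive_op (abs_op A) /\
  forall x, abs_op A (abs_op A x) = adjoint A (A x).
Proof.
move=> /psqrt_exists[P hP].
have : [set P | positive_op P /\ P \o P = adjoint A \o A] (abs_op A).
  by apply: xgetPex; exists P.
move=> [h1 h2]; split => // x; exact: (congr1 (fun f => f x) h2).
Qed.

Lemma abs_sa A : bounded_lin A -> self_adjoint (abs_op A).
Proof. by move=> /abs_opP[/positive_sa]. Qed.

Lemma abs_bop A : bounded_lin A -> bounded_lin (abs_op A).
Proof. by move=> /abs_sa[]. Qed.

Lemma abs_ip A x y : bounded_lin A -> ip (abs_op A x) (abs_op A y) = ip (A x) (A y).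
Proof.
by move=> bA; rewrite -(abs_sa bA).2 (abs_opP bA).2 adjEr.
Qed.

Lemma abs_nm A x : bounded_lin A -> nm (abs_op A x) = nm (A x).
Proof. by move=> bA; rewrite /nm /hn /sqn abs_ip. Qed.

Lemma abs_Re_ge0 A x : bounded_lin A -> 0 <= complex.Re (ip (abs_op A x) x).
Proof. by move=> /abs_opP[[_ /(_ x)]]; rewrite lecE => /andP[]. Qed.

End SquareRoot.

(** * Compact operators *)

Section Compactness.
Variables (R : realType) (H : hilbertType R).
Implicit Types (x y z : H) (A B C W : H -> H) (a : R[i]) (S : set H).

Notation hproj := (dproj (@ip R H)).

Definition perp (zs : seq H) x := forall z, z \in zs -> ip x z = 0.

Lemma perp_lin_sub zs : lin_sub (perp zs).
Proof.
split => [z _|x y px py z zin|a x px z zin]; first by rewrite dot0l.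
  by rewrite dotDl px // py // addr0.
by rewrite dotZl px // mulr0.
Qed.

Lemma perp_seq_closed zs : seq_closed (perp zs).
Proof. by move=> u x Su ux z zin; apply: (ip_tends0 ux) => n; apply: Su. Qed.

Lemma perp_hproj bs x : on0 (@ip R H) bs -> perp bs (x - hproj bs x).
Proof. by move=> onb z zin; apply: on0_proj_orth. Qed.

Lemma perp_onify zs : exists2 bs, on0 (@ip R H) bs &
  forall x, perp bs x -> perp zs x.
Proof.
have [hs [onh _ pr _]] := gram_schmidt (f := @ip R H) (bs := [::]) zs isT.
exists hs => // x px z /pr <-; rewrite dot_sumr big_seq big1 // => b bin.
by rewrite dotZr px // mulr0.
Qed.

(* Hilbert-space form of compactness: C is small on the orthogonal complement of
   a finite-dimensional subspace, i.e. C is a norm limit of finite rank operators. *)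
Definition approximable C := forall e : R, 0 < e -> exists zs, forall x, perp zs x ->
  nm (C x) <= e * nm x.

Definition seq_compact C := forall u : nat -> H, (forall n, nm (u n) <= 1) ->
  exists l, forall e : R, 0 < e -> forall N, exists2 n, (N <= n)%N &
    nm (C (u n) - l) < e.

Lemma compact_seqc C : compact_op C -> seq_compact C.
Proof.
move=> [/bopP bC cC] u hu.
pose S := [set x : H | nm x <= 1].
have bS : bounded_set S.
  exists 1; split; first exact: real1.
  move=> M M1 x /= Sx; rewrite normE; apply: le_trans (ltW M1).
  by rewrite lecR.
have := cC _ bS; rewrite precompactE => cS.
have FS : ((C \o u) @ \oo) (closure (C @` S)).
  by exists 0%N => // n _; apply: subset_closure; exists (u n) => //; apply: hu.
have [l [_ hl]] := cS _ _ FS.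
exists l => e e0 N.
have h1 : ((C \o u) @ \oo) [set C (u n) | n in [set n | (N <= n)%N]].
  by exists N => // n /= Nn; exists n.
have h2 : nbhs l (ball l e%:C) by apply: nbhsx_ballx; rewrite ltcR.
have [_ [[n Nn <-] hn]] := hl _ _ h1 h2.
by exists n => //; move: hn; rewrite hballE nmBC.
Qed.

Lemma real_grid (M d : R) : 0 < d -> exists L : seq R,
  forall r, `|r| <= M -> exists2 y, y \in L & `|r - y| <= d.
Proof.
move=> d0; pose N := (Num.truncn (2 * M / d)).+1.
exists [seq - M + d * k%:R | k <- iota 0 N] => r hr.
have rM : 0 <= r + M by move: hr; rewrite ler_norml => /andP[]; lra.
pose k := Num.truncn ((r + M) / d).
have kd0 : 0 <= (r + M) / d by rewrite divr_ge0 // ltW.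
have /andP[k1 k2] := truncn_itv kd0.
exists (- M + d * k%:R).
  apply/mapP; exists k => //; rewrite mem_iota add0n leq0n /= ltnS.
  apply: le_truncn; rewrite ler_pM2r ?invr_gt0 //.
  by move: hr; rewrite ler_norml => /andP[]; lra.
move: k1 k2; rewrite -/k ler_pdivlMr // ltr_pdivrMr // -natr1 => k1 k2.
rewrite ler_norml; apply/andP; split; lra.
Qed.

(** Total boundedness of the image of a ball under a finite-rank map: coordinates have modulus at
    most M and are rounded to a grid, one vector of [bs] at a time. *)
Lemma span_grid C (bs : seq H) (M e : R) : 0 < e -> subon (@ip R H) bs ->
  exists L : seq H, forall x, nm x <= M -> exists2 y, y \in L &
    nm (\sum_(b <- bs) ip x b *: C b - y) <= e.
Proof.
elim: bs e => [|b bs IH] e e0.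
  by exists [:: 0] => x _; exists 0; rewrite ?inE ?eqxx // big_nil subrr nm0 ltW.
rewrite subon_cons => /and3P[b1 _ sb].
have e2 : 0 < e / 2 by lra.
have [L hL] := IH _ e2 sb.
(* The added 1 keeps the mesh finite when [C b] is 0. The real and imaginary errors are at most one
   mesh each, so rounding this coordinate costs at most e/2. *)
have nC : 0 < 4 * (nm (C b) + 1) by have := nm_ge0 (C b); lra.
have d0 : 0 < e / (4 * (nm (C b) + 1)) by rewrite divr_gt0.
have [G hG] := real_grid M d0.
exists [seq p.1 *: C b + p.2 | p <- [seq (q, y) | q <- [seq (r +i* i)%C | r <- G, i <- G], y <- L]].
move=> x xM; have [y yL hy] := hL x xM.
have hc : csq (ip x b) <= M ^+ 2.
  apply: le_trans (csq_ip _ _) _; rewrite -nm2.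
  have := nm_ge0 x; have := sqn_ge0 (@ip R H) b; rewrite /hn; move: b1.
  move: (sqn _ _) (nm x) xM => p q qM p1 p0 q0.
  have : q ^+ 2 <= M ^+ 2 by rewrite ler_sqr ?nnegrE //; lra.
  have := sqr_ge0 q; nra.
have M0 : 0 <= M by apply: le_trans xM; apply: nm_ge0.
have [r rG hr] : exists2 r, r \in G & `|complex.Re (ip x b) - r| <= e / (4 * (nm (C b) + 1)).
  apply: hG; rewrite -ler_sqr ?nnegrE // real_normK ?num_real //.
  by apply: le_trans hc; apply: Re_le_csq.
have [i iG hi] : exists2 i, i \in G & `|complex.Im (ip x b) - i| <= e / (4 * (nm (C b) + 1)).
  apply: hG; rewrite -ler_sqr ?nnegrE // real_normK ?num_real //.
  by apply: le_trans hc; rewrite /csq lerDr sqr_ge0.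
exists ((r +i* i)%C *: C b + y).
  apply/mapP; exists ((r +i* i)%C, y) => //; apply: allpairs_f => //.
  exact: allpairs_f.
rewrite big_cons opprD addrACA -scalerBl.
apply: le_trans (nmD _ _) _.
suff : nm ((ip x b - (r +i* i)%C) *: C b) <= e / 2 by move: hy; lra.
have -> : e / 2 = 2 * (e / (4 * (nm (C b) + 1))) * (nm (C b) + 1).
  by field; rewrite gt_eqF //; have := nm_ge0 (C b); lra.
rewrite nmZ; apply: ler_pM; rewrite ?sqrtr_ge0 ?nm_ge0 ?lerDl //.
move: hr hi d0; set d := e / _; case: (ip x b) => p q /= hr hi d0.
have d2 : 0 <= 2 * d by lra.
rewrite -[2 * d](ger0_norm d2) -sqrtr_sqr ler_wsqrtr //.
rewrite /csq /=; move: hr hi; rewrite -ler_sqr ?nnegrE ?(ltW d0) // real_normK ?num_real // => hr.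
rewrite -ler_sqr ?nnegrE ?(ltW d0) // real_normK ?num_real // => hi.
rewrite exprMn; have := sqr_ge0 d; move: hr hi; rewrite !expr2; nra.
Qed.

(** For every radius, finitely many balls cover the closure of the image, so an ultrafilter on it
    contains one of them; it is thus Cauchy, and completeness gives a limit. *)
Lemma appr_compact C : bounded_lin C -> approximable C -> compact_op C.
Proof.
move=> bC aC; split; first exact/bopP.
move=> S [M0 [rM0 hM0]].
have [M M_gt0 hM] : exists2 M : R, 0 < M & forall x, S x -> nm x <= M.
  have M1 : M0 < (`|complex.Re M0| + 1)%:C.
    rewrite -(RRe_real rM0) ltcR /=.
    by apply: le_lt_trans (ler_norm _) _; rewrite ltrDl ltr01.
  exists (`|complex.Re M0| + 1); first by rewrite ltr_wpDl.
  by move=> x Sx; have := hM0 _ M1 x Sx; rewrite /= normE lecR.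
rewrite precompactE compact_ultra => F uF FS.
have cF : cauchy F.
  apply/cauchy_exP => _ /cpos_real[e e0 ->].
  have e3 : 0 < e / 4 / M by rewrite !divr_gt0.
  have [zs hzs] := aC _ e3.
  have [bs onb hbs] := perp_onify zs.
  have e4 : 0 < e / 4 by lra.
  have [L hL] := span_grid C M e4 (on0_subon onb).
  have cov : closure (C @` S) `<=` [set z | exists2 y, y \in L & ball y e%:C z].
    move=> z /(_ (ball z (e / 4)%:C)) [|_ [[x Sx <-] hz]].
      by apply: nbhsx_ballx; rewrite ltcR.
    move: hz; rewrite hballE => hz; have xM := hM _ Sx.
    have [y yL hy] := hL x xM; exists y => //; rewrite hballE.
    have h1 : nm (C x - \sum_(b <- bs) ip x b *: C b) <= e / 4.
      have -> : \sum_(b <- bs) ip x b *: C b = C (hproj bs x).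
        by rewrite (op_sum bC.1); apply: eq_bigr => b _; rewrite (opZ bC.1).
      rewrite -(opB bC.1).
      apply: le_trans (hzs _ (hbs _ (perp_hproj x onb))) _.
      rewrite mulrAC ler_pdivrMr // ler_wpM2l ?(ltW e4) //.
      apply: le_trans xM; rewrite le_nm /hn [leRHS](sqn_subproj _ onb) lerDr.
      by apply: sumr_ge0 => b _; apply: csq_ge0.
    have := nm_tri z (C x) y; have := nm_tri (C x) (\sum_(b <- bs) ip x b *: C b) y.
    rewrite [nm (y - z)]nmBC; lra.
  have : F [set z | exists2 y, y \in L & ball y e%:C z] by apply: filterS cov FS.
  elim: (L) => [|y L' IH] hF.
    have [z [y]] := filter_ex hF; by rewrite in_nil.
  have [Fy|Fy] := in_ultra_setVsetC (ball y e%:C) uF; first by exists y.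
  apply: IH; apply: filterS (filterI hF Fy) => z [[w]].
  rewrite inE => /orP[/eqP->|wL] hw nhw; first by case: nhw.
  by exists w.
have Fp : cvg F by exact: cauchy_cvg.
exists (lim F); split => //.
apply: closed_closure.
move=> B nB; have FB : F B by exact: Fp.
exact: filter_ex (filterI FS FB).
Qed.

Lemma dom_appr A B : (forall x, nm (A x) <= nm (B x)) -> approximable B -> approximable A.
Proof.
move=> h aB e /aB[zs hz]; exists zs => x /hz; apply: le_trans; exact: h.
Qed.

Lemma perp_cat zs ys x : perp (zs ++ ys) x -> perp zs x /\ perp ys x.
Proof. by move=> h; split => z zin; apply: h; rewrite mem_cat zin ?orbT. Qed.

Lemma apprD A B : approximable A -> approximable B -> approximable (fun x => A x + B x).
Proof.
move=> aA aB e e0; have e2 : 0 < e / 2 by lra.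
have [zs hz] := aA _ e2; have [ys hy] := aB _ e2; exists (zs ++ ys).
move=> x /perp_cat[/hz h1 /hy h2]; apply: le_trans (nmD _ _) _.
have := nm_ge0 x; lra.
Qed.

Lemma appr_compl A B : bounded_lin A -> approximable B -> approximable (A \o B).
Proof.
move=> [_ [M [M0 hM]]] aB e e0.
have M1 : 0 < M + 1 by lra.
have [zs hz] := aB _ (divr_gt0 e0 M1); exists zs => x /hz h.
apply: le_trans (hM _) _; move: h; rewrite mulrAC ler_pdivlMr //.
have := nm_ge0 (B x); nra.
Qed.

Lemma appr_compr A B : bounded_lin B -> approximable A -> approximable (A \o B).
Proof.
move=> bB aA e e0; have [_ [M [M0 hM]]] := bB.
have M1 : 0 < M + 1 by lra.
have [zs hz] := aA _ (divr_gt0 e0 M1); exists (map (adjoint B) zs) => x px.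
apply: le_trans (hz (B x) _) _.
  by move=> z zin; rewrite adjE // px // map_f.
rewrite mulrAC ler_pdivrMr // -mulrA ler_pM2l //.
apply: le_trans (hM x) _; have := nm_ge0 x; lra.
Qed.

Lemma apprZ a A : approximable A -> approximable (fun x => a *: A x).
Proof. exact: appr_compl (bopZ a (bop_id H)). Qed.

Lemma apprB A B : approximable A -> approximable B -> approximable (fun x => A x - B x).
Proof.
move=> aA /(apprZ (-1)) aB; have := apprD aA aB.
by congr approximable; apply/funext => x; rewrite scaleN1r.
Qed.

(** Since |A* x|^2 = <A A* x, x>, it suffices that A composed with A* is small, with e^2 in place of
    e. *)
Lemma appr_adj A : bounded_lin A -> approximable A -> approximable (adjoint A).
Proof.
move=> bA aA e e0; have bA' := adj_bop bA.
have e2 : 0 < e ^+ 2 by rewrite exprn_gt0.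
have [zs hz] := appr_compr bA' aA e2; exists zs => x /hz /= h.
rewrite nm_leP; last by rewrite mulr_ge0 ?nm_ge0 // ltW.
rewrite /hn /sqn adjEr //; apply: le_trans (Re_ip_le _ _) _.
rewrite exprMn [nm x ^+ 2]expr2 mulrA mulrC ler_wpM2r ?nm_ge0 //.
Qed.

Lemma appr_rank1 y z : approximable (fun x => ip x y *: z).
Proof.
move=> e e0; exists [:: y] => x px.
by rewrite px ?inE // scale0r nm0 mulr_ge0 ?nm_ge0 // ltW.
Qed.

Lemma appr0 : approximable (fun=> 0).
Proof. by move=> e e0; exists [::] => x _; rewrite nm0 mulr_ge0 ?nm_ge0 // ltW. Qed.

Lemma appr_hproj bs : approximable (hproj bs).
Proof.
elim: bs => [|b bs IH].
  by have := appr0; congr approximable; apply/funext => x; rewrite /dproj big_nil.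
have := apprD (appr_rank1 b b) IH; congr approximable; apply/funext => x.
by rewrite /dproj big_cons.
Qed.

End Compactness.

(** * Spectral theorem *)

Section Spectral.
Variables (R : realType) (H : hilbertType R).
Implicit Types (x y z : H) (A B C W T : H -> H) (a : R[i]) (S : set H).

Notation hproj := (dproj (@ip R H)).

Lemma on1_has_dim bs : on1 (@ip R H) bs ->
  has_dim [set x | hproj bs x = x] (size bs).
Proof.
move=> onb; exists (fun i => bs`_i); split.
  move=> c c0 j.
  have bin : bs`_j \in bs by apply: mem_nth.
  have /andP[/(pairwiseP 0) pw /allP a1] := onb.
  have : ip (\sum_(i < size bs) c i *: bs`_i) bs`_j = 0 by rewrite c0 dot0l.
  rewrite dot_suml (bigD1 j) //= dotZl ipxx /hn (eqP (a1 _ bin)) mulr1 big1 ?addr0 //.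
  move=> i ij; rewrite dotZl.
  suff -> : ip bs`_i bs`_j = 0 by rewrite mulr0.
  have [lt|gt|/val_inj e] := ltngtP i j; last by rewrite e eqxx in ij.
    by apply/eqP; apply: pw; rewrite ?inE.
  by apply/dot_eq0C/eqP; apply: pw; rewrite ?inE.
apply/seteqP; split => x.
  move=> px; exists (fun i => ip x bs`_i).
  by rewrite -[LHS]px /dproj (big_nth 0) big_mkord.
move=> [c ->] /=; have lS := lin_sub_proj (@ip R H) bs.
apply: (@lin_sub_sum _ _ _ _ _ (fun i : 'I_(size bs) => c i *: bs`_i) lS) => i.
have [_ _ SZ] := lS; apply: SZ => /=.
by apply: on0_projE; [exact: on1_on0|apply: mem_nth].
Qed.

Hypothesis infH : infinite_dimensional H.

(** Infinite dimension keeps the diagonalisation from stopping: eigenvectors form an infinite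
    sequence even for an operator of finite rank. *)
Lemma unit_perp (zs : seq H) : exists u, hn u = 1 /\ perp zs u.
Proof.
apply: contrapT => /forallNP no.
have [bs0 onb0 hbs] := perp_onify zs.
have span0 x : hproj bs0 x = x.
  have [/eqP|ne] := eqVneq (x - hproj bs0 x) 0; first by rewrite subr_eq0 => /eqP.
  exfalso; set d := x - _ in ne.
  have d0 : 0 < hn d by rewrite lt_def hn_ge0 andbT; apply: contra_neq ne => /hn_eq0.
  apply: (no ((nm d)^-1%:C *: d)); split.
    rewrite hnZr -nm2 -exprMn mulVf ?expr1n // gt_eqF //.
    by rewrite nm_gt0.
  by have [_ _ SZ] := perp_lin_sub zs; apply/SZ/hbs/perp_hproj.
pose bs := [seq b <- bs0 | sqn (@ip R H) b == 1].
have onb : on1 (@ip R H) bs.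
  rewrite /on1 filter_all andbT; apply: pairwise_filter.
  by have /andP[] := onb0.
have span x : hproj bs x = x.
  rewrite -[RHS]span0 /dproj big_filter [RHS](bigID (fun b => sqn (@ip R H) b == 1)) /=.
  rewrite [X in _ + X]big_seq_cond [X in _ + X]big1 ?addr0 // => b /andP[bin nb].
  have /andP[_ /allP/(_ _ bin)] := onb0; rewrite (negPf nb) orbF => /eqP b0.
  by rewrite (sqn_eq0 b0) scaler0.
apply: (infH (n := size bs)); rewrite (_ : setT = [set x | hproj bs x = x]).
  exact: on1_has_dim.
by apply/seteqP; split=> // x _; exact: span.
Qed.

Definition orthonormal_seq (e : nat -> H) := forall i j, ip (e i) (e j) = (i == j)%:R.

Lemma ons_on1 e n : orthonormal_seq e -> on1 (@ip R H) (mkseq e n).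
Proof.
move=> oe; apply/andP; split.
  apply/(pairwiseP 0) => i j; rewrite !inE size_mkseq => ni nj ij.
  by rewrite /orth2 !nth_mkseq // oe ltn_eqF.
apply/allP => _ /mapP[i _ ->]; apply/eqP; rewrite /sqn oe eqxx //.
Qed.

Lemma hn_ons e i : orthonormal_seq e -> hn (e i) = 1.
Proof. by move=> oe; rewrite /hn /sqn oe eqxx. Qed.

Lemma nm_ons e i : orthonormal_seq e -> nm (e i) = 1.
Proof. by move=> oe; rewrite /nm hn_ons // sqrtr1. Qed.

Definition perpn (e : nat -> H) n x := forall i, (i < n)%N -> ip x (e i) = 0.

Lemma perpn_perp e n x : perpn e n x <-> perp (mkseq e n) x.
Proof.
split => h.
  by move=> z zin; have [i + ->] := mapP zin; rewrite mem_iota => /h.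
by move=> i ni; apply: h; apply: map_f; rewrite mem_iota.
Qed.

Lemma hn_scale (x : H) : x != 0 -> exists2 r : R, 0 < r & hn (r%:C *: x) = 1.
Proof.
move=> /nm_gt0 x0; exists (nm x)^-1; first by rewrite invr_gt0.
by rewrite hnZr -nm2 -exprMn mulVf ?expr1n // gt_eqF.
Qed.

Lemma ip_scale0 a b x y : ip x y = 0 -> ip (a *: x) (b *: y) = 0.
Proof. by move=> h; rewrite dotZl dotZr h !mulr0. Qed.

(** The supremum [s] of |Wx| over the unit ball of the complement is attained: for near-maximisers
    W^2 x is close to s^2 x, and compactness produces a vector with W^2 e = s^2 e. Then either We =
    -se, or We + se is an eigenvector for s. *)
Lemma spectral_next W (es : seq H) : self_adjoint W -> seq_compact W ->
  (forall x, perp es x -> perp es (W x)) ->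
  exists p : H * R, [/\ hn p.1 = 1, perp es p.1, W p.1 = p.2%:C *: p.1 &
    forall x, perp es x -> nm (W x) <= `|p.2| * nm x].
Proof.
move=> saW cW inv; have [bW sW] := saW; have lW := bW.1.
have [_ pD pZ] := perp_lin_sub es.
have [M [M0 hM]] := bW.2.
pose E := [set nm (W x) | x in [set x | perp es x /\ nm x <= 1]].
have sE : has_sup E.
  split; first by exists (nm (W 0)), 0 => //; split; [case: (perp_lin_sub es)|rewrite nm0].
  exists M => _ [x [_ x1] <-]; apply: le_trans (hM x) _.
  by rewrite ler_piMr.
pose s := sup E.
have le_s x : perp es x -> nm (W x) <= s * nm x.
  move=> px; have [->|x0] := eqVneq x 0; first by rewrite (op0 lW) !nm0 mulr0.
  have n0 := nm_gt0 x0.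
  have : nm (W ((nm x)^-1%:C *: x)) <= s.
    apply: sup_upper_bound => //; exists ((nm x)^-1%:C *: x) => //; split; first exact: pZ.
    by rewrite nmZr ?invr_ge0 ?nm_ge0 // mulVf // gt_eqF.
  by rewrite (opZ lW) nmZr ?invr_ge0 ?nm_ge0 // ler_pdivrMl // mulrC.
have s0 : 0 <= s.
  have [u [u1 pu]] := unit_perp es.
  have := le_s u pu; rewrite /nm [hn u]u1 sqrtr1 mulr1; apply: le_trans.
  exact: sqrtr_ge0.
have [s_eq0|s_neq0] := eqVneq s 0.
  have [u [u1 pu]] := unit_perp es; exists (u, 0) => /=; split => //.
    rewrite scale0r; apply: nm_eq0; apply/eqP; rewrite eq_le nm_ge0 andbT.
    by have := le_s u pu; rewrite s_eq0 mul0r.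
  by move=> x /le_s; rewrite s_eq0 normr0.
have s_gt0 : 0 < s by rewrite lt_def s_neq0.
(* Expand the square, then use |W^2 x| <= s |Wx| and |x| <= 1. *)
have key x : perp es x -> nm x <= 1 ->
    hn (W (W x) - (s ^+ 2)%:C *: x) <= s ^+ 2 * (s ^+ 2 - hn (W x)).
  move=> px x1; rewrite hnB hnZr.
  have -> : complex.Re (ip (W (W x)) ((s ^+ 2)%:C *: x)) = s ^+ 2 * hn (W x).
    by rewrite dotZr sW cReM /= oppr0 !mul0r subr0.
  have h1 : hn (W (W x)) <= s ^+ 2 * hn (W x).
    by have := le_s _ (inv _ px); rewrite -!nm2 -exprMn ler_sqr ?nnegrE ?mulr_ge0 ?nm_ge0.
  have h2 : hn x <= 1 by rewrite -(expr1n _ 2) -nm_leP.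
  have h3 : 0 <= s ^+ 2 := sqr_ge0 s.
  have h4 : 0 <= (s ^+ 2) ^+ 2 := sqr_ge0 _.
  nra.
have ex n : exists x, [/\ perp es x, nm x <= 1 & s - n.+1%:R^-1 < nm (W x)].
  have n0 : 0 < n.+1%:R^-1 :> R by rewrite invr_gt0.
  by have [_ [x [px x1] <-] h] := sup_adherent n0 sE; exists x.
have /boolp.choice[u hu] := ex.
have [l hl] : exists l, forall e : R, 0 < e -> forall N, exists2 n, (N <= n)%N &
    nm (W (s^-1%:C *: W (u n)) - l) < e.
  apply: cW => n; have [pu u1 _] := hu n.
  rewrite nmZr ?invr_ge0 // ler_pdivrMl // mulr1.
  by apply: le_trans (le_s _ pu) _; rewrite ler_piMr.
(* The difference between s u_n and W (s^-1 W u_n) tends to 0, and the latter clusters at [l]; hence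
   the maximisers cluster at l/s. *)
pose e := s^-1%:C *: l.
have app d : 0 < d -> exists x, [/\ perp es x, nm x <= 1, s - d < nm (W x) & nm (x - e) < d].
  move=> d0.
  pose d1 := s * d / 2; have d1p : 0 < d1 by rewrite divr_gt0 // mulr_gt0.
  (* From s - i < |W u_n| <= s follows s^2 - |W u_n|^2 <= 2 s i, which the second bound makes
     smaller than d1^2. *)
  have d2p : 0 < Num.min d (d1 ^+ 2 / (2 * s)).
    by rewrite lt_min d0 divr_gt0 // ?exprn_gt0 ?mulr_gt0.
  have [N hN] := inv_small d2p; have [n /hN + hn'] := hl _ d1p N.
  rewrite lt_min => /andP[hd hd2]; have [pu u1 us] := hu n.
  exists (u n); split => //; first by apply: lt_trans us; rewrite ltrD2l ltrN2.
  have e1 : u n - e = s^-1%:C *: (s%:C *: u n - l).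
    by rewrite scalerBr scalerA -rmorphM /= mulVf ?gt_eqF // scale1r.
  rewrite e1 nmZr ?invr_ge0 // mulrC ltr_pdivrMr //.
  have e2 : s%:C *: u n - W (s^-1%:C *: W (u n)) =
      - (s^-1%:C *: (W (W (u n)) - (s ^+ 2)%:C *: u n)).
    rewrite (opZ lW) scalerBr scalerA -rmorphM /= expr2 mulrA mulVf ?gt_eqF // mul1r.
    by rewrite opprB.
  have h1 : nm (s%:C *: u n - W (s^-1%:C *: W (u n))) <= d1.
    rewrite e2 nmN nm_leP ?(ltW d1p) // hnZr exprVn ler_pdivrMl ?exprn_gt0 //.
    apply: le_trans (key _ pu u1) _; rewrite ler_pM2l ?exprn_gt0 //.
    move: hd2; rewrite ltr_pdivlMr ?mulr_gt0 // => hd2; rewrite -nm2.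
    have := nm_ge0 (W (u n)); have : 0 < n.+1%:R^-1 :> R by rewrite invr_gt0.
    move: (n.+1%:R^-1) us hd2 => i us hd2 i0 w0.
    have hs : nm (W (u n)) <= s by apply: le_trans (le_s _ pu) _; rewrite ler_piMr.
    nra.
  apply: le_lt_trans (nm_tri _ (W (s^-1%:C *: W (u n))) _) _.
  by rewrite /d1 in h1 hn'; rewrite mulrC; lra.
clearbody e; have pe : perp es e.
  have /boolp.choice[v hv] : forall n, exists x, perp es x /\ nm (x - e) < n.+1%:R^-1.
    move=> n; have n0 : 0 < n.+1%:R^-1 :> R by rewrite invr_gt0.
    by have [x [px _ _ xe]] := app _ n0; exists x.
  apply: (@perp_seq_closed _ _ es v) => [n|]; first by case: (hv n).
  apply: (@small_tends _ _ v e (fun n => n.+1%:R^-1)); last exact: inv_small.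
  by move=> n; apply/ltW; case: (hv n).
have e1 : nm e <= 1.
  apply/ler_addgt0Pr => d d0; have [x [_ x1 _ xe]] := app _ d0.
  by have := nmD (e - x) x; rewrite subrK nmBC; lra.
have We : s <= nm (W e).
  apply/ler_addgt0Pr => d d0.
  have M1 : 0 < d / (M + 1) by rewrite divr_gt0 //; lra.
  have [x [_ _ xs xe]] := app _ M1.
  have := nmD (W (x - e)) (W e); rewrite -(opD lW) subrK.
  have := hM (x - e); have := nm_ge0 (x - e).
  move: xe xs; set q := d / _; have : q * (M + 1) = d by rewrite mulfVK // gt_eqF //; lra.
  nra.
have ne : nm e = 1.
  apply/eqP; rewrite eq_le e1 /=; have := le_trans We (le_s _ pe).
  by rewrite -{1}[s]mulr1 ler_pM2l.
have hWe : hn (W e) = s ^+ 2.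
  rewrite -nm2; congr (_ ^+ 2); apply/eqP; rewrite eq_le We andbT.
  by have := le_s _ pe; rewrite ne mulr1.
have WWe : W (W e) = (s ^+ 2)%:C *: e.
  apply/eqP; rewrite -subr_eq0; apply/eqP/hn_eq0/eqP; rewrite eq_le hn_ge0 andbT.
  by have := key _ pe e1; rewrite hWe subrr mulr0.
have [f0|fn0] := eqVneq (W e + s%:C *: e) 0.
  exists (e, - s) => /=; split => //; first by rewrite -nm2 ne expr1n.
    by apply/eqP; rewrite rmorphN scaleNr -addr_eq0 f0.
  by move=> x /le_s; rewrite normrN (gtr0_norm s_gt0).
have [r r0 hr] := hn_scale fn0.
exists (r%:C *: (W e + s%:C *: e), s) => /=; split => //.
- by apply: (pZ); apply: pD; [apply: inv|apply: pZ].
- rewrite (opZ lW) (opD lW) (opZ lW) WWe !scalerA mulrC -scalerA; congr (_ *: _).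
  by rewrite scalerDr scalerA -rmorphM -expr2 addrC.
- by move=> x /le_s; rewrite (gtr0_norm s_gt0).
Qed.

Lemma spectral_thm W : self_adjoint W -> seq_compact W -> exists (e : nat -> H) (w : nat -> R),
  [/\ orthonormal_seq e, forall n, W (e n) = (w n)%:C *: e n,
      forall n x, perpn e n x -> nm (W x) <= `|w n| * nm x,
      nonincreasing_seq (fun n => `|w n|) &
      forall d, 0 < d -> exists n, `|w n| < d].
Proof.
move=> saW cW; have [bW sW] := saW.
(* The choice function has to be total: lists with a non-invariant complement get a dummy value and
   are never reached by [L]. *)
have /boolp.choice[f hf] : forall es : seq H, exists p : H * R,
    (forall x, perp es x -> perp es (W x)) ->
    [/\ hn p.1 = 1, perp es p.1, W p.1 = p.2%:C *: p.1 &
    forall x, perp es x -> nm (W x) <= `|p.2| * nm x].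
  move=> es; have [h|nh] := pselect (forall x, perp es x -> perp es (W x)).
    by have [p hp] := spectral_next saW cW h; exists p.
  by exists (0, 0).
pose L := fix L n := if n is m.+1 then rcons (L m) (f (L m)).1 else [::].
pose e n := (f (L n)).1; pose w n := (f (L n)).2.
have LE n : L n = mkseq e n by elim: n => // n IH; rewrite /= mkseqS -IH.
have inv n : forall x, perp (L n) x -> perp (L n) (W x).
  elim: n => [|n IH] x; first by move=> _ z.
  have [_ _ We _] := hf _ IH.
  rewrite /= => px z; rewrite mem_rcons inE => /orP[/eqP->|zin].
    by rewrite sW We dotZr px ?mulr0 // mem_rcons inE eqxx.
  by apply: IH => // y yin; apply: px; rewrite mem_rcons inE yin orbT.
have P n := hf _ (inv n).
have oe : orthonormal_seq e.
  have lt i j : (i < j)%N -> ip (e i) (e j) = 0.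
    move=> ij; have [_ pj _ _] := P j; apply: dot_eq0C; apply: pj.
    by rewrite LE; apply: map_f; rewrite mem_iota.
  move=> i j; have [ij|ij|->] := ltngtP i j; first exact: lt.
    by apply/dot_eq0C/lt.
  by have [h _ _ _] := P j; rewrite ipxx h.
exists e, w; split => //.
- by move=> n; have [] := P n.
- by move=> n x /perpn_perp; rewrite -LE; have [_ _ _] := P n; apply.
- apply/nonincreasing_seqP => n; have [_ _ _ hn'] := P n; have [h1 pn We _] := P n.+1.
  have := hn' (e n.+1) _; rewrite We nmZ csq_real sqrtr_sqr nm_ons // !mulr1.
  by apply => z zin; apply: pn; rewrite /= mem_rcons inE zin orbT.
(* If all |w_n| were at least d, the vectors W e_n would be at mutual distance at least d and could
   not cluster. *)
- move=> d d0; apply: contrapT => /forallNP h.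
  have [l hl] := cW e (fun n => eq_ind_r (fun t => t <= 1) (lexx _) (nm_ons n oe)).
  have d2 : 0 < d / 2 by rewrite divr_gt0.
  have [n _ hn1] := hl _ d2 0%N; have [m nm1 hm] := hl _ d2 n.+1.
  have := nm_tri (W (e n)) l (W (e m)); rewrite [nm (l - _)]nmBC.
  have : d <= nm (W (e n) - W (e m)).
    have [hen _ Wn _] := P n; have [hem _ Wm _] := P m.
    rewrite -[d](ger0_norm (ltW d0)) -sqrtr_sqr /nm ler_wsqrtr // hnB.
    have onm : ip (e n) (e m) = 0 by rewrite oe ltn_eqF.
    rewrite Wn Wm !hnZr (ip_scale0 _ _ onm) /= mulr0 subr0.
    rewrite hen hem !mulr1 -/(w n) -/(w m).
    have /negP := h n; rewrite -leNgt => hw.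
    have : d ^+ 2 <= `|w n| ^+ 2 by rewrite ler_sqr ?nnegrE // ltW.
    by rewrite real_normK ?num_real //; have := sqr_ge0 (w m); lra.
  lra.
Qed.

(** The [e i] are right singular vectors: the third clause is T*T e_i = s_i^2 e_i in weak form. The
    family need not be complete; the last two clauses force T to vanish on whatever is orthogonal to
    all of it. Zeros of [s] pad the finite-rank case. *)
Definition svd T (s : nat -> R) (e : nat -> H) :=
  [/\ orthonormal_seq e /\ nonincreasing_seq s, forall i, 0 <= s i,
      forall i x, ip (T (e i)) (T x) = (s i ^+ 2)%:C * ip (e i) x,
      forall n x, perpn e n x -> nm (T x) <= s n * nm x &
      forall d, 0 < d -> exists n, s n < d].

Lemma seqc_compl A B : bounded_lin A -> seq_compact B -> seq_compact (A \o B).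
Proof.
move=> [lA [M [M0 hM]]] cB u /cB[l hl]; exists (A l) => e e0 N.
have M1 : 0 < M + 1 by lra.
have [n Nn h] := hl _ (divr_gt0 e0 M1) N; exists n => //=.
rewrite -(opB lA); apply: le_lt_trans (hM _) _.
move: h; rewrite ltr_pdivlMr //; have := nm_ge0 (B (u n) - l); nra.
Qed.

Lemma seqc_svd T : bounded_lin T -> seq_compact T -> exists s e, svd T s e.
Proof.
move=> bT cT; have bT' := adj_bop bT.
have saW : self_adjoint (adjoint T \o T).
  split; first exact: bop_comp.
  by move=> x y /=; rewrite adjEr // adjE.
have [e [w [oe We hW mw w0]]] := spectral_thm saW (seqc_compl bT' cT).
have wE n : w n = hn (T (e n)).
  have := adjEr bT (T (e n)) (e n); have /= -> := We n.
  by rewrite dotZl oe eqxx mulr1 ipxx => -[].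
have wp n : `|w n| = w n by rewrite ger0_norm // wE hn_ge0.
exists (fun n => Num.sqrt (w n)), e; split.
- split => // m n mn; rewrite ler_wsqrtr //.
  by have := mw _ _ mn; rewrite !wp.
- by move=> i; apply: sqrtr_ge0.
- move=> i x; rewrite sqr_sqrtr; last by rewrite wE hn_ge0.
  by rewrite -adjEr //; have /= -> := We i; rewrite dotZl.
- move=> n x /hW; rewrite wp /= => h.
  rewrite nm_leP ?mulr_ge0 ?sqrtr_ge0 ?nm_ge0 // exprMn sqr_sqrtr; last by rewrite wE hn_ge0.
  rewrite /hn /sqn -adjEr //; apply: le_trans (Re_ip_le _ _) _.
  by rewrite [nm x ^+ 2]expr2 mulrA ler_wpM2r ?nm_ge0.
- move=> d d0; have d2 : 0 < d ^+ 2 by rewrite exprn_gt0.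
  have [n] := w0 _ d2; rewrite wp => h; exists n.
  by rewrite -[d](ger0_norm (ltW d0)) -sqrtr_sqr ltr_sqrt.
Qed.

Lemma svd_appr T s e : svd T s e -> approximable T.
Proof.
move=> [_ s0 _ hT st] d /st[n hn']; exists (mkseq e n) => x /perpn_perp/hT h.
by apply: le_trans h _; rewrite ler_wpM2r ?nm_ge0 // ltW.
Qed.

Lemma compactP T : bounded_lin T -> compact_op T <-> approximable T.
Proof.
move=> bT; split; last exact: appr_compact.
by move=> /compact_seqc /(seqc_svd bT)[s [e /svd_appr]].
Qed.

Lemma appr_svd T : bounded_lin T -> approximable T -> exists s e, svd T s e.
Proof. by move=> bT /(compactP bT)/compact_seqc /(seqc_svd bT). Qed.

End Spectral.

(** * Finite linear algebra *)

Section LinearAlgebra.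
Variables (R : realType).

Lemma left_kernel_vec (F : fieldType) m n (C : 'M[F]_(n, m)) : (m < n)%N ->
  exists2 d : 'rV[F]_n, d != 0 & d *m C = 0.
Proof.
move=> mn.
have : kermx C != 0.
  by rewrite -mxrank_eq0 mxrank_ker subn_eq0 -ltnNge (leq_ltn_trans (rank_leq_col C)).
by move=> /rowV0Pn[d /sub_kermxP dC dn0]; exists d.
Qed.

Lemma big_mkseq (V : nmodType) (X : Type) (e : nat -> X) n (F : X -> V) :
  \sum_(b <- mkseq e n) F b = \sum_(i < n) F (e i).
Proof.
by rewrite /mkseq big_map -(big_mkord xpredT (fun i => F (e i))) /index_iota subn0.
Qed.

End LinearAlgebra.

(** * Singular values and Ky Fan norms *)

Section SingularValues.
Variables (R : realType) (H : hilbertType R).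
Implicit Types (x y z : H) (A B C W T : H -> H) (a : R[i]) (S : set H).

Notation hproj := (dproj (@ip R H)).

Lemma has_dim_le S m n : has_dim S m -> has_dim S n -> (n <= m)%N.
Proof.
move=> [e [_ eS]] [g [gi gS]]; rewrite leqNgt; apply/negP => mn.
have /boolp.choice[c hc] : forall i, exists c : 'I_m -> R[i], g i = \sum_j c j *: e j.
  move=> i; have : S (g i).
    rewrite gS /=; exists (fun j => (i == j)%:R).
    rewrite (bigD1 i) //= eqxx scale1r big1 ?addr0 // => j ji.
    by rewrite eq_sym (negPf ji) scale0r.
  by rewrite eS.
have [d dn0 dC] := left_kernel_vec (\matrix_(i, j) c i j) mn.
have d0 : forall i, d 0 i = 0.
  apply: gi; under eq_bigr => i _ do rewrite hc scaler_sumr.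
  rewrite exchange_big big1 // => j _.
  under eq_bigr => i _ do rewrite scalerA.
  rewrite -scaler_suml (_ : \sum_i _ = (d *m \matrix_(i, j) c i j) 0 j).
    by rewrite dC mxE scale0r.
  by rewrite mxE; apply: eq_bigr => i _; rewrite mxE.
by move: dn0; rewrite (_ : d = 0) ?eqxx //; apply/rowP => i; rewrite d0 mxE.
Qed.

Lemma has_dim_inj S m n : has_dim S m -> has_dim S n -> m = n.
Proof.
move=> hm hn; apply/eqP; rewrite eqn_leq.
by rewrite (has_dim_le hm hn) (has_dim_le hn hm).
Qed.

(** At the first index k where the sequences differ, say v_k < u_k, the level u_k is reached by v
    only below k, where u agrees with v, whereas u reaches it at k too; the finite counts then
    disagree. *)
Lemma level_sets_inj (s t : nat -> R) : nonincreasing_seq s -> nonincreasing_seq t ->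
  (forall k, 0 <= s k) -> (forall k, 0 <= t k) ->
  (forall l, 0 < l -> exists n, ([set k | s k = l] #= `I_n)%card /\
                                ([set k | t k = l] #= `I_n)%card) -> s = t.
Proof.
have half (u v : nat -> R) k : nonincreasing_seq u -> nonincreasing_seq v ->
    (forall k, 0 <= v k) ->
    (forall l, 0 < l -> exists n, ([set k | u k = l] #= `I_n)%card /\
                                  ([set k | v k = l] #= `I_n)%card) ->
    (forall i, (i < k)%N -> u i = v i) -> ~ (v k < u k).
  move=> mu mv v0 lev eqi vu.
  have [n [cu cv]] := lev (u k) (le_lt_trans (v0 k) vu).
  have sub : [set i | v i = u k] `<=` [set i | u i = u k].
    move=> i /= vi; have [ik|ki] := ltnP i k; first by rewrite eqi.
    by have := mv _ _ ki; rewrite vi leNgt vu.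
  have fu : finite_set [set i | u i = u k] by exists n.
  have fv : finite_set [set i | v i = u k] by exists n.
  have : (fset_set [set i | v i = u k] `<` fset_set [set i | u i = u k])%fset.
    rewrite fproperEneq; apply/andP; split; last by rewrite -fset_set_sub.
    apply/eqP => e; have : k \in fset_set [set i | u i = u k].
      by rewrite in_fset_set // inE.
    by rewrite -e in_fset_set // inE /= => vk; rewrite vk ltxx in vu.
  by move=> /fproper_ltn_card; rewrite (card_fset_set cu) (card_fset_set cv) ltnn.
move=> ms mt s0 t0 lev; apply/funext => k.
elim/ltn_ind: k => k IH; apply/eqP; rewrite eq_le !leNgt; apply/andP; split; apply/negP.
  by apply: half => // i ik; rewrite IH.
apply: (half t s) => //; first by move=> l /lev[n [h1 h2]]; exists n.
by move=> i ik; rewrite IH.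
Qed.

Section SVD.
Variables (T : H -> H) (s : nat -> R) (e : nat -> H).
Hypotheses (bT : bounded_lin T) (hT : svd T s e).

Let oe : orthonormal_seq e. Proof. by case: hT => -[]. Qed.
Let s0 i : 0 <= s i. Proof. by case: hT. Qed.
Let lT := bT.1.

Lemma svd_mono m n : (m <= n)%N -> s n <= s m.
Proof. by case: hT => -[_ ms] _ _ _ _ /ms. Qed.

Lemma svd_ip i x : ip (T (e i)) (T x) = (s i ^+ 2)%:C * ip (e i) x.
Proof. by case: hT. Qed.

Lemma svd_tail n x : perpn e n x -> nm (T x) <= s n * nm x.
Proof. by case: hT => _ _ _ h _; apply: h. Qed.

(** (|T| + s)(|T| - s) e_i = 0, and |T| + s is injective for s > 0 because |T| is positive. This
    ties the root picked by [abs_op] to the singular vectors. *)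
Lemma abs_svd i : abs_op T (e i) = (s i)%:C *: e i.
Proof.
have [_ sP] := abs_sa bT; have lP := (abs_bop bT).1.
have PP : abs_op T (abs_op T (e i)) = (s i ^+ 2)%:C *: e i.
  rewrite (abs_opP bT).2; apply: ip_inj => x.
  by rewrite adjEr // svd_ip dotZl.
have [si0|sin0] := eqVneq (s i) 0.
  rewrite si0 scale0r; apply: nm_eq0; rewrite abs_nm // /nm /hn /sqn svd_ip si0.
  by rewrite cReZ expr0n mul0r sqrtr0.
have si_gt0 : 0 < s i by rewrite lt_def sin0 s0.
apply/eqP; rewrite -subr_eq0; apply/eqP/hn_eq0.
set v := _ - _.
have : abs_op T v + (s i)%:C *: v = 0.
  rewrite /v (opB lP) (opZ lP) PP scalerBr scalerA -rmorphM /= -expr2.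
  by rewrite addrA subrK subrr.
move=> /(congr1 (fun z => complex.Re (ip z v))).
rewrite dotDl dotZl cReD dot0l cReZ -/(sqn _ v) -/(hn v) /= => h.
have := abs_Re_ge0 v bT; have := hn_ge0 v; nra.
Qed.

Lemma svd_is_sv : is_singular_value_seq T s.
Proof.
split => //; first by move=> m n; apply: svd_mono.
move=> l l0.
have [N hN] : exists N, s N < l by case: hT => _ _ _ _; apply.
pose F := [fset k in iota 0 N | s k == l]%fset.
have FE k : (k \in F) = (s k == l).
  rewrite !inE /= mem_iota add0n andbC; case: eqP => //= skl.
  by rewrite ltnNge; apply/negP => /svd_mono; rewrite skl leNgt hN.
exists #|` F|; last first.
  suff -> : [set k | s k = l] = [set` F] by apply/card_eq_fsetP.
  by apply/seteqP; split => k /=; rewrite FE => /eqP.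
have onb : on1 (@ip R H) [seq e k | k <- F].
  have := fset_uniq F; rewrite /on1 => uF; apply/andP; split; last first.
    by apply/allP => _ /mapP[i _ ->]; apply/eqP/(hn_ons i oe).
  rewrite pairwise_map; move: uF; rewrite uniq_pairwise; apply: sub_pairwise.
  by move=> i j /= ij; rewrite /orth2 oe (negPf ij).
have := on1_has_dim onb; rewrite size_map; congr (has_dim _ _).
have [_ sP] := abs_sa bT; have lP := (abs_bop bT).1.
have lE : lin_sub (eigenspace_op (abs_op T) l).
  split; rewrite /eigenspace_op /=.
  - by rewrite (op0 lP) scaler0.
  - by move=> x y hx hy; rewrite (opD lP) hx hy scalerDr.
  - by move=> a x hx; rewrite (opZ lP) hx !scalerA mulrC.
have sub x : eigenspace_op (abs_op T) l (hproj [seq e k | k <- F] x).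
  apply: lin_sub_sum_seq => // b /mapP[k]; rewrite FE => /eqP skl ->.
  have [_ _ SZ] := lE; apply: SZ; rewrite /eigenspace_op /= abs_svd skl //.
apply/seteqP; split => x /=; first by move=> <-.
move=> xE; set y := x - hproj [seq e k | k <- F] x.
have yE : eigenspace_op (abs_op T) l y by apply: lin_subB.
suff : y = 0 by move=> /eqP; rewrite subr_eq0 => /eqP.
(* Eigenvectors of distinct eigenvalues are orthogonal, so [y] is orthogonal to every e_k. The tail
   bounds then give Ty = 0, whereas |T|y = ly with l > 0. *)
have py k : ip y (e k) = 0.
  have [skl|skl] := eqVneq (s k) l.
    have := perp_hproj x (on1_on0 onb); apply; apply: map_f.
    by rewrite FE skl.
  have := sP y (e k); rewrite [X in ip X _]yE abs_svd dotZl dotZr => /eqP.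
  rewrite (_ : Num.conj (s k)%:C = (s k)%:C); last exact: conj_realE.
  rewrite -subr_eq0 -mulrBl mulf_eq0 -rmorphB /= => /orP[|/eqP//].
  by rewrite eq_complex /= eqxx andbT subr_eq0 eq_sym (negPf skl).
have Ty : nm (T y) = 0.
  apply/eqP; rewrite eq_le nm_ge0 andbT; apply/ler_addgt0Pr => d d0; rewrite add0r.
  have y1 : 0 < nm y + 1 by have := nm_ge0 y; lra.
  have [n hn] : exists n, s n < d / (nm y + 1) by case: hT => _ _ _ _; apply; rewrite divr_gt0.
  apply: le_trans (@svd_tail n y (fun i _ => py i)) _.
  by move: hn; rewrite ltr_pdivlMr //; have := nm_ge0 y; have := s0 n; nra.
have := congr1 (@nm R H) yE; rewrite abs_nm // Ty nmZr ?(ltW l0) // => /esym/eqP.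
by rewrite mulf_eq0 gt_eqF //= => /eqP/nm_eq0.
Qed.

Lemma svd_singular : singular_values T = s.
Proof.
have : is_singular_value_seq T (singular_values T).
  by apply: xgetPex; exists s; apply: svd_is_sv.
move=> [mt t0 ht]; have [ms _ hs] := svd_is_sv.
apply: level_sets_inj => // l l0.
have [n dn cn] := ht _ l0; have [m dm cm] := hs _ l0.
by exists n; split => //; rewrite (has_dim_inj dn dm).
Qed.

(** As 0^-1 = 0, this is the zero vector when s_k = 0, and the family is orthogonal with norms 0 or
    1. *)
Definition left_sv k : H := (s k)^-1%:C *: T (e k).

Lemma left_svE k : T (e k) = (s k)%:C *: left_sv k.
Proof.
rewrite scalerA -rmorphM /=; have [sk|sk] := eqVneq (s k) 0; last by rewrite divff // scale1r.
rewrite sk mul0r scale0r; apply: hn_eq0; by rewrite /hn /sqn svd_ip sk cReZ expr0n mul0r.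
Qed.

Lemma hn_left_sv k : hn (left_sv k) = (s k != 0)%:R.
Proof.
rewrite hnZr /hn /sqn svd_ip oe eqxx mulr1 /= exprVn.
by have [->|sk] := eqVneq (s k) 0; rewrite ?expr0n ?mulr0 //= mulVf // expf_neq0.
Qed.

Lemma hn_left_sv_le k : hn (left_sv k) <= 1.
Proof. by rewrite hn_left_sv lern1 leq_b1. Qed.

Lemma left_sv_orth i j : i != j -> ip (left_sv i) (left_sv j) = 0.
Proof.
move=> ij; have h : ip (T (e i)) (T (e j)) = 0 by rewrite svd_ip oe (negPf ij) mulr0.
exact: ip_scale0.
Qed.

Lemma svd_pyth n x : hn (T x) = \sum_(k < n) s k ^+ 2 * csq (ip x (e k)) +
  hn (T (x - \sum_(k < n) ip x (e k) *: e k)).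
Proof.
set p := (X in T (x - X)).
have xE : x = p + (x - p) by rewrite addrC subrK.
have pe k : (k < n)%N -> ip p (e k) = ip x (e k).
  move=> kn; rewrite dot_suml (bigD1 (Ordinal kn)) //= dotZl oe eqxx mulr1 big1 ?addr0 //.
  by move=> i ik; rewrite dotZl oe (_ : (_ == _) = false) ?mulr0 //; apply: negPf;
    apply: contra_neq ik => ?; apply: val_inj.
have o : ip (T p) (T (x - p)) = 0.
  rewrite (op_sum lT) dot_suml big1 // => k _.
  by rewrite (opZ lT) dotZl svd_ip dotBr [ip _ x]dotC [ip _ p]dotC pe // subrr !mulr0.
have -> : hn (T x) = hn (T p + T (x - p)) by rewrite -(opD lT) -xE.
rewrite hnDd //; congr (_ + _).
have e1 z : ip (T p) z = \sum_(k < n) ip x (e k) * ip (T (e k)) z.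
  by rewrite /p (op_sum lT) dot_suml; apply: eq_bigr => k _; rewrite (opZ lT) dotZl.
rewrite /hn /sqn e1 cRe_sum; apply: eq_bigr => k _.
rewrite svd_ip [ip _ p]dotC pe // mulrCA mul_conj cReZ //.
Qed.

(** The summation behind Ky Fan's bounds: [c k] is the share of the k-th singular direction caught
    by the test vectors, at most 1 by Bessel; every test vector is charged the threshold [t n], and
    caught directions are charged the excess over it. *)
Lemma sum_telescope_le n (m : nat) (t : nat -> R) (c : nat -> R) :
  (m <= n)%N -> 0 <= t n -> (forall k, (k < n)%N -> t n <= t k) ->
  (forall k, (k < n)%N -> c k <= 1) ->
  m%:R * t n + \sum_(k < n) (t k - t n) * c k <= \sum_(k < n) t k.
Proof.
move=> mn tn ht hc.
have : \sum_(k < n) (t k - t n) * c k <= \sum_(k < n) (t k - t n).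
  by apply: ler_sum => k _; rewrite ler_piMr ?hc // subr_ge0 ht.
rewrite sumrB sumr_const card_ord -mulr_natl.
have : m%:R * t n <= n%:R * t n by rewrite ler_wpM2r // ler_nat.
lra.
Qed.

Lemma svd_hn_le n x :
  hn (T x) <= s n ^+ 2 * hn x + \sum_(k < n) (s k ^+ 2 - s n ^+ 2) * csq (ip x (e k)).
Proof.
have onk := on1_on0 (ons_on1 n oe).
have pE : \sum_(k < n) ip x (e k) *: e k = hproj (mkseq e n) x.
  by rewrite /dproj big_mkseq.
have sE : \sum_(b <- mkseq e n) csq (ip x b) = \sum_(k < n) csq (ip x (e k)).
  by rewrite big_mkseq.
rewrite (svd_pyth n) pE.
have := sqn_subproj x onk; rewrite -/(hn x) sE => ->.
have : hn (T (x - hproj (mkseq e n) x)) <= s n ^+ 2 * hn (x - hproj (mkseq e n) x).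
  rewrite -!nm2 -exprMn ler_sqr ?nnegrE ?mulr_ge0 ?nm_ge0 ?s0 //.
  by apply/svd_tail/perpn_perp/perp_hproj.
under [X in _ -> _ <= _ + X]eq_bigr => k _ do rewrite mulrBl.
rewrite sumrB -mulr_sumr -/(hn (x - _)); lra.
Qed.

Lemma ky_fan_sq n us : subon (@ip R H) us -> (size us <= n)%N ->
  \sum_(u <- us) hn (T u) <= \sum_(k < n) s k ^+ 2.
Proof.
move=> sub su.
have /le_trans -> // : \sum_(u <- us) hn (T u) <= (size us)%:R * s n ^+ 2 +
    \sum_(k < n) (s k ^+ 2 - s n ^+ 2) * \sum_(u <- us) csq (ip (e k) u).
  under [X in _ <= _ + X]eq_bigr => k _ do rewrite mulr_sumr.
  rewrite exchange_big (_ : (size us)%:R * _ = \sum_(u <- us) s n ^+ 2); last first.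
    by rewrite big_const_seq count_predT iter_addr_0 mulr_natl.
  rewrite -big_split /= big_seq [leRHS]big_seq; apply: ler_sum => u uin.
  apply: le_trans (svd_hn_le n u) _; apply: lerD.
    have /andP[_ /allP/(_ _ uin) u1] := sub.
    by rewrite ler_piMr ?sqr_ge0.
  by apply: ler_sum => k _; rewrite csq_dotC.
apply: (sum_telescope_le (t := fun k => s k ^+ 2)
  (c := fun k => \sum_(u <- us) csq (ip (e k) u))) => //.
- exact: sqr_ge0.
- by move=> k kn; rewrite ler_sqr ?nnegrE ?s0 // svd_mono // ltnW.
- move=> k kn; apply: le_trans (bessel _ sub) _.
  by rewrite -/(hn _) hn_ons.
Qed.

(** At most n constraints leave a nonzero combination of e_0, ..., e_n orthogonal to [zs], and on
    their span T multiplies norms by at least s_n. *)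
Lemma svd_minmax n (M : R) (zs : seq H) : (size zs <= n)%N -> 0 <= M ->
  (forall x, perp zs x -> nm (T x) <= M * nm x) -> s n <= M.
Proof.
move=> szs M0 hM.
have [d dn0 dC] := left_kernel_vec (\matrix_(i < n.+1, j < size zs) ip (e i) zs`_j) szs.
pose x := \sum_(i < n.+1) d 0 i *: e i.
have xe k : ip x (e (k : 'I_n.+1)) = d 0 k.
  rewrite dot_suml (bigD1 k) //= dotZl oe eqxx mulr1 big1 ?addr0 // => i ik.
  by rewrite dotZl oe (_ : (_ == _) = false) ?mulr0 //; apply: negPf; apply: contra_neq ik => ?;
    apply: val_inj.
have px : perp zs x.
  move=> z zin; have iz : (index z zs < size zs)%N by rewrite index_mem.
  have := congr1 (fun M : 'rV_(size zs) => M 0 (Ordinal iz)) dC; rewrite !mxE => <-.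
  rewrite dot_suml; apply: eq_bigr => i _; rewrite dotZl mxE /= nth_index //.
have xx : \sum_(k < n.+1) ip x (e k) *: e k = x.
  by apply: eq_bigr => k _; rewrite xe.
have hx : hn x = \sum_(k < n.+1) csq (d 0 k).
  rewrite /hn /sqn {2}/x dot_sumr cRe_sum; apply: eq_bigr => k _.
  by rewrite dotZr xe conj_mul.
have x0 : 0 < hn x.
  rewrite lt_def hn_ge0 andbT; apply: contra_neq dn0 => /hn_eq0 x0.
  by apply/rowP => i; rewrite -xe x0 dot0l mxE.
have h1 : s n ^+ 2 * hn x <= hn (T x).
  rewrite (svd_pyth n.+1) xx subrr (op0 lT) hn0 addr0 hx mulr_sumr.
  apply: ler_sum => k _; rewrite xe ler_wpM2r ?csq_ge0 //.
  by rewrite ler_sqr ?nnegrE ?s0 // svd_mono // -ltnS.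
rewrite -ler_sqr ?nnegrE ?s0 //.
rewrite -(ler_pM2r x0); apply: le_trans h1 _.
by rewrite -!nm2 -exprMn ler_sqr ?nnegrE ?mulr_ge0 ?nm_ge0 // hM.
Qed.

(** Ky Fan's principle on H x H. The extremal pairs are (e_k, f_k)/sqrt 2 with f_k the left singular
    vector; orthogonality is asked of the pairs only, not of their components. *)
Lemma ky_fan_pair n (bs : seq (H * H)) : subon (pair_dot (@ip R H)) bs ->
  (size bs <= n)%N ->
  \sum_(b <- bs) 2 * complex.Re (ip (T b.1) b.2) <= \sum_(k < n) s k.
Proof.
move=> sub sb.
have step b : b \in bs -> 2 * complex.Re (ip (T b.1) b.2) <= s n +
    \sum_(k < n) (s k - s n) * (csq (pair_dot (@ip R H) (e k, left_sv k) b) / 2).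
  case: b => u v bin.
  have b1 : hn u + hn v <= 1.
    by have /andP[_ /allP/(_ _ bin)] := sub; rewrite sqn_pair.
  (* Tz is Tu with the singular values above s_n cut down to s_n, so |Tz| <= s_n |u|; what is cut
     off is the sum of (s_k - s_n) <u, e_k> f_k. If s_k = 0 with k < n, then s_n = 0 and the value
     c_k = 0 given by division by zero is the right one. *)
  pose c k := s n / s k.
  have cs k : (k < n)%N -> s k * c k = s n.
    move=> kn; rewrite /c; have [sk|sk] := eqVneq (s k) 0; last by rewrite mulrC mulfVK.
    by rewrite sk mul0r; apply/eqP; rewrite eq_le s0 /= -sk svd_mono // ltnW.
  pose z := u - \sum_(k < n) ((1 - c k)%:C * ip u (e k)) *: e k.
  have ze k : (k < n)%N -> ip z (e k) = (c k)%:C * ip u (e k).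
    move=> kn; rewrite dotBl dot_suml (bigD1 (Ordinal kn)) //= dotZl oe eqxx mulr1.
    rewrite big1 ?addr0; last first.
      move=> i ik; rewrite dotZl oe (_ : (_ == _) = false) ?mulr0 //.
      by apply: negPf; apply: contra_neq ik => ?; apply: val_inj.
    by rewrite -[X in X - _]mul1r -mulrBl -(rmorph1 (real_complex R)) -rmorphB /= opprB addrC subrK.
  have zz : z - \sum_(k < n) ip z (e k) *: e k = u - \sum_(k < n) ip u (e k) *: e k.
    rewrite -addrA -opprD -big_split /=; congr (_ - _); apply: eq_bigr => k _.
    by rewrite ze // -scalerDl -mulrDl -rmorphD /= subrK mul1r.
  have hz : hn (T z) <= s n ^+ 2 * hn u.
    rewrite (svd_pyth n) zz.
    have onk := on1_on0 (ons_on1 n oe).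
    have pE : \sum_(k < n) ip u (e k) *: e k = hproj (mkseq e n) u.
      by rewrite /dproj big_mkseq.
    have sE : \sum_(b <- mkseq e n) csq (ip u b) = \sum_(k < n) csq (ip u (e k)).
      by rewrite big_mkseq.
    have := sqn_subproj u onk; rewrite -/(hn u) sE => ->; rewrite mulrDr pE.
    apply: lerD.
      rewrite mulr_sumr; apply: ler_sum => k _.
      by rewrite ze // csqM csq_real mulrA -exprMn cs.
    rewrite -/(hn (u - _)) -!nm2 -exprMn ler_sqr ?nnegrE ?mulr_ge0 ?nm_ge0 ?s0 //.
    by apply/svd_tail/perpn_perp/perp_hproj.
  have uE : T u = T z + \sum_(k < n) ((s k - s n)%:C * ip u (e k)) *: left_sv k.
    rewrite /z (opB lT) (op_sum lT) -addrA -[LHS]addr0; congr (_ + _).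
    rewrite addrC -sumrB big1 // => k _.
    rewrite (opZ lT) left_svE scalerA -scalerBl [X in _ - X]mulrAC -rmorphM /=.
    by rewrite mulrBl mul1r [c k * _]mulrC cs // subrr scale0r.
  have first_le : 2 * complex.Re (ip (T z) v) <= s n.
    have := Re_ip_le (T z) v.
    have : nm (T z) <= s n * nm u by rewrite nm_leP ?mulr_ge0 ?nm_ge0 ?s0 // exprMn nm2.
    move: b1; rewrite -!nm2; move: (nm u) (nm v) (nm (T z)) (nm_ge0 u) (nm_ge0 v) (s0 n).
    move=> p q r p0 q0 sn pq hr hre.
    have := sqr_ge0 (p - q); have : r * q <= s n * p * q by rewrite ler_wpM2r.
    nra.
  rewrite /= uE dotDl cReD mulrDr; apply: lerD => //.
  rewrite dot_suml cRe_sum mulr_sumr; apply: ler_sum => k _.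
  rewrite dotZl -mulrA cReZ mulrCA ler_wpM2l ?subr_ge0 ?svd_mono ?(ltnW (ltn_ord k)) //.
  (* For p = <u, e_k> and q = <v, f_k>, 2 Re (p conj q) <= |p + q|^2 / 2, and p + q is the pairing
     of (u, v) with (e_k, f_k). *)
  rewrite csq_dotC pair_dotE /= [ip v _]dotC.
  move: (ip u (e k)) (ip (left_sv k) v) => [a b] [c' d]; rewrite /csq /=.
  have := sqr_ge0 (a - c'); have := sqr_ge0 (b + d); nra.
have /le_trans -> // : \sum_(b <- bs) 2 * complex.Re (ip (T b.1) b.2) <=
    (size bs)%:R * s n + \sum_(k < n) (s k - s n) *
      \sum_(b <- bs) csq (pair_dot (@ip R H) (e k, left_sv k) b) / 2.
  under [X in _ <= _ + X]eq_bigr => k _ do rewrite mulr_sumr.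
  rewrite exchange_big (_ : (size bs)%:R * _ = \sum_(u <- bs) s n); last first.
    by rewrite big_const_seq count_predT iter_addr_0 mulr_natl.
  by rewrite -big_split /= big_seq [leRHS]big_seq; apply: ler_sum => b /step.
apply: (sum_telescope_le (t := s)
  (c := fun k => \sum_(b <- bs) csq (pair_dot (@ip R H) (e k, left_sv k) b) / 2)) => //.
- by move=> k kn; rewrite svd_mono // ltnW.
- move=> k kn; rewrite -mulr_suml ler_pdivrMr // mul1r.
  apply: le_trans (bessel _ sub) _; rewrite sqn_pair -!/(hn _) /= hn_ons //.
  by have := hn_left_sv_le k; lra.
Qed.

End SVD.
End SingularValues.

(** * Symmetric norms *)

Section SymmetricNorming.
Variables (R : realType) (Phi : (nat -> R) -> R).
Hypothesis hPhi : symmetric_norming_function Phi.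

Lemma pad0_out n (a : 'I_n -> R) k : (n <= k)%N -> pad0 a k = 0.
Proof. by move=> nk; rewrite /pad0 insubF // ltnNge nk. Qed.

Lemma pad0_c00 n (a : 'I_n -> R) : @c00 R (pad0 a).
Proof. by exists n => k; apply: pad0_out. Qed.

Lemma pad0_lift2 n (a b c : 'I_n -> R) (g : R -> R -> R) : g 0 0 = 0 ->
  (forall i, c i = g (a i) (b i)) -> pad0 c = (fun k => g (pad0 a k) (pad0 b k)).
Proof.
move=> g0 h; apply/funext => k; rewrite /pad0.
by case: insubP => [i _ _|_].
Qed.

Section Fixed.
Variable n : nat.
Hypothesis n_gt0 : (0 < n)%N.
Implicit Types (a b s t : 'I_n -> R).
Let F a := Phi (pad0 a).

Lemma snf_abs a b : (forall i, `|a i| = `|b i|) -> F a = F b.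
Proof.
move=> h; rewrite /F (snf_sym hPhi a (1%g : 'S_n)) // (snf_sym hPhi b (1%g : 'S_n)) //.
by congr (Phi (pad0 _)); apply/funext => i; rewrite !perm1.
Qed.

Lemma snf_perm a (p : 'S_n) : F (a \o p) = F a.
Proof.
rewrite /F [RHS](snf_sym hPhi a p) // (snf_sym hPhi _ (1%g : 'S_n)) //.
by congr (Phi (pad0 _)); apply/funext => i; rewrite /= perm1.
Qed.

Lemma snf_conv (th : R) a b c : 0 <= th <= 1 -> F b = F a ->
  (forall i, c i = (1 - th) * a i + th * b i) -> F c <= F a.
Proof.
move=> /andP[t0 t1] ba hc.
have -> : F c = Phi (fun k => (fun k => (1 - th) * pad0 a k) k + (fun k => th * pad0 b k) k).
  rewrite /F (pad0_lift2 (g := fun x y => (1 - th) * x + th * y) _ hc) //.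
  by rewrite !mulr0 addr0.
apply: le_trans (snf_triangle hPhi _ _) _.
- by exists n => k nk; rewrite pad0_out ?mulr0.
- by exists n => k nk; rewrite pad0_out ?mulr0.
rewrite !(snfZ hPhi) ?ger0_norm; try exact: pad0_c00; rewrite ?subr_ge0 //.
by move: ba; rewrite /F => ->; rewrite -mulrDl subrK mul1r.
Qed.

Lemma snf_mono a b : (forall i, 0 <= a i <= b i) -> F a <= F b.
Proof.
move=> hab.
pose h k (i : 'I_n) := if (i < k)%N then a i else b i.
have -> : F a = F (h n).
  by congr (Phi (pad0 _)); apply/funext => i; rewrite /h ltn_ord.
elim: {-2}n (leqnn n) => [|k IH] kn.
  by rewrite le_eqVlt; apply/orP; left; apply/eqP; congr (Phi (pad0 _)).
apply: le_trans (IH (ltnW kn)).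
pose i := Ordinal kn.
have /andP[a0 ab] := hab i.
have hi : h k i = b i by rewrite /h ltnn.
have hi1 : h k.+1 i = a i by rewrite /h ltnSn.
have hj j : j != i -> h k.+1 j = h k j.
  move=> ji; rewrite /h ltnS leq_eqVlt; case: (eqVneq (j : nat) k) => //= e.
  by case/eqP: ji; apply: val_inj.
have [b0|bn0] := eqVneq (b i) 0.
  have -> // : h k.+1 = h k.
  apply/funext => j; have [->|/hj//] := eqVneq j i.
  by rewrite hi hi1 b0; apply/eqP; rewrite eq_le a0 -b0 ab.
have b_gt0 : 0 < b i by rewrite lt_def bn0 (le_trans a0).
(* [a i] lies between [- b i] and [b i]; this is the weight of [- b i] in the convex combination.
   Flipping one sign leaves the norm unchanged. *)
apply: (@snf_conv ((1 - a i / b i) / 2) (h k) (fun j => if j == i then - h k j else h k j)).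
- have : a i / b i <= 1 by rewrite ler_pdivrMr // mul1r.
  have : 0 <= a i / b i by rewrite divr_ge0 // ltW.
  by move=> *; apply/andP; split; lra.
- by apply: snf_abs => j; case: eqP; rewrite ?normrN.
- move=> j; have [->|ji] := eqVneq j i; last by rewrite hj //; lra.
  by rewrite hi1 hi; field.
Qed.

(** Transfers between two entries: take the first j with s_j < t_j and the last i < j with s_i >
    t_i, which the partial sums force to exist, and move min(s_i - t_i, t_j - s_j) from i to j. The
    result is a convex combination of s and s with i, j exchanged, so the norm does not grow, and
    one more entry agrees with t. *)
Lemma snf_majorization s t : (forall i j : 'I_n, (i <= j)%N -> t j <= t i) ->
  (forall i, 0 <= t i) ->
  (forall r, \sum_(k < n | (k < r)%N) t k <= \sum_(k < n | (k < r)%N) s k) ->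
  F t <= F s.
Proof.
move=> mt t0.
have [m] := ubnP #|[pred i | s i != t i]|; elim: m s => // m IH s hm hs.
have [j0 hj0|no] := pickP (fun j => s j < t j); last first.
  by apply: snf_mono => i; rewrite t0 /= leNgt no.
have [j hj minj] := @arg_minnP _ j0 (fun j => s j < t j) (@nat_of_ord n) hj0.
have lej (k : 'I_n) : (k < j)%N -> t k <= s k.
  by move=> kj; rewrite leNgt; apply/negP => /minj; rewrite leqNgt kj.
have [i0 /andP[i0j hi0]|no] := pickP (fun i : 'I_n => (i < j)%N && (t i < s i)); last first.
  exfalso; have := hs j.+1.
  rewrite (bigD1 j) ?ltnSn //= [X in _ <= X](bigD1 j) ?ltnSn //=.
  rewrite (eq_bigr s) => [|k /andP[kj kn]]; first by rewrite lerD2r leNgt hj.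
  have kj' : (k < j)%N by rewrite ltn_neqAle kn -ltnS.
  apply/eqP; rewrite eq_le lej //= leNgt.
  by have := no k; rewrite kj' /= => ->.
have i0P : (i0 < j)%N && (t i0 < s i0) by rewrite i0j.
have [i /andP[ij hi] maxi] :=
  @arg_maxnP _ i0 (fun i : 'I_n => (i < j)%N && (t i < s i)) (@nat_of_ord n) i0P.
have mid (k : 'I_n) : (i < k)%N -> (k < j)%N -> s k = t k.
  move=> ik kj; apply/eqP; rewrite eq_le lej // andbT leNgt; apply/negP => tk.
  by have := maxi k; rewrite kj tk => /(_ isT) /(leq_trans ik); rewrite ltnn.
pose d := Num.min (s i - t i) (t j - s j).
have d_gt0 : 0 < d by rewrite lt_min !subr_gt0 hi hj.
have d1 : d <= s i - t i by rewrite ge_min lexx.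
have d2 : d <= t j - s j by rewrite ge_min lexx orbT.
have tij : t j <= t i by apply: mt; apply: ltnW.
have inj : i != j by apply: contraTneq ij => ->; rewrite ltnn.
pose s' k := s k + d * ((k == j)%:R - (k == i)%:R).
have si' : s' i = s i - d by rewrite /s' eqxx (negPf inj) sub0r mulrN1.
have sj' : s' j = s j + d by rewrite /s' eqxx eq_sym (negPf inj) subr0 mulr1.
have sk' k : k != i -> k != j -> s' k = s k.
  by move=> /negPf ki /negPf kj; rewrite /s' ki kj subrr mulr0 addr0.
have s's : F s' <= F s.
  apply: (@snf_conv (d / (s i - s j)) s (s \o tperm i j)).
  - by apply/andP; split; [rewrite divr_ge0 ?ltW //|rewrite ler_pdivrMr ?mul1r]; lra.
  - exact: snf_perm.
  - have sij : s i - s j != 0 by rewrite gt_eqF //; lra.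
    move=> k; rewrite /=; have [->|ki] := eqVneq k i.
      by rewrite tpermL si'; field.
    have [->|kj] := eqVneq k j; first by rewrite tpermR sj'; field.
    by rewrite tpermD 1?eq_sym // sk' //; ring.
apply: le_trans s's; apply: IH.
  move: hm; rewrite ltnS; apply: leq_trans; apply: proper_card; apply/properP; split.
    apply/fintype.subsetP => k; rewrite !inE; have [->|ki] := eqVneq k i.
      by move=> _; rewrite gt_eqF.
    by have [->|kj] := eqVneq k j; [move=> _; rewrite lt_eqF|rewrite sk'].
  have [e|e] := leP (s i - t i) (t j - s j).
    exists i; rewrite !inE; first by rewrite gt_eqF.
    by rewrite negbK si' /d (min_idPl e); apply/eqP; ring.
  exists j; rewrite !inE; first by rewrite lt_eqF.
  by rewrite negbK sj' /d (min_idPr (ltW e)); apply/eqP; ring.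
(* Only partial sums with i < r <= j change. There domination follows from the old partial sum up to
   i, from s'_i >= t_i, and from s = t strictly between i and j. *)
move=> r.
have ind (p : 'I_n) : \sum_(k < n | (k < r)%N) (k == p)%:R = (p < r)%:R :> R.
  have [pr|pr] := boolP (p < r)%N.
    by rewrite (bigD1 p) //= eqxx big1 ?addr0 // => k /andP[_ /negPf->].
  rewrite big1 // => k kr; case: eqP => // kp; by rewrite -kp kr in pr.
rewrite big_split /= -mulr_sumr sumrB !ind.
have [jr|rj] := ltnP j r.
  by rewrite (ltn_trans ij jr) subrr mulr0 addr0.
have [ir|ri] := ltnP i r; last by rewrite subrr mulr0 addr0.
rewrite sub0r mulrN1 lerBrDr.
rewrite (bigD1 i) //= [leRHS](bigD1 i) //=.
suff : \sum_(k < n | (k < r)%N && (k != i)) t k <= \sum_(k < n | (k < r)%N && (k != i)) s k by lra.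
rewrite (bigID (fun k : 'I_n => (k < i)%N)) /= [leRHS](bigID (fun k : 'I_n => (k < i)%N)) /=.
apply: lerD.
  have eqi (k : 'I_n) : (k < i)%N = (k < r)%N && (k != i) && (k < i)%N.
    have [ki|] := ltnP k i; rewrite ?andbF ?andbT //.
    by rewrite (ltn_trans ki ir) (_ : k != i) //; apply: contraTneq ki => ->; rewrite ltnn.
  by have := hs i; rewrite (eq_bigl _ _ eqi) [leRHS](eq_bigl _ _ eqi).
apply: ler_sum => k /andP[/andP[kr ki]];
  rewrite -leqNgt leq_eqVlt eq_sym (negPf ki : (k == i :> nat) = false) /= => ik.
by rewrite mid // (leq_trans kr).
Qed.

End Fixed.

Lemma snf_weak_majorization (s t : nat -> R) k : nonincreasing_seq t ->
  (forall i, 0 <= t i) -> weakly_majorized t s ->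
  Phi (pad0 (fun i : 'I_k.+1 => t i)) <= Phi (pad0 (fun i : 'I_k.+1 => s i)).
Proof.
move=> mt t0 ts; apply: snf_majorization => // [i j /mt//|r].
have E (u : nat -> R) : \sum_(i < k.+1 | (i < r)%N) u i = \sum_(i < minn r k.+1) u i.
  have [rk|kr] := leqP r k.+1; first by rewrite (big_ord_narrow rk).
  apply: eq_bigl => i; by rewrite (ltn_trans (ltn_ord i)).
rewrite !E; case: (minn r k.+1) => [|m]; first by rewrite !big_ord0.
exact: ts.
Qed.

End SymmetricNorming.

(** * Orthogonal projections and uniqueness of the Moore-Penrose inverse *)

Section Projections.
Variables (R : realType) (H : hilbertType R).
Implicit Types (x y z : H) (A B C P X Y T : H -> H) (S : set H).

Lemma orth_proj_exists S : lin_sub S -> seq_closed S ->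
  exists P, is_orthogonal_projection S P.
Proof.
move=> lS cS; have /boolp.choice[P hP] := projection_thm lS cS.
by exists P => x; have [h1 h2] := hP x; split.
Qed.

Section OrthProj.
Variables (S : set H) (P : H -> H).
Hypotheses (lS : lin_sub S) (hP : is_orthogonal_projection S P).

Lemma orth_proj_uniq x p : S p -> orthogonal_complement S (x - p) -> P x = p.
Proof.
move=> Sp op; have [SP oP] := hP x.
apply/eqP; rewrite -subr_eq0; apply/eqP/hn_eq0.
have Sd : S (P x - p) by apply: lin_subB.
have -> : hn (P x - p) = complex.Re (ip ((x - p) - (x - P x)) (P x - p)).
  by rewrite (_ : x - p - (x - P x) = P x - p) // opprB [LHS]addrC addrA subrK.
by rewrite dotBl (op _ Sd) (oP _ Sd) subrr.
Qed.

Lemma orth_proj_id x : S x -> P x = x.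
Proof. by move=> Sx; apply: orth_proj_uniq => // y _; rewrite subrr dot0l. Qed.

Lemma orth_proj_mem x : S (P x). Proof. by have [] := hP x. Qed.

Lemma orth_proj_sa : self_adjoint P.
Proof.
have [S0 SD SZ] := lS; have lC := orth_lin_sub S; have [_ CD CZ] := lC.
have lP : linear P.
  apply: mk_linear => [x y|a x]; apply: orth_proj_uniq.
  - by apply: SD; apply: orth_proj_mem.
  - by rewrite opprD addrACA; apply: CD; [have [] := hP x|have [] := hP y].
  - by apply/SZ/orth_proj_mem.
  - by rewrite -scalerBr; apply: CZ; have [] := hP x.
have ipP x y : ip (P x) y = ip (P x) (P y).
  have [_ oy] := hP y; have := dot_eq0C (oy _ (orth_proj_mem x)).
  by rewrite dotBr => /eqP; rewrite subr_eq0 => /eqP.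
split; last first.
  by move=> x y; rewrite ipP [RHS]dotC (ipP y x) -dotC.
split => //; exists 1; split => // x; rewrite mul1r le_nm.
have [_ ox] := hP x; rewrite -[x in leRHS](subrK (P x)) hnDd ?lerDr ?hn_ge0 //.
exact/ox/orth_proj_mem.
Qed.

Lemma orth_proj_bop : bounded_lin P. Proof. exact: orth_proj_sa.1. Qed.

Lemma orth_proj_nm x : nm (P x) <= nm x.
Proof.
rewrite le_nm; have [_ ox] := hP x.
rewrite -[x in leRHS](subrK (P x)) hnDd ?lerDr ?hn_ge0 //.
exact/ox/orth_proj_mem.
Qed.

End OrthProj.

Lemma range_lin_sub A : linear A -> lin_sub (range A).
Proof.
move=> lA; split.
- by exists 0 => //; rewrite (op0 lA).
- by move=> _ _ [x _ <-] [y _ <-]; exists (x + y) => //; rewrite (opD lA).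
- by move=> a _ [x _ <-]; exists (a *: x) => //; rewrite (opZ lA).
Qed.

Lemma moore_penrose_uniq A X : linear A ->
  [set X | [/\ bounded_op X, A \o X \o A = A, X \o A \o X = X,
    is_orthogonal_projection (range A) (A \o X) &
    is_orthogonal_projection (orthogonal_complement (nullspace A)) (X \o A)]] X ->
  moore_penrose A = X.
Proof.
move=> lA hX.
have := xgetPex 0 (ex_intro _ X hX); rewrite -/(moore_penrose A).
move: (moore_penrose A) => Y [_ _ YAY pY1 pY2].
case: hX => _ _ XAX pX1 pX2.
have e1 x : A (Y x) = A (X x).
  apply: (orth_proj_uniq (range_lin_sub lA) pY1); first by exists (X x).
  by have [_] := pX1 x.
have e2 x : Y (A x) = X (A x).
  by have [h1 h2] := pX2 x; apply: (orth_proj_uniq (orth_lin_sub _) pY2).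
apply/funext => x.
have := congr1 (fun f => f x) YAY; have := congr1 (fun f => f x) XAX => /= <- <-.
by rewrite e2 e1.
Qed.

End Projections.

(** * Extremal families, ideal membership and comparison of norms *)

Section NormFacts.
Variables (R : realType) (H : hilbertType R) (Phi : (nat -> R) -> R).
Hypotheses (infH : infinite_dimensional H) (hPhi : symmetric_norming_function Phi).
Implicit Types (x y z : H) (A B C P X Y T : H -> H) (S : set H).

Lemma singular_svd T : bounded_lin T -> approximable T -> exists e, svd T (singular_values T) e.
Proof.
move=> bT aT; have [s [e h]] := appr_svd infH bT aT.
by exists e; rewrite (svd_singular bT h).
Qed.

Section Pairs.
Variables (T : H -> H) (s : nat -> R) (e : nat -> H).
Hypotheses (bT : bounded_lin T) (hT : svd T s e).
Let r : R := Num.sqrt 2^-1.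
Let r2 : r ^+ 2 = 2^-1. Proof. by rewrite sqr_sqrtr // invr_ge0. Qed.

(** The pairs that attain equality in Ky Fan's principle on H x H; [r] is 1/sqrt 2. *)
Definition svd_pairs n : seq (H * H) :=
  mkseq (fun k => (r%:C *: e k, r%:C *: left_sv T s e k)) n.

Lemma svd_pairs_subon n : subon (pair_dot (@ip R H)) (svd_pairs n).
Proof.
have oe : orthonormal_seq e by case: hT => -[].
apply/andP; split; last first.
  apply/allP => _ /mapP[k _ ->]; rewrite sqn_pair -!/(hn _) (hnZr r (e k))
    (hnZr r (left_sv T s e k)) r2 hn_ons //.
  by have := hn_left_sv_le hT k; lra.
rewrite pairwise_map; have := iota_uniq 0 n; rewrite uniq_pairwise.
apply: sub_pairwise => i j /= ij; rewrite /orth2 pair_dotE /=.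
have h1 : ip (e i) (e j) = 0 by rewrite oe (negPf ij).
by rewrite (ip_scale0 r%:C r%:C h1) (ip_scale0 r%:C r%:C (left_sv_orth hT ij)) addr0.
Qed.

Lemma svd_pairs_sum n X : linear X ->
  \sum_(b <- svd_pairs n) 2 * complex.Re (ip (X b.1) b.2) =
  \sum_(k < n) complex.Re (ip (X (e k)) (left_sv T s e k)).
Proof.
move=> lX; rewrite big_mkseq; apply: eq_bigr => k _ /=.
rewrite (opZ lX) dotZl dotZr mulrA mul_conj csq_real r2 cReZ mulrA divff ?mul1r //.
Qed.

Lemma svd_left_ip k : complex.Re (ip (T (e k)) (left_sv T s e k)) = s k.
Proof.
rewrite [X in ip X _](left_svE hT) dotZl cReZ -/(sqn _ _) -/(hn _) (hn_left_sv hT).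
by case: eqVneq => [->|_]; rewrite ?mul0r ?mulr1.
Qed.

Lemma ky_fan_left n T1 s1 e1 : bounded_lin T1 -> svd T1 s1 e1 ->
  \sum_(k < n) complex.Re (ip (T1 (e k)) (left_sv T s e k)) <= \sum_(k < n) s1 k.
Proof.
move=> bT1 h1; rewrite -(svd_pairs_sum _ bT1.1).
by apply: (ky_fan_pair bT1 h1); [exact: svd_pairs_subon|rewrite size_mkseq].
Qed.

End Pairs.

Lemma ky_fan_triangle T T1 T2 s s1 s2 e e1 e2 n : bounded_lin T -> bounded_lin T1 -> bounded_lin T2 ->
  svd T s e -> svd T1 s1 e1 -> svd T2 s2 e2 -> (forall x, T x = T1 x + T2 x) ->
  \sum_(k < n) s k <= \sum_(k < n) s1 k + \sum_(k < n) s2 k.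
Proof.
move=> bT bT1 bT2 h h1 h2 hT.
have -> : \sum_(k < n) s k = \sum_(k < n) complex.Re (ip (T (e k)) (left_sv T s e k)).
  by apply: eq_bigr => k _; rewrite svd_left_ip.
under eq_bigr => k _ do rewrite [X in ip X _]hT dotDl cReD.
rewrite big_split /=; apply: lerD.
  exact: (ky_fan_left h n bT1 h1).
exact: (ky_fan_left h n bT2 h2).
Qed.

(** A unit vector orthogonal to u_0, ..., u_(n-1) completes them to n + 1 orthonormal vectors, and
    Ky Fan's bound on squares leaves it at most s_n^2. Thus an orthonormal family that attains the
    singular values behaves like the right singular vectors. *)
Lemma svd_tail_of T s e u n x : bounded_lin T -> svd T s e -> orthonormal_seq u ->
  (forall k, (k < n)%N -> s k ^+ 2 <= hn (T (u k))) -> perpn u n x ->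
  nm (T x) <= s n * nm x.
Proof.
move=> bT h ou hu px; have s0 : 0 <= s n by case: h.
have [->|x0] := eqVneq x 0; first by rewrite (op0 bT.1) !nm0 mulr0.
have [r r0 hr] := hn_scale x0.
have sub : subon (@ip R H) (rcons (mkseq u n) (r%:C *: x)).
  apply: on1_subon; have /andP[pw al] := ons_on1 n ou.
  rewrite /on1 -cats1 pairwise_cat all_cat pw al /= !andbT; apply/andP; split; last exact/eqP.
  apply/allrelP => a b ain; have [i + ->] := mapP ain.
  rewrite mem_iota => /andP[_ ni]; rewrite inE => /eqP->.
  by apply/eqP; rewrite dotZr (dot_eq0C (px i ni)) mulr0.
have := ky_fan_sq bT h (n := n.+1) sub; rewrite size_rcons size_mkseq => /(_ (leqnn _)).
rewrite -cats1 big_cat big_seq1 /= big_mkseq big_ord_recr /= => hle.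
have hsum : \sum_(k < n) s k ^+ 2 <= \sum_(k < n) hn (T (u k)).
  by apply: ler_sum => k _; apply: hu.
have : hn (T (r%:C *: x)) <= s n ^+ 2 by lra.
rewrite (opZ bT.1) hnZr => hle2.
rewrite nm_leP ?mulr_ge0 ?nm_ge0 // exprMn nm2.
have : r ^+ 2 * hn (T x) <= r ^+ 2 * (s n ^+ 2 * hn x).
  by rewrite [leRHS]mulrCA -(hnZr r x) hr mulr1.
by rewrite ler_pM2l // exprn_gt0.
Qed.

Lemma svd_max_eq T s e u k : bounded_lin T -> svd T s e -> orthonormal_seq u ->
  (forall k, s k ^+ 2 <= hn (T (u k))) -> hn (T (u k)) = s k ^+ 2.
Proof.
move=> bT h ou hu; apply/eqP; rewrite eq_le hu andbT.
have := svd_tail_of (n := k) (x := u k) bT h ou (fun k _ => hu k).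
rewrite nm_ons // mulr1 nm_leP; last by case: h.
apply => i ik; by rewrite ou gtn_eqF.
Qed.

Lemma ons_ext X Y (u : nat -> H) (s : nat -> R) : bounded_lin X -> bounded_lin Y -> orthonormal_seq u ->
  (forall k, X (u k) = Y (u k)) ->
  (forall n x, perpn u n x -> nm (X x) <= s n * nm x) ->
  (forall n x, perpn u n x -> nm (Y x) <= s n * nm x) ->
  (forall n, 0 <= s n) -> (forall d, 0 < d -> exists n, s n < d) -> X = Y.
Proof.
move=> [lX _] [lY _] ou e hX hY s0 st; apply/funext => x.
apply/eqP; rewrite -subr_eq0; apply/eqP/nm_eq0/eqP; rewrite eq_le nm_ge0 andbT.
apply/ler_addgt0Pr => d d0; rewrite add0r.
have x1 : 0 < 2 * (nm x + 1) by have := nm_ge0 x; lra.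
have [n hn'] := st _ (divr_gt0 d0 x1).
have onk := on1_on0 (ons_on1 n ou).
pose p := dproj (@ip R H) (mkseq u n) x.
have Xp : X p = Y p.
  rewrite /p /dproj big_mkseq (op_sum lX) (op_sum lY); apply: eq_bigr => k _.
  by rewrite (opZ lX) (opZ lY) e.
have px : perpn u n (x - p) by apply/perpn_perp/perp_hproj.
have -> : X x - Y x = X (x - p) - Y (x - p).
  by rewrite (opB lX) (opB lY) Xp opprB addrA subrK.
apply: le_trans (nmB _ _) _.
have := hX _ _ px; have := hY _ _ px.
have : nm (x - p) <= nm x.
  rewrite le_nm /hn [leRHS](sqn_subproj _ onk) lerDr.
  by apply: sumr_ge0 => b _; apply: csq_ge0.
move: hn'; rewrite ltr_pdivlMr // => h1 h2 h3 h4.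
have := ler_wpM2l (s0 n) h2; have := nm_ge0 x; have := s0 n; lra.
Qed.

(** Min-max with the constraints [adjoint Y (e1 k)], which force Yx into the tail of T1. *)
Lemma sv_le_dom T T1 c Y : bounded_lin T -> approximable T -> bounded_lin T1 -> approximable T1 -> bounded_lin Y -> 0 <= c ->
  (forall x, nm (T x) <= c * nm (T1 (Y x))) ->
  exists2 M, 0 <= M & forall n, singular_values T n <= c * (singular_values T1 n * M).
Proof.
move=> bT aT bT1 aT1 bY c0 hT.
have [e h] := singular_svd bT aT; have [e1 h1] := singular_svd bT1 aT1.
have [_ [M [M0 hM]]] := bY; exists M => // n.
have s0 : 0 <= singular_values T1 n by case: h1.
apply: (svd_minmax bT h (zs := map (adjoint Y) (mkseq e1 n))).
- by rewrite size_map size_mkseq.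
- by rewrite !mulr_ge0.
- move=> x px; apply: le_trans (hT x) _.
  rewrite -mulrA ler_wpM2l //.
  have h2 : perpn e1 n (Y x).
    by apply/perpn_perp => z zin; rewrite adjE // px // map_f.
  apply: le_trans (svd_tail h1 h2) _.
  by rewrite -mulrA ler_wpM2l.
Qed.

Lemma symmetric_norm_le T T1 : bounded_lin T -> approximable T -> bounded_lin T1 ->
  (approximable T1 -> weakly_majorized (singular_values T) (singular_values T1)) ->
  (symmetric_norm Phi T <= symmetric_norm Phi T1)%E.
Proof.
move=> bT aT bT1 h; rewrite /symmetric_norm.
have -> : `[< compact_op T >] by apply/asboolP/compactP.
case: asboolP => [/(compactP infH bT1) aT1|_]; last by rewrite leey.
apply: ge_ereal_sup => _ [k _ <-]; apply: le_trans (ereal_sup_ubound _); last by exists k.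
rewrite lee_fin.
have [e [[_ mT] s0 _ _ _]] := singular_svd bT aT.
by apply: snf_weak_majorization => //; apply: h.
Qed.

Lemma idealP T : bounded_lin T -> symmetric_ideal Phi T <-> approximable T /\
  exists B : R, forall k, Phi (pad0 (fun i : 'I_k.+1 => singular_values T i)) <= B.
Proof.
move=> bT; split.
  move=> [cT]; rewrite /symmetric_norm; case: asboolP => // _ lt_oo.
  split; first exact/(compactP infH bT).
  have n0 : (ereal_sup (range (fun k : nat =>
      (Phi (pad0 (fun i : 'I_k.+1 => singular_values T i)))%:E)) != -oo)%E.
    rewrite gt_eqF //; apply: lt_le_trans (ereal_sup_ubound _); last by exists 0%N.
    exact: ltNyr.
  move: lt_oo n0; case E: (ereal_sup _) => [B||] // _ _; exists B => k.
  by rewrite -lee_fin -E; apply: ereal_sup_ubound; exists k.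
move=> [aT [B hB]]; have cT : compact_op T by apply/compactP.
split => //; rewrite /symmetric_norm; case: asboolP => // _.
apply: le_lt_trans (ltry B); apply: ge_ereal_sup => _ [k _ <-].
by rewrite lee_fin.
Qed.

(** The two-sided ideal property in a single domination: left factors enter through the constant
    [c], right factors through [Y]. *)
Lemma ideal_dom T T1 c Y : bounded_lin T -> symmetric_ideal Phi T1 -> bounded_lin T1 -> bounded_lin Y -> 0 <= c ->
  (forall x, nm (T x) <= c * nm (T1 (Y x))) -> symmetric_ideal Phi T.
Proof.
move=> bT + bT1 bY c0 hT => /(idealP bT1)[aT1 [B hB]]; apply/(idealP bT).
have aT : approximable T.
  have := apprZ c%:C (appr_compr bY aT1); apply: dom_appr => x /=.
  by rewrite nmZr.
split => //; have [M M0 hM] := sv_le_dom bT aT bT1 aT1 bY c0 hT.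
have [e [[_ mT] s0 _ _ _]] := singular_svd bT aT.
exists (c * M * B) => k.
have /le_trans -> // : Phi (pad0 (fun i : 'I_k.+1 => singular_values T i)) <=
    Phi (pad0 (fun i : 'I_k.+1 => c * M * singular_values T1 i)).
  apply: (snf_weak_majorization hPhi (s := fun i => c * M * singular_values T1 i)) => //.
  by move=> n; apply: ler_sum => i _; rewrite mulrAC -mulrA.
rewrite (pad0_lift2 (a := fun i : 'I_k.+1 => singular_values T1 i)
  (b := fun i : 'I_k.+1 => singular_values T1 i) (g := fun u _ => c * M * u)) ?mulr0 //.
rewrite (snfZ hPhi) ?ger0_norm ?mulr_ge0 //; last exact: pad0_c00.
by rewrite ler_wpM2l // mulr_ge0.
Qed.

Lemma idealD T T1 T2 : bounded_lin T -> bounded_lin T1 -> bounded_lin T2 -> symmetric_ideal Phi T1 ->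
  symmetric_ideal Phi T2 -> (forall x, T x = T1 x + T2 x) -> symmetric_ideal Phi T.
Proof.
move=> bT bT1 bT2 /(idealP bT1)[a1 [B1 h1]] /(idealP bT2)[a2 [B2 h2]] hT.
have aT : approximable T by rewrite (_ : T = fun x => T1 x + T2 x); [exact: apprD|exact/funext].
apply/(idealP bT); split => //.
have [e h] := singular_svd bT aT; have [e1 g1] := singular_svd bT1 a1.
have [e2 g2] := singular_svd bT2 a2.
have [[_ mT] s0 _ _ _] := h.
exists (B1 + B2) => k.
have /le_trans -> // : Phi (pad0 (fun i : 'I_k.+1 => singular_values T i)) <=
    Phi (pad0 (fun i : 'I_k.+1 => singular_values T1 i + singular_values T2 i)).
  apply: (snf_weak_majorization hPhi (s := fun i => singular_values T1 i + singular_values T2 i)) => //.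
  by move=> n; rewrite big_split; apply: (ky_fan_triangle _ bT bT1 bT2 h g1 g2).
rewrite (pad0_lift2 (a := fun i : 'I_k.+1 => singular_values T1 i)
  (b := fun i : 'I_k.+1 => singular_values T2 i) (g := fun u v => u + v)) ?addr0 //.
apply: le_trans (snf_triangle hPhi _ _) _; try exact: pad0_c00.
exact: lerD.
Qed.

End NormFacts.

(** * Moore-Penrose inverses *)

Section MoorePenrosePart.
Variables (R : realType) (H : hilbertType R) (Phi : (nat -> R) -> R).
Hypotheses (infH : infinite_dimensional H) (hPhi : symmetric_norming_function Phi).
Variables (A B : H -> H).
Hypothesis hA : closed_range_op A.
Hypothesis orbB : left_orbit (symmetric_ideal Phi) A B.
Hypothesis AB : forall x, range A x -> A (adjoint B x) = x.
Hypothesis BA : forall x, range B x -> B (adjoint A x) = x.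

Let bA : bounded_lin A. Proof. by case: hA => /bopP. Qed.
Let lA := bA.1.

Lemma left_orbit_bop : bounded_lin B.
Proof. by case: orbB => G [/bopP bG _ _] <-; apply: bop_comp. Qed.

Let bB := left_orbit_bop.
Let bD : bounded_lin (A \- B). Proof. exact: bopB. Qed.

Lemma left_orbit_ideal : symmetric_ideal Phi (A \- B).
Proof.
case: orbB => G [/bopP bG _ JG] BE.
have bG1 : bounded_lin (G \- idfun) by apply: bopB => //; apply: bop_id.
apply: (ideal_dom infH hPhi (c := 1) (Y := A) bD JG bG1 bA ler01) => x.
by rewrite mul1r -BE /= nmBC.
Qed.

(** With B = GA, the identity BA*B = B reads GAA*B = GA, and G can be cancelled. *)
Lemma left_orbit_AAB x : A (adjoint A (B x)) = A x.
Proof.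
have := BA (ex_intro2 _ _ x I erefl).
case: orbB => G [/bopP bG [X [_ _ XG]] _] <- /= h.
by have := congr1 X h; rewrite -![X (G _)]/((X \o G) _) XG.
Qed.

(** The adjoint of AB*P = P is PBA* = P. Together with A*P = A* and AA*B = A it yields the Penrose
    conditions for the adjoint of A. *)
Lemma moore_penrose_left_orbit P : is_orthogonal_projection (range A) P ->
  moore_penrose (adjoint A) = P \o B.
Proof.
move=> hP; have lS := range_lin_sub lA.
have bP := orth_proj_bop lS hP; have [_ sP] := orth_proj_sa lS hP.
have bA' := adj_bop bA; have bB' := adj_bop bB.
have PA x : P (A x) = A x by apply: (orth_proj_id lS hP); exists x.
have A'P z : adjoint A (P z) = adjoint A z.
  by apply: ip_inj => w; rewrite !adjEr // sP PA.
have PBA z : P (B (adjoint A z)) = P z.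
  apply: ip_inj => w; rewrite sP adjE // adjEr // AB; last exact: (orth_proj_mem hP).
  by rewrite sP.
have AA'PB x : A (adjoint A (P (B x))) = A x by rewrite A'P left_orbit_AAB.
apply: (moore_penrose_uniq bA'.1); split.
- by apply/bopP/bop_comp.
- by apply/funext => x /=; rewrite PBA A'P.
- by apply/funext => x /=; rewrite PBA (orth_proj_id lS hP) //; apply: (orth_proj_mem hP).
- move=> x; split; first by exists (P (B x)).
  by move=> _ [z _ <-]; rewrite -adjE // (opB lA) AA'PB subrr dot0l.
- move=> x /=; rewrite PBA; have [[w _ Pw] ox] := hP x; split.
    by rewrite -Pw => y Ay; rewrite adjE // Ay dot0r.
  move=> y oy; apply/dot_eq0C/oy; rewrite /nullspace /=.
  by apply: ip_inj => v; rewrite adjEr // dot0l; apply: ox; exists v.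
Qed.

Lemma left_orbit_proj : exists P, [/\ is_orthogonal_projection (range A) P,
  moore_penrose (adjoint A) = P \o B &
  A \- moore_penrose (adjoint A) = P \o (A \- B)].
Proof.
have lS := range_lin_sub lA.
have [P hP] := orth_proj_exists lS (closed_seq_closed hA.2).
exists P; have e := moore_penrose_left_orbit hP; split => //.
rewrite e; apply/funext => x /=.
have PA : P (A x) = A x by apply: (orth_proj_id lS hP); exists x.
by rewrite (opB (orth_proj_bop lS hP).1) PA.
Qed.

Lemma left_orbit_majorized n :
  singular_values (A \- moore_penrose (adjoint A)) n <= singular_values (A \- B) n.
Proof.
have lS := range_lin_sub lA.
have [P [hP _ ->]] := left_orbit_proj.
have bP := orth_proj_bop lS hP.
have [aD _] := (idealP Phi infH bD).1 left_orbit_ideal.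
have aPD : approximable (P \o (A \- B)) by apply: appr_compl.
have [e h] := singular_svd infH (bop_comp bP bD) aPD.
have [e1 h1] := singular_svd infH bD aD.
apply: (svd_minmax (bop_comp bP bD) h (zs := mkseq e1 n)); first by rewrite size_mkseq.
  by case: h1.
move=> x /perpn_perp /(svd_tail h1); apply: le_trans.
exact: (orth_proj_nm hP).
Qed.

Lemma moore_penrose_norm_le :
  (symmetric_norm Phi (A \- moore_penrose (adjoint A))%R <= symmetric_norm Phi (A \- B)%R)%E.
Proof.
have lS := range_lin_sub lA.
have [P [hP _ e]] := left_orbit_proj.
have [aD _] := (idealP Phi infH bD).1 left_orbit_ideal.
have bP := orth_proj_bop lS hP.
apply: (symmetric_norm_le infH hPhi) => //; rewrite ?e.
- exact: bop_comp.
- exact: appr_compl.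
- by move=> _ n; apply: ler_sum => i _; rewrite -e; apply: left_orbit_majorized.
Qed.

Lemma moore_penrose_norm_eq : strictly_schur_convex H Phi ->
  symmetric_norm Phi (A \- moore_penrose (adjoint A)) = symmetric_norm Phi (A \- B) ->
  B = moore_penrose (adjoint A).
Proof.
move=> ssc eqn; have lS := range_lin_sub lA.
have [P [hP mpE e]] := left_orbit_proj.
have bP := orth_proj_bop lS hP.
have JD := left_orbit_ideal.
have JPD : symmetric_ideal Phi (P \o (A \- B)).
  apply: (ideal_dom infH hPhi (c := 1) (Y := idfun) (bop_comp bP bD) JD bD (bop_id H) ler01).
  by move=> x; rewrite mul1r; apply: (orth_proj_nm hP).
have sE : singular_values (A \- B) = singular_values (P \o (A \- B)).
  apply: ssc => //; last by rewrite -e.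
  by move=> n; apply: ler_sum => i _; rewrite -e; apply: left_orbit_majorized.
have [aD _] := (idealP Phi infH bD).1 JD.
have aPD : approximable (P \o (A \- B)) by apply: appr_compl.
have [e1 h1] := singular_svd infH (bop_comp bP bD) aPD.
have [e0 h0] := singular_svd infH bD aD.
have [[oe1 _] s0 _ t1 st] := h1.
have hn1 k : hn (P ((A \- B) (e1 k))) = singular_values (A \- B) k ^+ 2.
  rewrite sE; have [_ _ /(_ k (e1 k)) + _ _] := h1.
  by rewrite ipxx oe1 eqxx mulr1 => -[].
(* [e1] consists of singular vectors of P(A - B), but as the singular values coincide it is extremal
   for A - B as well, so these inequalities are equalities and (A - B) e1_k lies in R(A). *)
have le1 k : singular_values (A \- B) k ^+ 2 <= hn ((A \- B) (e1 k)).
  by rewrite -hn1 -le_nm; apply: (orth_proj_nm hP).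
have eqD : A \- B = P \o (A \- B).
  apply: (ons_ext bD (bop_comp bP bD) oe1 (s := singular_values (A \- B))) => //.
  - move=> k; have hk := svd_max_eq k bD h0 oe1 le1.
    apply/eqP; rewrite -subr_eq0; apply/eqP/hn_eq0.
    set v := (A \- B) (e1 k) in hk *; have [Sv ov] := hP v.
    have := hnDd (ov _ Sv); rewrite subrK hk -hn1 -/v /=; lra.
  - by move=> n x px; apply: (svd_tail_of bD h0 oe1).
  - by rewrite sE.
  - by case: h0.
  - by case: h0.
rewrite mpE; apply/funext => x; have := congr1 (fun f => f x) eqD => /=.
have PA : P (A x) = A x by apply: (orth_proj_id lS hP); exists x.
by rewrite (opB bP.1) PA => /addrI/oppr_inj.
Qed.

End MoorePenrosePart.

(** * Compact perturbations of the identity *)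

Section Fredholm.
Variables (R : realType) (H : hilbertType R).
Implicit Types (x y z : H) (A B C P X Y T Z : H -> H) (S : set H).

Lemma range_seq_closed A (c : R) : bounded_lin A -> 0 < c ->
  (forall x, c * nm x <= nm (A x)) -> seq_closed (range A).
Proof.
move=> bA c0 hA u y /= hu uy.
have /boolp.choice[v hv] : forall n, exists x, A x = u n.
  by move=> n; have [x _ <-] := hu n; exists x.
have [x vx] : exists x, tends v x.
  apply: complete_seq => e e0; have e1 : 0 < c * e / 2 by rewrite divr_gt0 // mulr_gt0.
  have [N hN] := uy _ e1; exists N => m n /hN h1 /hN h2.
  rewrite -(ltr_pM2l c0); apply: le_lt_trans (hA _) _.
  rewrite (opB bA.1) !hv; apply: le_lt_trans (nm_tri _ y _) _.
  by rewrite [nm (y - _)]nmBC; lra.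
exists x => //; apply: tends_unique (tends_bop bA vx) _.
by apply: eq_tends uy => n /=; rewrite hv.
Qed.

(** Otherwise there are unit vectors u_n with T u_n tending to 0; compactness of T - 1 makes them
    cluster at some -l with Tl = 0, so l = 0, against |u_n| = 1. *)
Lemma bounded_below T : bounded_lin T -> approximable (fun x => T x - x) ->
  (forall x, T x = 0 -> x = 0) -> exists2 c : R, 0 < c & forall x, c * nm x <= nm (T x).
Proof.
move=> bT aC inj; have lT := bT.1.
have bC : bounded_lin (fun x => T x - x) := bopB bT (bop_id H).
have /compact_seqc cC := appr_compact bC aC.
apply: contrapT => no.
have /boolp.choice[u hu] : forall n, exists x, nm x = 1 /\ nm (T x) < n.+1%:R^-1.
  move=> n; apply: contrapT => /forallNP h; apply: no; exists (n.+1%:R^-1) => [|x].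
    by rewrite invr_gt0.
  have [->|/[dup] x0 /nm_gt0 nx] := eqVneq x 0; first by rewrite nm0 mulr0 nm_ge0.
  rewrite leNgt; apply/negP => hx; apply: (h ((nm x)^-1%:C *: x)); split.
    by rewrite nmZr ?invr_ge0 ?nm_ge0 // mulVf // gt_eqF.
  by rewrite (opZ lT) nmZr ?invr_ge0 ?nm_ge0 // ltr_pdivrMl // mulrC.
have u1 n : nm (u n) <= 1 by rewrite (hu n).1.
have [l hl] := cC u u1.
have [_ [M [M0 hM]]] := bT.
have app d : 0 < d -> exists n, nm (u n + l) < d /\ nm (T (u n)) < d.
  move=> d0; have d2 : 0 < d / 2 by rewrite divr_gt0.
  have [N hN] := inv_small d2; have [n /hN Nn h] := hl _ d2 N.
  have h2 := (hu n).2; exists n; split; last by move: Nn h2; move: (_^-1) => i; lra.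
  have -> : u n + l = T (u n) - (T (u n) - u n - l) by rewrite !opprB addrCA
    [X in l + X]addrC subrK addrC.
  apply: le_lt_trans (nmB _ _) _; move: Nn h2 h; move: (_^-1) => i; lra.
have Tl : T l = 0.
  apply/nm_eq0/eqP; rewrite eq_le nm_ge0 andbT; apply/ler_addgt0Pr => d d0; rewrite add0r.
  have M1 : 0 < d / (M + 1) by rewrite divr_gt0 //; lra.
  have [n [h1 h2]] := app _ M1.
  have -> : T l = T (u n + l) - T (u n) by rewrite (opD lT) addrC addKr.
  apply: le_trans (nmB _ _) _; have := hM (u n + l); have := nm_ge0 (u n + l).
  move: h1 h2; set q := d / _; have : q * (M + 1) = d by rewrite mulfVK // gt_eqF //; lra.
  nra.
have l0 := inj _ Tl.
have [n [h _]] := app 1 ltr01; by move: h; rewrite l0 addr0 (hu n).1 ltxx.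
Qed.

Lemma bop_iter T n : bounded_lin T -> bounded_lin (iter n T).
Proof.
move=> bT; elim: n => [|n IH]; first exact: bop_id.
exact: bop_comp bT IH.
Qed.

(** If y0 is missed, injectivity makes the closed ranges of the powers of T strictly decreasing.
    Unit vectors e_n in R(T^n) orthogonal to R(T^(n+1)) have images under T - 1 at mutual distance
    at least 1, against compactness. *)
Lemma fredholm_alternative T : bounded_lin T -> approximable (fun x => T x - x) ->
  (forall x, T x = 0 -> x = 0) -> forall y, exists x, T x = y.
Proof.
move=> bT aC inj y0; have lT := bT.1; apply: contrapT => /forallNP nsurj.
have [c c0 hc] := bounded_below bT aC inj.
have bC : bounded_lin (fun x => T x - x) := bopB bT (bop_id H).
have /compact_seqc cC := appr_compact bC aC.
have lIt n := (bop_iter n bT).1.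
have injit n x : iter n T x = 0 -> x = 0 by elim: n => // n IH /= /inj/IH.
have hit n x : c ^+ n * nm x <= nm (iter n T x).
  elim: n => [|n IH] /=; first by rewrite expr0 mul1r.
  rewrite exprS -mulrA; apply: le_trans (hc _); by rewrite ler_pM2l.
have lS n := range_lin_sub (lIt n).
have cS n : seq_closed (range (iter n T)).
  by apply: range_seq_closed (bop_iter n bT) (exprn_gt0 n c0) (hit n).
have sub m n : (n <= m)%N -> range (iter m T) `<=` range (iter n T).
  move=> nm _ [x _ <-]; exists (iter (m - n) T x) => //.
  by rewrite -iterD subnKC.
have ex n : exists x, [/\ nm x = 1, range (iter n T) x &
    orthogonal_complement (range (iter n.+1 T)) x].
  have [P hP] := orth_proj_exists (lS n.+1) (@cS n.+1).
  pose y := iter n T y0; have [Py oy] := hP y.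
  have d0 : y - P y != 0.
    apply/eqP => /eqP; rewrite subr_eq0 => /eqP yP.
    move: Py; rewrite -yP => -[x _]; rewrite iterSr => e.
    apply: (nsurj x); apply/eqP; rewrite -subr_eq0; apply/eqP/(injit n).
    by rewrite (opB (lIt n)) e subrr.
  have [r r0 hr] := hn_scale d0.
  exists (r%:C *: (y - P y)); have [_ _ SZ] := lS n;
    have [_ _ CZ] := orth_lin_sub (range (iter n.+1 T)).
  split; first by rewrite /nm hr sqrtr1.
    apply: SZ; apply: (lin_subB (lS n)); first by exists y0.
    exact: (@sub n.+1 n (leqnSn n)).
  exact: CZ.
have /boolp.choice[e he] := ex.
have e1 n : nm (e n) <= 1 by have [->] := he n.
have [l hl] := cC e e1.
have h2 : (0 : R) < 2^-1 by rewrite invr_gt0.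
have [n _ hn1] := hl _ h2 0%N; have [m nm1 hm] := hl _ h2 n.+1.
have [en Sn on] := he n; have [em Sm om] := he m.
(* As m > n, [w] lies in R(T^(n+1)) and is orthogonal to e_n; the difference of the two images is w
   - e_n. *)
pose w := T (e n) - (T (e m) - e m).
have Sw : range (iter n.+1 T) w.
  apply: (lin_subB (lS n.+1)).
    by have [x _ <-] := Sn; exists x.
  apply: (lin_subB (lS n.+1)); last exact: (@sub m n.+1 nm1).
  have [x _ <-] := Sm; apply: (@sub m.+1 n.+1); [exact: ltnW|by exists x].
have E : T (e n) - e n - (T (e m) - e m) = w - e n by rewrite addrAC.
have : 1 <= nm (T (e n) - e n - (T (e m) - e m)).
  rewrite E -[1]sqrtr1 ler_wsqrtr // hnB -(nm2 (e n)) en expr1n.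
  rewrite (dot_eq0C (on _ Sw)) /= mulr0 subr0 lerDr hn_ge0 //.
have := nm_tri (T (e n) - e n) l (T (e m) - e m); rewrite [nm (l - _)]nmBC.
lra.
Qed.

Lemma appr_sum I (r : seq I) (F : I -> H -> H) : (forall i, approximable (F i)) ->
  approximable (fun x => \sum_(i <- r) F i x).
Proof.
move=> aF; elim: r => [|i r IH].
  by have := @appr0 R H; congr approximable; apply/funext => x; rewrite big_nil.
by have := apprD (aF i) IH; congr approximable; apply/funext => x; rewrite big_cons.
Qed.

(* Otherwise a finite rank perturbation of Z would be injective without being
   surjective. *)
Lemma fredholm_kernel Z (xs zs : seq H) : bounded_lin Z -> approximable (fun x => Z x - x) ->
  on1 (@ip R H) xs -> (forall x z, x \in xs -> ip (Z z) x = 0) ->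
  (size zs < size xs)%N -> exists z, [/\ z != 0, Z z = 0 & perp zs z].
Proof.
move=> bZ aZ /andP[/(pairwiseP 0) pw /allP a1] Zx szs; apply: contrapT => /forallNP no.
pose F z := Z z + \sum_(i <- iota 0 (size zs)) ip z zs`_i *: xs`_i.
have oxs i j : (i < size xs)%N -> (j < size xs)%N -> ip xs`_i xs`_j = (i == j)%:R.
  move=> hi hj; have [lt|gt|->] := ltngtP i j.
  - by apply/eqP; apply: pw; rewrite ?inE.
  - by apply/dot_eq0C/eqP; apply: pw; rewrite ?inE.
  - by rewrite ipxx /hn (eqP (a1 _ (mem_nth _ hj))).
have bF : bounded_lin F by apply: bopD => //; apply: bop_sum => i; apply: bop_rank1.
have aF : approximable (fun x => F x - x).
  have := apprD aZ (appr_sum (iota 0 (size zs)) (fun i => appr_rank1 zs`_i xs`_i)).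
  by congr approximable; apply/funext => x; rewrite /F addrAC.
have ipF z j : (j < size xs)%N -> ip (F z) xs`_j = if (j < size zs)%N then ip z zs`_j else 0.
  move=> hj; rewrite dotDl Zx ?mem_nth // add0r dot_suml.
  case: ifP => jz; last first.
    rewrite big_seq big1 // => i; rewrite mem_iota => /andP[_ iz].
    rewrite dotZl oxs ?(ltn_trans iz) // (_ : (_ == _) = false) ?mulr0 //.
    by apply: contraFF jz => /eqP <-.
  rewrite (bigD1_seq j) ?iota_uniq ?mem_iota //= dotZl oxs // eqxx mulr1.
  rewrite big_seq_cond big1 ?addr0 // => i /andP[]; rewrite mem_iota => /andP[_ iz] ij.
  by rewrite dotZl oxs ?(ltn_trans iz) // (negPf ij) mulr0.
have injF z : F z = 0 -> z = 0.
  move=> Fz; have pz : perp zs z.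
    move=> _ /(nthP 0)[i iz <-]; have := ipF z i (ltn_trans iz szs).
    by rewrite iz Fz dot0l.
  apply: contrapT => /eqP z0; apply: (no z); split => //.
  move: Fz; rewrite /F big_seq big1 ?addr0 // => i; rewrite mem_iota => /andP[_ iz].
  by rewrite pz ?scale0r // mem_nth.
(* This member of [xs] is the first one orthogonal both to the range of Z and to the finite-rank
   correction, so it cannot be a value of F. *)
have [z Fz] := fredholm_alternative bF aF injF xs`_(size zs).
have := ipF z _ szs; rewrite Fz oxs // eqxx ltnn => /eqP.
by rewrite oner_eq0.
Qed.

(** The vectors are found one at a time: Xz is orthogonal to an earlier g exactly when z is
    orthogonal to X*g, and there are fewer such conditions than vectors in [xs]. *)
Lemma fredholm_orthonormal Z X (xs : seq H) n : bounded_lin Z -> approximable (fun x => Z x - x) ->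
  bounded_lin X -> (forall z, X z = 0 -> z = 0) ->
  on1 (@ip R H) xs -> (forall x z, x \in xs -> ip (Z z) x = 0) ->
  (n <= size xs)%N -> exists gs, [/\ size gs = n, on1 (@ip R H) gs &
    forall g, g \in gs -> exists2 z, Z z = 0 & g = X z].
Proof.
move=> bZ aZ bX injX onx Zx; elim: n => [|n IH] nx; first by exists [::].
have [gs [sg og hg]] := IH (ltnW nx).
have szs : (size (map (adjoint X) gs) < size xs)%N by rewrite size_map sg.
have [z [z0 Zz pz]] := fredholm_kernel bZ aZ onx Zx szs.
have Xz0 : X z != 0 by apply: contra_neq z0 => /injX.
have [r r0 hr] := hn_scale Xz0.
exists (r%:C *: X z :: gs); split.
- by rewrite /= sg.
- rewrite on1_cons og andbT -/(hn _) hr eqxx /=; apply/allP => g gin; apply/eqP.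
  by rewrite dotZl adjE // pz ?mulr0 // map_f.
- move=> g; rewrite inE => /orP[/eqP->|/hg//].
  by exists (r%:C *: z); rewrite ?(opZ bZ.1) ?Zz ?scaler0 // (opZ bX.1).
Qed.

End Fredholm.

(** * Polar factors *)

Section KeyInequality.
Variables (R : realType) (H : hilbertType R).
Variables (U V W X P : H -> H).
Implicit Types (x y z g : H) (b : H * H).
Notation hproj := (dproj (@ip R H)).
Notation pdot := (pair_dot (@ip R H)).

Hypothesis bU : bounded_lin U.
Hypothesis saP : self_adjoint P.
Hypothesis PP : forall x, P (P x) = P x.
Hypothesis UU : forall x y, ip (U x) (U y) = ip (P x) y.
Hypothesis saW : self_adjoint W.
Hypothesis PW : forall x, P (W x) = W x.
(** P + W stands for |A|, and in the equality case for P + (1 + d)(|A| - P). *)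
Hypothesis pos : forall x, 0 <= complex.Re (ip (P x + W x) x).
Hypothesis bV : bounded_lin V.
Hypothesis V1 : forall x, nm (V x) <= nm x.
Hypothesis bX : bounded_lin X.
Hypothesis injX : forall z, X z = 0 -> z = 0.
Hypothesis aX : approximable (fun x => X x - x).
(** In the application V = G A K^-1 and X is the adjoint of K^-1, which carries N(A)^perp into the
    initial space of V. *)
Hypothesis VX : forall z y, P z = z -> ip (V (X z)) (V y) = ip (X z) y.
Hypothesis aUV : approximable (fun x => U x - V x).

Variables (e : nat -> H) (w : nat -> R).
Hypothesis oe : orthonormal_seq e.
Hypothesis We : forall i, W (e i) = (w i)%:C *: e i.

Let lU := bU.1.
Let lP := saP.1.1.
Let lW := saW.1.1.
Let lV := bV.1.
Let lX := bX.1.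
Let sP := saP.2.
Let sW := saW.2.
Let WP x : W (P x) = W x.
Proof. by apply: ip_inj => y; rewrite sW sP PW -sW. Qed.

Let UP x : U (P x) = U x.
Proof.
apply/eqP; rewrite -subr_eq0 -(opB lU); apply/eqP/hn_eq0.
by rewrite /hn /sqn UU (opB lP) PP subrr dot0l.
Qed.

Let Bop x := P x + W x.
Let A x := U (Bop x).
Let lB : linear Bop. Proof. exact: (bopD saP.1 saW.1).1. Qed.
Let lA : linear A. Proof. exact: (bop_comp bU (bopD saP.1 saW.1)).1. Qed.
Let sB x y : ip (Bop x) y = ip x (Bop y).
Proof. by rewrite /Bop dotDl dotDr sP sW. Qed.
Let PB x : P (Bop x) = Bop x. Proof. by rewrite /Bop (opD lP) PP PW. Qed.
Let BP x : Bop (P x) = Bop x. Proof. by rewrite /Bop PP WP. Qed.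

Variables (s : nat -> R) (f : nat -> H) (n : nat).
Hypothesis hD : svd (fun x => A x - V x) s f.
(** A nonzero eigenvalue places e_i in the range of P, where U is isometric. *)
Hypothesis wn0 : forall i, (i < n)%N -> w i != 0.

Let Ip := [seq i <- iota 0 n | 0 < w i].
Let Im := [seq i <- iota 0 n | ~~ (0 < w i)].
Let r : R := Num.sqrt 2^-1.
Let r2 : r ^+ 2 = 2^-1. Proof. by rewrite sqr_sqrtr // invr_ge0. Qed.

Let Pe i : (i < n)%N -> P (e i) = e i.
Proof.
move=> ni; have := PW (e i); rewrite We (opZ lP) => /eqP.
rewrite -subr_eq0 -scalerBr scaler_eq0 => /orP[|].
  by rewrite eq_complex /= (negPf (wn0 ni)).
by rewrite subr_eq0 => /eqP.
Qed.

Let Be i : (i < n)%N -> Bop (e i) = (1 + w i)%:C *: e i.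
Proof. by move=> ni; rewrite /Bop Pe // We rmorphD /= scalerDl scale1r. Qed.

Let lam_ge0 i : (i < n)%N -> 0 <= 1 + w i.
Proof.
move=> ni; have := pos (e i); rewrite -/(Bop _) Be // dotZl cReZ oe eqxx mulr1 //.
Qed.

Let ltI i J : i \in [seq i <- iota 0 n | J i] -> (i < n)%N.
Proof. by rewrite mem_filter mem_iota => /andP[_]. Qed.

Let on1_sub J : on1 (@ip R H) [seq e i | i <- iota 0 n & J i].
Proof.
apply/andP; split; last by apply/allP => _ /mapP[i _ ->]; apply/eqP/(hn_ons i oe).
rewrite pairwise_map; have := filter_uniq J (iota_uniq 0 n); rewrite uniq_pairwise.
by apply: sub_pairwise => i j /= ij; rewrite /orth2 oe (negPf ij).
Qed.

Let xm := [seq e i | i <- Im].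
Let P' x := P x - hproj xm x.
Let on_xm : on0 (@ip R H) xm := on1_on0 (on1_sub _).
Let bP' : bounded_lin P' := bopB saP.1 (bop_proj xm).
Let lP' := bP'.1.

Let Pxm x : x \in xm -> P x = x.
Proof. by move=> /mapP[i /ltI ni ->]; apply: Pe. Qed.

Let Phm x : P (hproj xm x) = hproj xm x.
Proof.
rewrite /dproj (op_sum lP) big_seq [RHS]big_seq; apply: eq_bigr => b bin.
by rewrite (opZ lP) Pxm.
Qed.

Let hmP x : hproj xm (P x) = hproj xm x.
Proof.
by apply: ip_inj => y; rewrite !dot_projC sP Phm.
Qed.

Let hmm x : hproj xm (hproj xm x) = hproj xm x.
Proof.
rewrite {1}/dproj; under eq_big_seq => b bin do rewrite dot_projC on0_projE //.
by [].
Qed.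

Let PP' x : P (P' x) = P' x. Proof. by rewrite /P' (opB lP) PP Phm. Qed.
Let hmP' x : hproj xm (P' x) = 0.
Proof.
have [lh _] := bop_proj xm.
by rewrite /P' (opB lh) hmP hmm subrr.
Qed.
Let sP' x y : ip (P' x) y = ip x (P' y).
Proof. by rewrite dotBl dotBr sP dot_projC. Qed.

Let Uadj := adjoint U.
Let bUadj : bounded_lin Uadj := adj_bop bU.
Let G x := x + Uadj (V x).
Let bG : bounded_lin G := bopD (bop_id H) (bop_comp bUadj bV).
Let lG := bG.1.
(** Modulo compact operators X is 1 and V is U, so half of P'(1 + U*V)XP is P' and Z is the
    identity. Its range is orthogonal to [xm], so index zero gives a kernel of dimension at least
    the length of [xm]. For z in the kernel, g = Xz makes (g, -Vg) a member of [S]. *)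
Let Z z := 2^-1%:C *: P' (G (X (P z))) + (z - P z).

Let UadjU x : Uadj (U x) = P x.
Proof. by apply: ip_inj => y; rewrite adjEr // UU. Qed.

Let bXP : bounded_lin (X \o P) := bop_comp bX saP.1.

Let bZ : bounded_lin Z.
Proof.
apply: bopD; last exact: bopB (bop_id H) saP.1.
exact: bopZ (bop_comp bP' (bop_comp bG bXP)).
Qed.

Let aZ : approximable (fun z => Z z - z).
Proof.
have a1 : approximable (fun z => P' (G (X (P z) - P z))).
  exact: appr_compl bP' (appr_compl bG (appr_compr saP.1 aX)).
have a2 : approximable (fun z => P' (Uadj (U (P z) - V (P z)))).
  exact: appr_compl bP' (appr_compl bUadj (appr_compr saP.1 aUV)).
have a3 := appr_hproj xm.
have := apprB (apprZ (2^-1%:C) (apprB a1 a2)) a3.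
congr approximable; apply/funext => z.
rewrite (opB bUadj.1) UadjU PP !(opB lP') (opB lG) (opB lP').
have -> : P' (G (P z)) = P' (P z) + P' (Uadj (V (P z))) by rewrite -(opD lP').
have -> : P' (P z) = P z - hproj xm z by rewrite /P' PP hmP.
rewrite /Z; set q := P' (G _); set t := P' (Uadj _); set p := P z; set m := hproj xm z.
have h2 : (2^-1)%:C = 2^-1 :> R[i] by rewrite fmorphV /= rmorph_nat.
apply: ip_inj => y; rewrite !(dotDl, dotBl, dotZl, dotNl) h2.
by field.
Qed.

Let Z_orth x z : x \in xm -> ip (Z z) x = 0.
Proof.
move=> xin; have P'x : P' x = 0 by rewrite /P' Pxm // on0_projE // subrr.
by rewrite dotDl dotZl sP' P'x dot0r mulr0 add0r dotBl sP Pxm // subrr.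
Qed.

Let Z_ker z : Z z = 0 -> P z = z /\ P' (G (X z)) = 0.
Proof.
move=> Zz; have PZ : P (Z z) = 0 by rewrite Zz (op0 lP).
move: (PZ); rewrite /Z (opD lP) (opZ lP) PP' (opB lP) PP subrr addr0 => h.
have Pz : P z = z.
  by move: Zz; rewrite /Z h add0r => /eqP; rewrite subr_eq0 => /eqP.
split => //; move/eqP: h; rewrite scaler_eq0 Pz => /orP[|/eqP//].
by rewrite eq_complex /= invr_eq0 pnatr_eq0.
Qed.

(** Orthogonality to all (x, -Ux) with x in R(P) orthogonal to [xm]; on such pairs the A-form can be
    negative only through the directions in [xm]. *)
Let S : set (H * H) := [set b | forall x, P x = x -> hproj xm x = 0 ->
  ip b.1 x = ip b.2 (U x)].

Let lin_S : lin_sub S.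
Proof.
split => /= [x _ _|x y hx hy z h1 h2|a x hx z h1 h2].
- by rewrite !dot0l.
- by rewrite !dotDl hx ?hy.
- by rewrite !dotZl hx.
Qed.

Let pairA i : H * H := (r%:C *: e i, r%:C *: U (e i)).
Let pairC g : H * H := (r%:C *: g, - r%:C *: V g).

Let bsA := [seq pairA i | i <- Ip].

Let as_on0 : on0 pdot bsA.
Proof.
apply: on1_on0; apply/andP; split.
  rewrite pairwise_map; have : uniq Ip by rewrite filter_uniq ?iota_uniq.
  rewrite uniq_pairwise; apply: (sub_in_pairwise (P := fun i => (i < n)%N)).
    move=> i j ni nj /= ij; rewrite /orth2 pair_dotE /=.
    have h1 : ip (e i) (e j) = 0 by rewrite oe (negPf ij).
    have h2 : ip (U (e i)) (U (e j)) = 0 by rewrite UU Pe.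
    by rewrite (ip_scale0 r%:C r%:C h1) (ip_scale0 r%:C r%:C h2) addr0.
  by apply/allP => i /ltI.
apply/allP => _ /mapP[i /ltI ni ->]; rewrite sqn_pair -!/(hn _).
rewrite (hnZr r (e i)) (hnZr r (U (e i))) r2 hn_ons // /hn /sqn UU Pe // oe eqxx /=.
by apply/eqP; lra.
Qed.

Let as_S b : b \in bsA -> S b.
Proof.
move=> /mapP[i /ltI ni ->] x Px _ /=.
by rewrite !dotZl UU Pe.
Qed.

Section WithKernel.
Variable gs : seq H.
Hypothesis sgs : size gs = size xm.
Hypothesis ogs : on1 (@ip R H) gs.
Hypothesis hgs : forall g, g \in gs -> exists2 z, Z z = 0 & g = X z.
Let bsC := [seq pairC g | g <- gs].

Let Vg g y : g \in gs -> ip (V g) (V y) = ip g y.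
Proof. by move=> /hgs[z /Z_ker[Pz _] ->]; apply: VX. Qed.

Let cs_on0 : on0 pdot bsC.
Proof.
have /andP[pw /allP a1] := ogs.
have cr : Num.conj r%:C = r%:C by exact: conj_realE.
have rm : Num.conj (- r%:C) = - r%:C by rewrite rmorphN /= cr.
have C0 g h : g \in gs -> pdot (pairC g) (pairC h) = ip g h.
  move=> gin; rewrite pair_dotE /= !dotZl !dotZr rm Vg // mulrA mul_conj csq_real r2.
  rewrite mulrA mulrNN -rmorphM /= -expr2 r2 -mulrDl -rmorphD /=.
  by rewrite (_ : 2^-1 + 2^-1 = 1) ?mul1r //; lra.
apply: on1_on0; apply/andP; split.
  rewrite pairwise_map; apply: (sub_in_pairwise (P := mem gs)) pw.
    by move=> g h gin hin /= /eqP gh; rewrite /orth2 C0 // gh.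
  by apply/allP.
apply/allP => _ /mapP[g gin ->]; rewrite /sqn C0 //.
exact: a1.
Qed.

Let cs_S b : b \in bsC -> S b.
Proof.
move=> /mapP[g /hgs[z /Z_ker[Pz hz] ->] ->] x Px mx /=.
have : ip (G (X z)) x = 0.
  have -> : x = P' x by rewrite /P' Px mx subr0.
  by rewrite -sP' hz dot0l.
rewrite /G dotDl adjEr // !dotZl => /eqP; rewrite addr_eq0 => /eqP->.
by rewrite mulrN mulNr.
Qed.

(** A sesquilinear form on H x H with diagonal 2 Re <C b.1, b.2>, in the shape required by
    [trace_indep]. *)
Let tr (C : H -> H) (b c : H * H) : R[i] := ip (C b.1) c.2 + ip b.2 (C c.1).

Let tr_lin C : linear C -> forall y : H * H, linear_for *%R ((tr C)^~ y).
Proof.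
move=> lC y a x z; rewrite /tr /= (opD lC) (opZ lC) !dotDl !dotZl.
by rewrite mulrDr addrACA.
Qed.

Let tr_D C : linear C -> forall x y z : H * H, tr C x (y + z) = tr C x y + tr C x z.
Proof. by move=> lC x y z; rewrite /tr /= (opD lC) !dotDr addrACA. Qed.

Let tr_Z C : linear C -> forall a (x y : H * H), tr C x (a *: y) = Num.conj a * tr C x y.
Proof. by move=> lC a x y; rewrite /tr /= (opZ lC) !dotZr mulrDr. Qed.

Let tr_Re C b : complex.Re (tr C b b) = 2 * complex.Re (ip (C b.1) b.2).
Proof. by rewrite /tr cReD (dotReC _ (C b.1)) mulr_natl mulr2n. Qed.

(** On [S] the vectors P'u and P'U*v coincide, so <Au, v> splits into <Bop P'u, P'u> >= 0 and terms
    over [xm]; for the latter 2 Re (ab) >= -|a - conj b|^2 / 2. *)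
Let Re_lower (u v : H) : S (u, v) ->
  - \sum_(i <- Im) (1 + w i) * (csq (pdot (u, v) (e i, - U (e i))) / 2) <=
  2 * complex.Re (ip (A u) v).
Proof.
move=> Suv; pose z := Uadj v.
have Pz : P z = z by apply: ip_inj => y; rewrite sP /z !adjEr // UP.
have e0 : P' u = P' z.
  apply: ip_inj => y; rewrite !sP' (Suv (P' y)) ?PP' ?hmP' //=.
  by rewrite /z adjEr.
have lh := (bop_proj xm).1.
have Bh y : Bop (hproj xm y) = \sum_(i <- Im) ((1 + w i)%:C * ip y (e i)) *: e i.
  rewrite /dproj (op_sum lB) big_map big_seq [RHS]big_seq; apply: eq_bigr => i /ltI ni.
  by rewrite (opZ lB) Be // scalerA mulrC.
have cross y t : ip (Bop (hproj xm y)) (P' t) = 0.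
  rewrite Bh dot_suml big_seq big1 // => i iin; rewrite dotZl.
  suff -> : ip (e i) (P' t) = 0 by rewrite mulr0.
  rewrite -sP' (_ : P' (e i) = 0) ?dot0l //.
  have xin : e i \in xm by apply: map_f.
  by rewrite /P' Pxm // on0_projE // subrr.
have uE : Bop u = Bop (P' u) + Bop (hproj xm u) by rewrite -(opD lB) /P' subrK BP.
have zE : z = P' z + hproj xm z by rewrite /P' subrK Pz.
have AE : ip (A u) v = ip (Bop (P' u)) (P' u) +
    \sum_(i <- Im) (1 + w i)%:C * (ip u (e i) * ip (U (e i)) v).
  rewrite /A adjE // -[adjoint U v]/z uE zE dotDl !(dotDr _ (P' z) (hproj xm z)) cross add0r -e0.
  have -> : ip (Bop (P' u)) (hproj xm z) = 0 by rewrite sB; apply/dot_eq0C/cross.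
  rewrite addr0 Bh dot_suml; congr (_ + _); apply: eq_big_seq => i iin.
  rewrite dotZl -mulrA; congr (_ * (_ * _)).
  have xin : e i \in xm by apply: map_f.
  by rewrite -dot_projC on0_projE // /z -adjE.
rewrite AE cReD cRe_sum mulrDr -[leLHS]add0r; apply: lerD.
  by rewrite mulr_ge0 //; apply: pos.
rewrite mulr_sumr -sumrN big_seq [leRHS]big_seq; apply: ler_sum => i /ltI ni.
have := lam_ge0 ni; rewrite cReZ pair_dotE /= dotNr [ip v _]dotC.
move: (1 + w i) (ip u (e i)) (ip (U (e i)) v) => q [a b] [c d]; rewrite /csq /= => q0.
have := sqr_ge0 (a + c); have := sqr_ge0 (b - d); nra.
Qed.

Lemma key_with_kernel : \sum_(i < n) `|w i| <= \sum_(i < n) s i.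
Proof.
have [hs [on_h sh ph hS]] := gram_schmidt bsC as_on0.
have [hs' [on_h' sh' ph' hS']] := gram_schmidt bsA cs_on0.
have lD : linear (fun x => A x - V x).
  by apply: mk_linear => [x y|a x]; rewrite ?(opD lA) ?(opD lV) ?(opZ lA) ?(opZ lV) ?scalerBr //
    opprD addrACA.
have bD : bounded_lin (fun x => A x - V x) by apply: bopB => //; apply: (bop_comp bU (bopD saP.1 saW.1)).
have nE : (size Ip + size Im = n)%N.
  by rewrite !size_filter -[RHS](size_iota 0 n) count_predC.
have sb : (size (bsA ++ hs) <= n)%N.
  by rewrite size_cat sh !size_map sgs size_map nE.
have up := ky_fan_pair bD hD (on0_subon on_h) sb.
have f12 b : b \in bsA ++ hs -> dproj pdot (bsC ++ hs') b = b.
  have base c : c \in bsA -> dproj pdot (bsC ++ hs') c = c by apply: ph'.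
  have base' c : c \in bsC -> dproj pdot (bsC ++ hs') c = c.
    by move=> cin; apply: on0_projE => //; rewrite mem_cat cin.
  rewrite mem_cat => /orP[/base//|hin].
  exact: (hS _ (lin_sub_proj pdot (bsC ++ hs')) base base' b hin).
have f21 b : b \in bsC ++ hs' -> dproj pdot (bsA ++ hs) b = b.
  have base c : c \in bsC -> dproj pdot (bsA ++ hs) c = c by apply: ph.
  have base' c : c \in bsA -> dproj pdot (bsA ++ hs) c = c.
    by move=> cin; apply: on0_projE => //; rewrite mem_cat cin.
  rewrite mem_cat => /orP[/base//|hin].
  exact: (hS' _ (lin_sub_proj pdot (bsA ++ hs)) base base' b hin).
have trV := trace_indep (tr_lin lV) (tr_D lV) (tr_Z lV) f12 f21.
have {trV} trV : \sum_(b <- bsA ++ hs) 2 * complex.Re (ip (V b.1) b.2) =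
    \sum_(b <- bsC ++ hs') 2 * complex.Re (ip (V b.1) b.2).
  have := congr1 (@complex.Re R) trV; rewrite !cRe_sum.
  by under eq_bigr => b _ do rewrite tr_Re; under [RHS]eq_bigr => b _ do rewrite tr_Re.
have split : \sum_(b <- bsA ++ hs) 2 * complex.Re (ip (A b.1 - V b.1) b.2) =
   \sum_(b <- bsA ++ hs) 2 * complex.Re (ip (A b.1) b.2) -
   \sum_(b <- bsC ++ hs') 2 * complex.Re (ip (V b.1) b.2).
  rewrite -trV -sumrB; apply: eq_bigr => b _.
  by rewrite dotBl cReB mulrBr.
rewrite split in up.
have upV : \sum_(b <- bsC ++ hs') 2 * complex.Re (ip (V b.1) b.2) <=
    (size Ip)%:R - (size Im)%:R.
  rewrite big_cat /= [leRHS]addrC; apply: lerD; last first.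
    (* V is a contraction, so each remaining pair of norm at most 1 contributes at most 1; their
       number is the size of [Ip]. *)
    apply: (@le_trans _ _ (\sum_(b <- hs') 1)); last first.
      by rewrite big_const_seq count_predT iter_addr_0 sh' size_map.
    rewrite big_seq [leRHS]big_seq; apply: ler_sum => b bin.
    have b1 : hn b.1 + hn b.2 <= 1.
      have := on0_subon on_h'; rewrite /subon => /andP[_ /allP/(_ b)].
      by rewrite mem_cat bin orbT => /(_ isT); rewrite sqn_pair.
    have := Re_ip_le (V b.1) b.2; have := V1 b.1; move: b1; rewrite -!nm2.
    move: (nm b.1) (nm b.2) (nm (V b.1)) (nm_ge0 b.1) (nm_ge0 b.2) (nm_ge0 (V b.1)).
    move=> p q t p0 q0 t0 b1 tp; have := sqr_ge0 (p - q).
    have : t * q <= p * q by rewrite ler_wpM2r.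
    nra.
  rewrite -(size_map e Im) -[size (map e Im)]/(size xm) -sgs.
  rewrite (_ : - (size gs)%:R = \sum_(g <- gs) -1); last first.
    by rewrite big_const_seq count_predT iter_addr_0 mulNrn.
  rewrite big_map big_seq [leRHS]big_seq; apply: ler_sum => g gin /=.
  rewrite (opZ lV) dotZl dotZr Vg // rmorphN /=.
  have /andP[_ /allP/(_ _ gin)/eqP g1] := ogs.
  have -> : Num.conj r%:C = r%:C by exact: conj_realE.
  rewrite mulrA mulrN -rmorphM /= -expr2 r2 mulNr cReN cReZ -/(sqn _ g) g1; lra.
have lowA : \sum_(i <- Ip) (1 + w i) - \sum_(i <- Im) (1 + w i) <=
    \sum_(b <- bsA ++ hs) 2 * complex.Re (ip (A b.1) b.2).
  rewrite big_cat /=; apply: lerD.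
    rewrite big_map big_seq [leRHS]big_seq; apply: ler_sum => i /ltI ni /=.
    have -> : A (r%:C *: e i) = (r * (1 + w i))%:C *: U (e i).
      by rewrite /A (opZ lB) Be // !(opZ lU) scalerA -rmorphM.
    rewrite dotZl dotZr UU Pe // oe eqxx mulr1.
    have -> : Num.conj r%:C = r%:C by exact: conj_realE.
    by rewrite -rmorphM /= mulrAC -expr2 r2 mulrA divff ?mul1r.
  have hsS h : h \in hs -> S h by apply: hS.
  have low h : h \in hs -> - \sum_(i <- Im) (1 + w i) * (csq (pdot h (e i, - U (e i))) / 2) <=
      2 * complex.Re (ip (A h.1) h.2).
    by case: h => u v /hsS; apply: Re_lower.
  apply: (@le_trans _ _ (\sum_(h <- hs) - \sum_(i <- Im)
    (1 + w i) * (csq (pdot h (e i, - U (e i))) / 2))); last first.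
    by rewrite big_seq [leRHS]big_seq; apply: ler_sum => h /low.
  (* By Bessel the weights of a fixed i add up to at most half the squared norm of (e_i, -U e_i),
     that is 1. *)
  rewrite sumrN lerN2 exchange_big big_seq [leRHS]big_seq; apply: ler_sum => i /ltI ni.
  rewrite -mulr_sumr -mulr_suml ler_piMr ?lam_ge0 // ler_pdivrMr // mul1r.
  have sub : subon pdot hs.
    by apply: on0_subon; move: on_h; rewrite on0_cat => /and3P[].
  under eq_bigr => h _ do rewrite -csq_dotC.
  apply: le_trans (bessel _ sub) _; rewrite sqn_pair /= -!/(hn _) hnN hn_ons //.
  by rewrite /hn /sqn UU Pe // oe eqxx /=.
have -> : \sum_(i < n) `|w i| = \sum_(i <- Ip) w i - \sum_(i <- Im) w i.
  rewrite -(big_mkord xpredT (fun i => `|w i|)) /index_iota subn0.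
  rewrite (bigID (fun i => 0 < w i)) /= /Ip /Im !big_filter -sumrN; congr (_ + _).
    by apply: eq_bigr => i h; rewrite gtr0_norm.
  by apply: eq_bigr => i; rewrite -leNgt => h; rewrite ler0_norm.
(* The sizes produced by the 1 in 1 + w_i cancel against the bound for the V-trace. *)
have eI L : \sum_(i <- L) (1 + w i) = (size L)%:R + \sum_(i <- L) w i.
  by rewrite big_split /= big_const_seq count_predT iter_addr_0.
move: lowA up upV; rewrite !eI; lra.
Qed.

End WithKernel.

Lemma key_inequality : \sum_(i < n) `|w i| <= \sum_(i < n) s i.
Proof.
have [gs [sgs ogs hgs]] := fredholm_orthonormal bZ aZ bX injX (on1_sub _) Z_orth (leqnn _).
exact: key_with_kernel hgs.
Qed.

End KeyInequality.

(** * Null spaces, self-adjoint operators and partial isometries *)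

Section OperatorFacts.
Variables (R : realType) (H : hilbertType R).
Implicit Types (x y z : H) (A B C D P T V : H -> H).

Lemma polarization C D : linear C -> linear D -> (forall x, hn (C x) = hn (D x)) ->
  forall x y, ip (C x) (C y) = ip (D x) (D y).
Proof.
move=> lC lD h.
have hRe x y : complex.Re (ip (C x) (C y)) = complex.Re (ip (D x) (D y)).
  have := h (x + y); rewrite (opD lC) (opD lD) !hnD !h; lra.
move=> x y; apply/eqP; rewrite eq_complex hRe eqxx /=; apply/eqP.
have := hRe ('i%C *: x) y; rewrite (opZ lC) (opZ lD) !dotZl !cReM /= !mul0r !mul1r; lra.
Qed.

Lemma null_proj A : bounded_lin A -> exists P,
  [/\ is_orthogonal_projection (orthogonal_complement (nullspace A)) P,
      forall x, A (P x) = A x & forall x, A x = 0 -> P x = 0].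
Proof.
move=> bA; have lN := null_lin_sub bA.1.
have [Q hQ] := orth_proj_exists lN (null_seq_closed bA).
have AQ x : A (Q x) = 0 by have [] := hQ x.
exists (fun x => x - Q x); split.
- move=> x; split; first by have [] := hQ x.
  by rewrite opprB addrC subrK => y oy; apply/dot_eq0C/oy; apply: AQ.
- by move=> x; rewrite (opB bA.1) AQ subr0.
- by move=> x Ax; rewrite (orth_proj_id lN hQ) // subrr.
Qed.

(** The lower bound closes the range, and by self-adjointness the orthogonal complement of the range
    is the kernel, which is 0. *)
Lemma sa_surj T (c : R) : self_adjoint T -> 0 < c -> (forall x, c * nm x <= nm (T x)) ->
  forall y, exists x, T x = y.
Proof.
move=> [bT sT] c0 hT y.
have lS := range_lin_sub bT.1.
have [Q hQ] := orth_proj_exists lS (range_seq_closed bT c0 hT).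
have [[x _ Qx] oy] := hQ y; exists x.
have Tv : T (y - Q y) = 0.
  by apply: ip_inj => z; rewrite sT dot0l; apply: oy; exists z.
have := hT (y - Q y); rewrite Tv nm0 pmulr_rle0 // => h.
have /eqP : y - Q y = 0 by apply: nm_eq0; apply/eqP; rewrite eq_le h nm_ge0.
by rewrite subr_eq0 Qx => /eqP.
Qed.

Lemma partial_isometry_ip V P : partial_isometry V ->
  is_orthogonal_projection (orthogonal_complement (nullspace V)) P ->
  (forall x, V (P x) = V x) -> forall x y, ip (V x) (V y) = ip (P x) y.
Proof.
move=> [/bopP bV isoV] hP VP x y.
have lS := orth_lin_sub (nullspace V).
have [bP sP] := orth_proj_sa lS hP.
rewrite (polarization bV.1 bP.1) ?sP => [|z].
  by rewrite (orth_proj_id lS hP) //; apply: (orth_proj_mem hP).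
rewrite -VP -!nm2; congr (_ ^+ 2).
have := isoV _ (orth_proj_mem hP z); rewrite !normE => -[] //.
Qed.

Lemma partial_isometry_le V : partial_isometry V -> forall x, nm (V x) <= nm x.
Proof.
move=> pV x; have bV : bounded_lin V by case: pV => /bopP.
have [Q [hQ VQ _]] := null_proj bV.
have lS := orth_lin_sub (nullspace V).
rewrite le_nm {1}/hn /sqn (partial_isometry_ip pV hQ VQ).
apply: le_trans (Re_ip_le _ _) _; rewrite -nm2 expr2.
by rewrite ler_wpM2r ?nm_ge0 // (orth_proj_nm hQ).
Qed.

End OperatorFacts.

(** * The polar factor among the partial isometries of the orbit *)

Section PolarPart.
Variables (R : realType) (H : hilbertType R) (Phi : (nat -> R) -> R).
Hypotheses (infH : infinite_dimensional H) (hPhi : symmetric_norming_function Phi).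
Variables (A V : H -> H).
Hypothesis bA : bounded_lin A.
Hypothesis orbV : two_sided_orbit (symmetric_ideal Phi) A V.
Hypothesis pV : partial_isometry V.
Implicit Types (x y z : H).

Let bV : bounded_lin V. Proof. by case: pV => /bopP. Qed.
Let lA := bA.1.
Let lV := bV.1.
Let bD : bounded_lin (A \- V) := bopB bA bV.
Let bA' := adj_bop bA.
Let bV' := adj_bop bV.

(** With V = GAX and KX = 1, A - V = A(K - 1)X - (G - 1)AX. *)
Lemma two_sided_orbit_ideal : symmetric_ideal Phi (A \- V).
Proof.
case: orbV => G [K [X [[/bopP bG _ JG] [/bopP bK _ JK] [/bopP bX KX _] VE]]].
have bG1 : bounded_lin (G \- idfun) by apply: bopB bG (bop_id H).
have bK1 : bounded_lin (K \- idfun) by apply: bopB bK (bop_id H).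
have [_ [M [M0 hM]]] := bA.
have bT1 : bounded_lin (A \o ((K \- idfun) \o X)) := bop_comp bA (bop_comp bK1 bX).
have bT2 : bounded_lin (fun x => - (G \- idfun) (A (X x))) := bopN (bop_comp bG1 (bop_comp bA bX)).
apply: (idealD infH hPhi bD bT1 bT2).
- apply: (ideal_dom infH hPhi (c := M) (Y := X) bT1 JK bK1 bX M0) => x; exact: hM.
- apply: (ideal_dom infH hPhi (c := 1) (Y := A \o X) bT2 JG bG1 (bop_comp bA bX) ler01).
  by move=> x; rewrite mul1r nmN.
- move=> x; rewrite VE /=.
  rewrite -[K (X x)]/((K \o X) x) KX (opB lA) /= opprB.
  by rewrite addrA subrK.
Qed.

Let JD := two_sided_orbit_ideal.
Let aD : approximable (A \- V). Proof. by have [] := (idealP Phi infH bD).1 JD. Qed.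

(** As G is injective, K^-1 maps N(V) into N(A), so its adjoint, the [X] of the statement, maps
    N(A)^perp into N(V)^perp. The lower bound for A on N(A)^perp is inherited from V, which is
    isometric on N(V)^perp. *)
Lemma orbit_facts : exists P X : H -> H, exists M : R,
  [/\ is_orthogonal_projection (orthogonal_complement (nullspace A)) P /\
      (forall x, A (P x) = A x), 0 < M /\ (forall x, nm (P x) <= M * nm (A x)),
      bounded_lin X /\ (forall z, X z = 0 -> z = 0), approximable (fun x => X x - x) &
      forall z y, P z = z -> ip (V (X z)) (V y) = ip (X z) y].
Proof.
case: orbV => G [K [X [[/bopP bG [Y [_ GY YG]] JG] [/bopP bK _ JK] [/bopP bX KX XK] VE]]].
have {}KX x : K (X x) = x := congr1 (fun f => f x) KX.
have {}XK x : X (K x) = x := congr1 (fun f => f x) XK.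
have {}YG x : Y (G x) = x := congr1 (fun f => f x) YG.
have {}VE x : V x = G (A (X x)) := congr1 (fun f => f x) VE.
have bK1 : bounded_lin (K \- idfun) by apply: bopB bK (bop_id H).
have [aK _] := (idealP Phi infH bK1).1 JK.
have bX' := adj_bop bX.
have [P [hP AP P0]] := null_proj bA.
have [Q [hQ VQ Q0]] := null_proj bV.
have lS := orth_lin_sub (nullspace A); have lSV := orth_lin_sub (nullspace V).
have VV := partial_isometry_ip pV hQ VQ.
have AX y : V y = 0 -> A (X y) = 0.
  by rewrite VE => h; rewrite -[A _]YG h -[RHS](YG 0) (op0 bG.1).
have [_ [MG [MG0 hMG]]] := bG; have [_ [MX [MX0 hMX]]] := bX.
exists P, (adjoint X), (MX * MG + 1); split.
- by [].
- split; first by rewrite ltr_wpDl // mulr_ge0.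
  (* Here X is K^-1. V kills Kx - QKx, so A, and with it P, kills x - XQKx. The norm of QKx is that
     of VKx = GAx. *)
  move=> x; have e : P x = P (X (Q (K x))).
    apply/eqP; rewrite -subr_eq0 -(opB (orth_proj_bop lS hP).1); apply/eqP/P0.
    rewrite -{1}[x]XK -(opB bX.1); apply: AX.
    by rewrite (opB lV) VQ subrr.
  rewrite e; apply: le_trans (orth_proj_nm hP _) _.
  apply: le_trans (hMX _) _.
  have -> : nm (Q (K x)) = nm (G (A x)).
    rewrite -[x in RHS]XK -VE /nm; congr Num.sqrt.
    have QQ t : ip (Q t) (Q t) = ip (Q t) t.
      rewrite -(orth_proj_sa lSV hQ).2 (orth_proj_id lSV hQ) //.
      exact: (orth_proj_mem hQ).
    by rewrite /hn /sqn VV QQ.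
  have := hMG (A x); have := nm_ge0 (A x) => h1 h2.
  have := ler_wpM2l MX0 h2; lra.
- split => // z hz; apply: ip_inj => y; rewrite -[y]XK -adjEr // hz !dot0l //.
- have bC : bounded_lin (fun x => X x - x) := bopB bX (bop_id H).
  have aC : approximable (fun x => X x - x).
    have := appr_compl (bopN (bop_id H)) (appr_compr bX aK); congr approximable.
    by apply/funext => x /=; rewrite KX opprB.
  have := appr_adj bC aC; congr approximable; apply/funext => y.
  by apply: ip_injr => z; rewrite -adjE // dotBl dotBr adjE.
- move=> z y Pz; rewrite VV (orth_proj_id lSV hQ) // => v Vv.
  have [Sz _] := hP z; rewrite Pz in Sz.
  by rewrite adjEr //; apply: Sz; apply: AX.
Qed.

Let B := abs_op A.
Let bB : bounded_lin B := abs_bop bA.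
Let lB := bB.1.
Let sB : forall x y, ip (B x) y = ip x (B y) := (abs_sa bA).2.

Section WithFacts.
Variables (P X : H -> H) (M : R).
Hypothesis hP : is_orthogonal_projection (orthogonal_complement (nullspace A)) P.
Hypothesis AP : forall x, A (P x) = A x.
Hypothesis M0 : 0 < M.
Hypothesis hM : forall x, nm (P x) <= M * nm (A x).
Hypothesis bX : bounded_lin X.
Hypothesis injX : forall z, X z = 0 -> z = 0.
Hypothesis aX : approximable (fun x => X x - x).
Hypothesis VX : forall z y, P z = z -> ip (V (X z)) (V y) = ip (X z) y.

Let lS := orth_lin_sub (nullspace A).
Let saP := orth_proj_sa lS hP.
Let bP := saP.1.
Let sP := saP.2.
Let lP := bP.1.

Let PP x : P (P x) = P x.
Proof. by apply: (orth_proj_id lS hP); apply: (orth_proj_mem hP). Qed.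

Let BP x : B (P x) = B x.
Proof.
apply/eqP; rewrite -subr_eq0 -(opB lB); apply/eqP/nm_eq0.
by rewrite /B abs_nm // (opB lA) AP subrr nm0.
Qed.

Let PB x : P (B x) = B x.
Proof. by apply: ip_inj => y; rewrite sP !sB BP. Qed.

Let P0 x : A x = 0 <-> P x = 0.
Proof.
split => h; last by rewrite -AP h (op0 lA).
by apply: nm_eq0; apply/eqP; rewrite eq_le nm_ge0 andbT; have := hM x; rewrite h nm0 mulr0.
Qed.

(** |A| + (1 - P) is self-adjoint and bounded below, hence invertible, and agrees with |A| on the
    range of P; U is A composed with its inverse. *)
Lemma polar_exists : exists U, [/\ partial_isometry U, nullspace U = nullspace A & A = U \o B].
Proof.
pose S0 x := B x + (x - P x).
have bS0 : bounded_lin S0 := bopD bB (bopB (bop_id H) bP).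
have saS0 : self_adjoint S0.
  by split => // x y; rewrite /S0 dotDl dotDr dotBl dotBr sB sP.
have hS0 x : hn (S0 x) = hn (B x) + hn (x - P x).
  by apply: hnDd; rewrite -PB sP (opB lP) PP subrr dot0r.
have hx x : hn x = hn (P x) + hn (x - P x).
  rewrite -hnDd; first by rewrite addrC subrK.
  by rewrite dotBr !sP PP subrr.
pose c := (M + 1)^-1.
have c0 : 0 < c by rewrite invr_gt0 addr_gt0.
have below x : c * nm x <= nm (S0 x).
  rewrite -ler_sqr ?nnegrE ?mulr_ge0 ?nm_ge0 ?(ltW c0) // exprMn !nm2 exprVn ler_pdivrMl
    ?exprn_gt0 ?addr_gt0 //.
  rewrite hx hS0.
  have h1 : hn (P x) <= M ^+ 2 * hn (B x).
    by rewrite -!nm2 -exprMn ler_sqr ?nnegrE ?mulr_ge0 ?nm_ge0 ?(ltW M0) // /B abs_nm.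
  move: h1 (hn_ge0 (B x)) (hn_ge0 (x - P x)) M0.
  move: (hn (P x)) (hn (B x)) (hn (x - P x)) => p b d h1 b0 d0 m0.
  have mb : 0 <= M * b by rewrite mulr_ge0 // ltW.
  have md : 0 <= M * d by rewrite mulr_ge0 // ltW.
  have mmd : 0 <= M * (M * d) by rewrite mulr_ge0 // ltW.
  nra.
have /boolp.choice[T hT] := sa_surj saS0 c0 below.
have injS0 x y : S0 x = S0 y -> x = y.
  move=> h; apply/eqP; rewrite -subr_eq0; apply/eqP/nm_eq0/eqP; rewrite eq_le nm_ge0 andbT.
  by have := below (x - y); rewrite (opB bS0.1) h subrr nm0 pmulr_rle0.
have lT : linear T.
  by move=> a x y; apply: injS0; rewrite bS0.1 !hT.
have TB x : T (B x) = P x by apply: injS0; rewrite hT /S0 BP PP subrr addr0.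
have Py y : P y = B (T y).
  rewrite -{1}[y]hT /S0 (opD lP) (opB lP) PP subrr addr0 PB //.
have nmU y : nm (A (T y)) = nm (P y) by rewrite Py /B abs_nm.
have nullU : nullspace (A \o T) = nullspace A.
  apply/seteqP; split => y; rewrite /nullspace /= => h.
    by apply/P0/nm_eq0; rewrite -nmU h nm0.
  by apply: nm_eq0; rewrite nmU (P0 y).1 // nm0.
exists (A \o T); split => //.
- split.
    apply/bopP; split; first by move=> a x y /=; rewrite lT lA.
    by exists 1; split => // y; rewrite mul1r /= nmU; apply: (orth_proj_nm hP).
  by rewrite nullU => y Sy; rewrite !normE /= nmU (orth_proj_id lS hP).
- by apply/funext => x /=; rewrite TB AP.
Qed.

Let U := polar_isometry A.

Let U_spec : [/\ partial_isometry U, nullspace U = nullspace A & A = U \o B].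
Proof.
have [U0 hU] := polar_exists.
have : [set V | [/\ partial_isometry V, nullspace V = nullspace A &
    A = V \o abs_op A]] U by apply: xgetPex; exists U0.
by [].
Qed.

Let bU : bounded_lin U. Proof. by case: U_spec => -[/bopP]. Qed.
Let lU := bU.1.
Let AE x : A x = U (B x). Proof. by case: U_spec => _ _ {1}->. Qed.

Let UP x : U (P x) = U x.
Proof.
apply/eqP; rewrite -subr_eq0 -(opB lU); apply/eqP.
have [_ nU _] := U_spec; have : nullspace A (P x - x).
  by rewrite /nullspace /= (opB lA) AP subrr.
by rewrite -nU.
Qed.

Let UU x y : ip (U x) (U y) = ip (P x) y.
Proof.
have [pU nU _] := U_spec; apply: (partial_isometry_ip pU _ UP).
by rewrite nU.
Qed.

Let W x := B x - P x.
Let bW : bounded_lin W := bopB bB bP.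
Let lW := bW.1.
Let saW : self_adjoint W. Proof. by split => // x y; rewrite dotBl dotBr sB sP. Qed.
Let PW x : P (W x) = W x. Proof. by rewrite (opB lP) PB PP. Qed.

(** A*A - P = A*(A - V)P + (A - V)*VP + (V*V - 1)P is compact; in the last term V*V fixes XP and X -
    1 is compact. It also equals (|A| + 1)W, and |A| + 1 does not decrease norms, so W is
    approximable as well. *)
Let aW : approximable W.
Proof.
pose VV x := adjoint V (V x).
have VVX x : VV (X (P x)) = X (P x).
  by apply: ip_inj => y; rewrite adjEr // VX.
pose C x := adjoint A (A x) - P x.
have aC : approximable C.
  have a1 : approximable (fun x => adjoint A ((A \- V) (P x))).
    exact: appr_compl bA' (appr_compr bP aD).
  have a2 : approximable (fun x => adjoint (A \- V) (V (P x))).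
    exact: appr_compr (bop_comp bV bP) (appr_adj bD aD).
  have bVV1 : bounded_lin (fun x => VV x - x) by apply: bopB (bop_comp bV' bV) (bop_id H).
  have a3 : approximable (fun x => VV (X (P x) - P x) - (X (P x) - P x)).
    exact: appr_compl bVV1 (appr_compr bP aX).
  have := apprB (apprD a1 a2) a3; congr approximable; apply/funext => x.
  apply: ip_inj => y.
  have lVV := (bop_comp bV' bV).1.
  have -> : VV (X (P x) - P x) = X (P x) - VV (P x).
    by rewrite -[in RHS]VVX -(opB lVV).
  rewrite /C /VV !(dotBl, dotDl) !(adjEr bA) (adjEr bD) (adjEr bV) /=.
  by rewrite !dotBl !dotBr AP; ring.
apply: dom_appr aC => x.
have -> : C x = B (W x) + W x.
  by rewrite /W (opB lB) BP /C -(abs_opP bA).2 addrA subrK.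
rewrite le_nm hnD; have := abs_Re_ge0 (W x) bA; have := hn_ge0 (B (W x)); rewrite -/B; lra.
Qed.

Lemma polar_diag : exists e w, [/\ orthonormal_seq e, forall i, W (e i) = (w i)%:C *: e i,
  svd (A \- U) (fun i => `|w i|) e & nonincreasing_seq (fun i => `|w i|)].
Proof.
have cW := compact_seqc (appr_compact bW aW).
have [e [w [oe We hW mw w0]]] := spectral_thm infH saW cW.
exists e, w; split => //.
have DE x : (A \- U) x = U (W x) by rewrite /= AE -[in U x]UP -(opB lU) // UP.
have nD x y : ip ((A \- U) x) ((A \- U) y) = ip (W x) (W y) by rewrite !DE UU PW.
split => //.
- move=> i x; rewrite nD We dotZl -saW.2 We dotZl mulrA -rmorphM -expr2.
  by rewrite real_normK ?num_real.
- by move=> n x /hW; rewrite /nm /hn /sqn nD.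
Qed.

Lemma polar_dist_appr : bounded_lin (A \- U) /\ approximable (A \- U).
Proof.
split; first exact: bopB.
by have [e [w [_ _ h _]]] := polar_diag; apply: svd_appr h.
Qed.

Section Majorization.
Variables (e : nat -> H) (w : nat -> R).
Hypothesis oe : orthonormal_seq e.
Hypothesis We : forall i, W (e i) = (w i)%:C *: e i.
Hypothesis mw : nonincreasing_seq (fun i => `|w i|).

(** t = 1 serves the norm inequality, some t > 1 the equality case. [key_inequality] wants nonzero
    eigenvalues: a zero w_n adds nothing and is dropped by induction, while a nonzero one makes all
    earlier ones nonzero by monotonicity. *)
Lemma polar_majorized_scaled (t : R) s f n : 0 < t ->
  (forall x, 0 <= complex.Re (ip (P x + t%:C *: W x) x)) ->
  svd (fun x => U (P x + t%:C *: W x) - V x) s f ->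
  \sum_(i < n) t * `|w i| <= \sum_(i < n) s i.
Proof.
move=> t0 pos hs; have s0 : forall i, 0 <= s i by case: hs.
elim: n => [|n IH]; first by rewrite !big_ord0.
have [wn|wn] := eqVneq (w n) 0.
  by rewrite !big_ord_recr /= wn normr0 mulr0 addr0; apply: le_trans IH _; rewrite lerDl.
have tC : Num.conj t%:C = t%:C by exact: conj_realE.
have saW' : self_adjoint (fun x => t%:C *: W x).
  split; first exact: bopZ.
  by move=> x y; rewrite dotZl dotZr tC saW.2.
have aUV : approximable (fun x => U x - V x).
  have := apprB aD polar_dist_appr.2; congr approximable; apply/funext => x /=.
  by rewrite opprB [LHS]addrC addrA subrK.
have We' i : t%:C *: W (e i) = (t * w i)%:C *: e i.
  by rewrite We scalerA -rmorphM.
have wn0 i : (i < n.+1)%N -> t * w i != 0.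
  move=> ni; rewrite mulf_neq0 ?(gt_eqF t0) // -normr_gt0.
  apply: (@lt_le_trans _ _ `|w n|); first by rewrite normr_gt0.
  exact: mw.
have PtW x : P (t%:C *: W x) = t%:C *: W x by rewrite (opZ lP) PW.
have := key_inequality bU saP PP UU saW' PtW pos bV (partial_isometry_le pV)
  bX injX aX VX aUV oe We' hs wn0.
by under eq_bigr => i _ do rewrite normrM (gtr0_norm t0).
Qed.

Lemma polar_majorized s f n : svd (A \- V) s f ->
  \sum_(i < n) `|w i| <= \sum_(i < n) s i.
Proof.
move=> hs; have E x : P x + W x = B x by rewrite addrC subrK.
have := @polar_majorized_scaled 1 s f n ltr01.
have one x : P x + 1%:C *: W x = B x by rewrite rmorph1 scale1r E.
under eq_bigr => i _ do rewrite mul1r; apply.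
  by move=> x; rewrite one; apply: abs_Re_ge0.
by rewrite (_ : (fun x => _) = A \- V) //; apply/funext => x; rewrite one /= AE.
Qed.

(* [<|A|x, x> >= ||A|x|^2 / ||A||] and [|Ax| >= |Px| / M], so that [P + t(|A| - P)]
   remains positive for some [t > 1]. *)
Lemma polar_margin : exists2 d : R, 0 < d &
  forall x, 0 <= complex.Re (ip (P x + (1 + d)%:C *: W x) x).
Proof.
have [_ [N0 [N00 hN0]]] := bB.
pose N := N0 + 1; have Npos : 0 < N by rewrite ltr_wpDl.
have hN x : nm (B x) <= N * nm x.
  by apply: le_trans (hN0 x) _; rewrite ler_wpM2r ?nm_ge0 // lerDl.
have h1 x : hn (B x) <= N * complex.Re (ip (B x) x).
  (* This test vector gives <Bx, x> - (2/N) |Bx|^2 + N^-2 <BBx, Bx> >= 0, where the last term is at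
     most |Bx|^2 / N. *)
  have := abs_Re_ge0 (x - N^-1%:C *: B x) bA; rewrite -/B.
  have NC : Num.conj N^-1%:C = N^-1%:C by exact: conj_realE.
  rewrite (opB lB) (opZ lB) dotBl !dotBr !dotZl !dotZr NC !cReB !cReZ.
  have e1 : complex.Re (ip (B (B x)) x) = hn (B x) by rewrite sB.
  have e2 : complex.Re (ip (B x) (B x)) = hn (B x) by [].
  rewrite e1 e2 => h.
  have h2 : complex.Re (ip (B (B x)) (B x)) <= N * hn (B x).
    apply: le_trans (Re_ip_le _ _) _; rewrite -nm2 expr2 mulrA.
    by rewrite ler_wpM2r ?nm_ge0.
  move: h h2; move: (complex.Re (ip (B (B x)) (B x))) (complex.Re (ip (B x) x)) (hn (B x)).
  move=> p q b h h2.
  have h3 : N^-1 * (N^-1 * p) <= N^-1 * b.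
    by rewrite ler_pM2l ?invr_gt0 // ler_pdivrMl.
  have h4 : N^-1 * b <= q by lra.
  by move: h4; rewrite ler_pdivrMl.
pose d := (N * M ^+ 2)^-1.
have d0 : 0 < d by rewrite invr_gt0 mulr_gt0 // exprn_gt0.
have h2 x : d * hn (P x) <= complex.Re (ip (B x) x).
  rewrite ler_pdivrMl ?mulr_gt0 ?exprn_gt0 //.
  have h3 : hn (P x) <= M ^+ 2 * hn (B x).
    by rewrite -!nm2 -exprMn ler_sqr ?nnegrE ?mulr_ge0 ?nm_ge0 ?(ltW M0) // /B abs_nm.
  apply: le_trans h3 _; rewrite [N * _]mulrC -[leRHS]mulrA ler_pM2l ?exprn_gt0 //.
exists d => // x.
have -> : P x + (1 + d)%:C *: W x = (1 + d)%:C *: B x - d%:C *: P x.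
  rewrite /W scalerBr addrCA; congr (_ + _).
  by rewrite rmorphD /= scalerDl scale1r opprD addrA subrr sub0r.
rewrite dotBl !dotZl cReB !cReZ.
have hPP : complex.Re (ip (P x) x) = hn (P x) by rewrite /hn /sqn -sP PP.
rewrite hPP; have := h2 x; have := hn_ge0 (P x); nra.
Qed.

End Majorization.

Lemma polar_weakly_majorized :
  weakly_majorized (singular_values (A \- U)) (singular_values (A \- V)).
Proof.
have [e [w [oe We h0 mw]]] := polar_diag.
have [f hf] := singular_svd infH bD aD.
by move=> n; rewrite (svd_singular polar_dist_appr.1 h0); apply: (polar_majorized oe We mw n.+1 hf).
Qed.

Lemma polar_norm_le_with :
  (symmetric_norm Phi (A \- U)%R <= symmetric_norm Phi (A \- V)%R)%E.
Proof.
have [bD0 aD0] := polar_dist_appr.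
by apply: (symmetric_norm_le infH hPhi) => // _; apply: polar_weakly_majorized.
Qed.

Lemma polar_norm_eq_with : strictly_schur_convex H Phi ->
  symmetric_norm Phi (A \- U) = symmetric_norm Phi (A \- V) -> V = U.
Proof.
move=> ssc eqn; have [bD0 aD0] := polar_dist_appr.
have JD0 : symmetric_ideal Phi (A \- U).
  split; first exact/(compactP infH bD0).
  by rewrite eqn; case: JD.
have sE : singular_values (A \- V) = singular_values (A \- U).
  by apply: ssc => //; apply: polar_weakly_majorized.
have [e [w [oe We h0 mw]]] := polar_diag.
have [f hf] := singular_svd infH bD aD.
pose s := singular_values (A \- V).
have wE i : `|w i| = s i by rewrite /s sE (svd_singular bD0 h0).
have {}h0 : svd (A \- U) s e by rewrite /s sE (svd_singular bD0 h0).
have [d d0 pos] := polar_margin.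
pose T x := U (P x + (1 + d)%:C *: W x) - V x.
have TE x : T x = (A \- V) x + d%:C *: (A \- U) x.
  have -> : (A \- U) x = U (W x) by rewrite /= AE -[in U x]UP -(opB lU).
  rewrite /T rmorphD /= scalerDl scale1r addrA (addrC (P x)) subrK (opD lU) (opZ lU) -AE.
  by rewrite addrAC.
have bT : bounded_lin T.
  apply: bopB => //; apply: (bop_comp bU); apply: bopD => //; exact: bopZ.
have aT : approximable T.
  rewrite (_ : T = fun x => (A \- V) x + d%:C *: (A \- U) x); last exact/funext.
  exact: apprD aD (apprZ _ aD0).
have [u hu] := singular_svd infH bT aT.
set sg := singular_values T in hu.
pose lv := left_sv T sg u.
have [[ou _] _ _ _ _] := hu.
have s0 i : 0 <= s i by case: hf.
have Re_sg k : sg k = complex.Re (ip ((A \- V) (u k)) (lv k)) +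
    d * complex.Re (ip ((A \- U) (u k)) (lv k)).
  by rewrite -(svd_left_ip hu k) [X in ip X _]TE dotDl cReD dotZl cReZ.
have d1 : 0 < 1 + d by rewrite addr_gt0.
(* The scaled inequality bounds the sum of the [sg k] below by 1 + d times that of the [s k], while
   Ky Fan bounds its two parts above by 1 and d times it. Both bounds are attained, for every n,
   hence also term by term. *)
have tight n : \sum_(k < n) complex.Re (ip ((A \- V) (u k)) (lv k)) = \sum_(k < n) s k /\
    \sum_(k < n) complex.Re (ip ((A \- U) (u k)) (lv k)) = \sum_(k < n) s k.
  have l1 := ky_fan_left hu n bD hf; have l2 := ky_fan_left hu n bD0 h0.
  have := polar_majorized_scaled oe We mw n d1 pos hu.
  rewrite -mulr_sumr; under eq_bigr => i _ do rewrite wE.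
  under [X in _ <= X]eq_bigr => i _ do rewrite Re_sg.
  rewrite big_split /= -mulr_sumr mulrDl mul1r.
  move: l1 l2; rewrite -/lv -/s.
  move: (\sum_(k < n) complex.Re (ip ((A \- V) (u k)) (lv k))).
  move: (\sum_(k < n) complex.Re (ip ((A \- U) (u k)) (lv k))) (\sum_(k < n) s k).
  by move=> p q r h1 h2 h3; split; apply/eqP; rewrite eq_le; apply/andP; split => //; nra.
have tight1 k : complex.Re (ip ((A \- V) (u k)) (lv k)) = s k /\
    complex.Re (ip ((A \- U) (u k)) (lv k)) = s k.
  have [h1 h2] := tight k; have [] := tight k.+1; rewrite !big_ord_recr /= h1 h2.
  by move=> /addrI -> /addrI ->.
(* Re <D u_k, lv_k> = s_k with |lv_k| <= 1 gives |D u_k| >= s_k; extremality makes this an equality,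
   and the equality case of Cauchy-Schwarz gives D u_k = s_k lv_k. *)
have same D : bounded_lin D -> (exists g, svd D s g) ->
    (forall k, complex.Re (ip (D (u k)) (lv k)) = s k) ->
    (forall k, D (u k) = (s k)%:C *: lv k) /\
    (forall n x, perpn u n x -> nm (D x) <= s n * nm x).
  move=> bD1 [g hg] hre.
  have lv1 k : hn (lv k) <= 1 := hn_left_sv_le hu k.
  have ge k : s k ^+ 2 <= hn (D (u k)).
    rewrite -nm2 ler_sqr ?nnegrE ?nm_ge0 // -hre; apply: le_trans (Re_ip_le _ _) _.
    by rewrite ler_piMr ?nm_ge0 // nm_leP // expr1n.
  split; last by move=> n x; apply: (svd_tail_of bD1 hg ou).
  move=> k; have e1 := svd_max_eq k bD1 hg ou ge.
  apply/eqP; rewrite -subr_eq0; apply/eqP/hn_eq0/eqP; rewrite eq_le hn_ge0 andbT.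
  have sC : Num.conj (s k)%:C = (s k)%:C by exact: conj_realE.
  rewrite hnB hnZr e1 dotZr sC cReZ hre.
  have := lv1 k; have := sqr_ge0 (s k); nra.
have [D1 t1] := same _ bD (ex_intro _ f hf) (fun k => (tight1 k).1).
have [D2 t2] := same _ bD0 (ex_intro _ e h0) (fun k => (tight1 k).2).
have st : forall d, 0 < d -> exists n, s n < d by case: hf.
have := ons_ext bD bD0 ou (fun k => etrans (D1 k) (esym (D2 k))) t1 t2 s0 st.
move=> eqD; apply/funext => x; have /= := congr1 (fun f => f x) eqD.
by move/addrI/oppr_inj.
Qed.

End WithFacts.

Lemma polar_norm_le : (symmetric_norm Phi (A \- polar_isometry A)%R <=
  symmetric_norm Phi (A \- V)%R)%E.
Proof.
have [P [X [M [[hP AP] [M0 hM] [bX injX] aX VX]]]] := orbit_facts.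
exact: (polar_norm_le_with hP AP M0 hM bX injX aX VX).
Qed.

Lemma polar_norm_eq : strictly_schur_convex H Phi ->
  symmetric_norm Phi (A \- polar_isometry A) = symmetric_norm Phi (A \- V) ->
  V = polar_isometry A.
Proof.
have [P [X [M [[hP AP] [M0 hM] [bX injX] aX VX]]]] := orbit_facts.
exact: (polar_norm_eq_with hP AP M0 hM bX injX aX VX).
Qed.

End PolarPart.

Theorem theorem3p11 (R : realType) (H : hilbertType R)
    (sepH : separable H) (infH : infinite_dimensional H)
    (Phi : (nat -> R) -> R) (hPhi : symmetric_norming_function Phi)
    (A : H -> H) (hA : closed_range_op A) :
  let J : set (H -> H) := symmetric_ideal Phi in
  let VA := polar_isometry A in
  let Astar_dag := moore_penrose (adjoint A) in
  let admissible1 (V : H -> H) := two_sided_orbit J A V /\ partial_isometry V in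
  let admissible2 (B : H -> H) :=
    [/\ left_orbit J A B,
        (forall x, range A x -> A (adjoint B x) = x) &
        (forall x, range B x -> B (adjoint A x) = x)] in
  [/\ (forall V, admissible1 V ->
        (symmetric_norm Phi (A \- VA)%R <= symmetric_norm Phi (A \- V)%R)%E),
      (forall B, admissible2 B ->
        (symmetric_norm Phi (A \- Astar_dag)%R <= symmetric_norm Phi (A \- B)%R)%E),
      (strictly_schur_convex H Phi -> forall V, admissible1 V ->
        symmetric_norm Phi (A \- VA)%R = symmetric_norm Phi (A \- V)%R ->
        V = VA) &
      (strictly_schur_convex H Phi -> forall B, admissible2 B ->
        symmetric_norm Phi (A \- Astar_dag)%R = symmetric_norm Phi (A \- B)%R ->
        B = Astar_dag)].
Proof.
move=> J VA Astar_dag admissible1 admissible2.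
have bA : bounded_lin A by have [/bopP] := hA.
split.
- by move=> V [orbV pV]; exact: (polar_norm_le infH hPhi bA orbV pV).
- by move=> B [orbB AB BA]; exact: (moore_penrose_norm_le infH hPhi hA orbB AB BA).
- by move=> ssc V [orbV pV]; exact: (polar_norm_eq infH hPhi bA orbV pV ssc).
- move=> ssc B [orbB AB BA].
  exact: (moore_penrose_norm_eq infH hPhi hA orbB AB BA ssc).
Qed.
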